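(* Let $M$ be an $n$-dimensional projective manifold, $L$ a very ample line bundle on $M$, $k\ge1$ an integer, and $\gamma\in\mathrm{Aut}(M)$ a biholomorphic automorphism of $M$. Then pullback of Kähler metrics $\omega\mapsto\gamma^*\omega$ gives a diffeomorphism $$\gamma^* : \mathcal{B}_{M,L^k}\to\mathcal{B}_{M,\gamma^*L^k},$$ and it satisfies $\gamma^*G_{Ca,M,L^k}=G_{Ca,M,\gamma^*L^k}$ and $\gamma^*G_{Ma,M,L^k}=G_{Ma,M,\gamma^*L^k}$, where for a Riemannian metric $G$ on $\mathcal{B}_{M,L^k}$, $\gamma^*G$ denotes the metric on $\mathcal{B}_{M,\gamma^*L^k}$ obtained by transporting $G$ along the diffeomorphism $\gamma^*$, i.e. $(\gamma^*G)_{\gamma^*\omega}(d\gamma^*_\omega\dot\varphi,d\gamma^*_\omega\dot\phi)=G_\omega(\dot\varphi,\dot\phi)$ for all $\omega\in\mathcal{B}_{M,L^k}$ and $\dot\varphi,\dot\phi\in T_\omega\mathcal{B}_{M,L^k}$. (That is, $\gamma^*$ is an isometry for the Calabi metrics and for the Mabuchi metrics.)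
   Context: Projective manifolds are compact connected complex manifolds embeddable in a complex projective space. Bergman space. For a very ample line bundle $L$ on $M$ and an integer $k\ge 1$, let $N_k = \dim H^0(M,L^k)-1$. Each basis of $H^0(M,L^k)$ gives an embedding $F: M\to \mathbb{C}P^{N_k}$, and $$\mathcal{B}_{M,L^k} = \left\{ \tfrac1k F^*\omega_{FS} : F: M\to\mathbb{C}P^{N_k} \text{ given by a basis of } H^0(M,L^k)\right\},$$ where $\omega_{FS}=\frac{\sqrt{-1}}{2\pi}\partial\bar\partial\log|Z|^2$ is the Fubini-Study metric (in the class $c_1(\mathcal{O}(1))$). $\mathcal{B}_{M,\gamma^*L^k}$ is the same space for the very ample line bundle $\gamma^*L$ and the same $k$ (with $\gamma^* L^k=(\gamma^*L)^k$). Fix a Kähler metric $\omega_0\in c_1(L)$; then $\mathcal{B}_{M,L^k}$ is contained in the space $\mathcal{K}_{[\omega_0]}$ of all Kähler metrics in the class $[\omega_0]=c_1(L)$. Smooth structure. Fix a basis $\{S_i\}_{i=0}^{N_k}$ of $H^0(M,L^k)$. For $A=(a_{i,j})\in SL(N_k+1,\mathbb{C})$ let $\omega_A=\frac1k F_A^*\omega_{FS}$, where $F_A$ is the embedding given by the basis $\{\sum_j a_{i,j}S_j\}_{i}$. The map $[A]\mapsto\omega_A$ is a bijection $SU(N_k+1)\backslash SL(N_k+1,\mathbb{C})\to\mathcal{B}_{M,L^k}$, and $\mathcal{B}_{M,L^k}$ carries the finite-dimensional smooth manifold structure making it a diffeomorphism (independent of the choice of basis). Metrics. The tangent space $T_\omega\mathcal{K}_{[\omega_0]}$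 is identified with $C^\infty(M,\mathbb{R})/\mathbb{R}$ via $\dot\varphi\mapsto\sqrt{-1}\partial\bar\partial\dot\varphi$. Let $dV_\omega=\omega^{n}/n!$ and $\Delta_\omega\dot\varphi=\mathrm{tr}_\omega\sqrt{-1}\partial\bar\partial\dot\varphi$. The Calabi metric on $\mathcal{K}_{[\omega_0]}$ is $$G_{Ca}(\dot\varphi,\dot\phi)=\int_M \Delta_\omega\dot\varphi\,\Delta_\omega\dot\phi\,dV_\omega,$$ and the Mabuchi metric is $$G_{Ma}(\dot\varphi,\dot\phi)=\int_M\Big(\dot\varphi-\tfrac{1}{\mathrm{Vol}_\omega(M)}\int_M\dot\varphi\,dV_\omega\Big)\Big(\dot\phi-\tfrac{1}{\mathrm{Vol}_\omega(M)}\int_M\dot\phi\,dV_\omega\Big)dV_\omega .$$ Their restrictions to $\mathcal{B}_{M,L^k}$ are denoted $G_{Ca,M,L^k}$ and $G_{Ma,M,L^k}$; similarly $G_{Ca,M,\gamma^*L^k}$, $G_{Ma,M,\gamma^*L^k}$ are the restrictions to $\mathcal{B}_{M,\gamma^*L^k}$ of the Calabi and Mabuchi metrics on the space of Kähler metrics in $c_1(\gamma^*L)$. *)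

(* Defs.v *)
From HB Require Import structures.
From mathcomp Require Import all_boot all_order all_algebra.
From mathcomp Require Import complex.
From mathcomp Require Import all_classical all_reals all_analysis.

Set Implicit Arguments.
Unset Strict Implicit.
Unset Printing Implicit Defensive.

Import Order.TTheory GRing.Theory Num.Theory.
Import numFieldNormedType.Exports.

Local Open Scope classical_set_scope.
Local Open Scope ring_scope.

(* The wrapper makes Rocq see R[i] only as a numClosedFieldType, hence as a
   normed space over itself: 'rV[Cplx R]_n is C^n as a complex normed space. *)
Definition Cplx (R : realType) : numClosedFieldType := R[i].

Definition reC (R : realType) (z : Cplx R) : R := complex.Re z.
Definition imC (R : realType) (z : Cplx R) : R := complex.Im z.
Definition mkC (R : realType) (x y : R) : Cplx R := Complex x y.

(* Complex matrices as pairs of real matrices; real calculus on C^n or on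
   n x n complex matrices takes place in the latter real normed space. *)
Definition realify (R : realType) m n (A : 'M[Cplx R]_(m, n)) :
  'M[R]_(m, n) * 'M[R]_(m, n) := (map_mx (@reC R) A, map_mx (@imC R) A).
Definition cplxify (R : realType) m n (X : 'M[R]_(m, n) * 'M[R]_(m, n)) :
  'M[Cplx R]_(m, n) := \matrix_(i, j) mkC (X.1 i j) (X.2 i j).

Definition adjmx (R : realType) m n (A : 'M[Cplx R]_(m, n)) :
  'M[Cplx R]_(n, m) := (map_mx Num.conj A)^T.

(* C^infinity over K, for an open set U of a finite-dimensional space.  For
   K = R this is real smoothness; for K = C it is holomorphy (one complex
   derivative on an open set already entails all the others). *)
Fixpoint diff_order (K : numFieldType) (V W : normedModType K) (k : nat)
    (U : set V) (f : V -> W) : Prop :=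
  if k is k'.+1 then
    (forall x, U x -> differentiable f x) /\
    (forall v, diff_order k' U (fun x => 'D_v f x))
  else forall x, U x -> {for x, continuous f}.

Definition smooth_on (K : numFieldType) (V W : normedModType K)
    (U : set V) (f : V -> W) : Prop := forall k, diff_order k U f.

Definition smooth_near (K : numFieldType) (V W : normedModType K)
    (x : V) (f : V -> W) : Prop :=
  exists2 U, open_nbhs x U & smooth_on U f.

Record chart (T E : Type) := Chart {
  cdom : set T;
  cmap : T -> E;
  cinv : E -> T }.

Definition topological_chart (T E : topologicalType) (c : chart T E) : Prop :=
  [/\ open (cdom c) /\ open (cmap c @` cdom c),
      (forall p, cdom c p -> cinv c (cmap c p) = p),
      {within cdom c, continuous (cmap c)} &
      {within cmap c @` cdom c, continuous (cinv c)}].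

(* A space with a preferred chart chart_at p around each point p; the tangent
   space at p is C^n, through the chart chart_at p. *)
Record charted (R : realType) (n : nat) := Charted {
  carrier :> ptopologicalType;
  chart_at : carrier -> chart carrier 'rV[Cplx R]_n }.

Definition complex_manifold (R : realType) n (M : charted R n) : Prop :=
  [/\ hausdorff_space M,
      (forall p : M, topological_chart (chart_at p) /\ cdom (chart_at p) p) &
      forall p q : M,
        smooth_on (cmap (chart_at p) @` (cdom (chart_at p) `&` cdom (chart_at q)))
          (cmap (chart_at q) \o cinv (chart_at p))].

Section Maps.
Context {R : realType} {n m : nat} {M : charted R n} {M' : charted R m}.

Definition in_charts (F : M -> M') (p : M) : 'rV[Cplx R]_n -> 'rV[Cplx R]_m :=
  cmap (chart_at (F p)) \o F \o cinv (chart_at p).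

Definition holomorphic (F : M -> M') : Prop := forall p : M,
  {for p, continuous F} /\
  smooth_near (cmap (chart_at p) p) (in_charts F p).

(* 'J uses row vectors: entry (a, j) is the a-th partial derivative of the
   j-th component. *)
Definition jac (F : M -> M') (p : M) : 'M[Cplx R]_(n, m) :=
  'J (in_charts F p) (cmap (chart_at p) p).

Definition embedding (F : M -> M') : Prop :=
  [/\ holomorphic F, injective F,
      (forall p, row_free (jac F p)) &
      forall U : set M, open U -> exists2 V : set M', open V & U = F @^-1` V].

End Maps.

Definition automorphism (R : realType) n (M : charted R n) (g : M -> M) : Prop :=
  holomorphic g /\
  exists h : M -> M, [/\ holomorphic h, cancel g h & cancel h g].

Section FunctionsAndForms.
Context {R : realType} {n : nat} {M : charted R n}.
Local Notation C := (Cplx R).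

Definition holomorphic_fun_on (U : set M) (f : M -> C) : Prop :=
  forall p, U p -> smooth_near (cmap (chart_at p) p) (f \o cinv (chart_at p)).

Definition smooth_fun (f : M -> R) : Prop := forall p : M,
  smooth_near (realify (cmap (chart_at p) p))
    (f \o cinv (chart_at p) \o (@cplxify R 1 n)).

(* Elements of the maximal holomorphic atlas. *)
Definition holomorphic_chart (c : chart M 'rV[C]_n) : Prop :=
  topological_chart c /\
  forall p, cdom c p ->
    smooth_near (cmap c p) (cmap (chart_at p) \o cinv c) /\
    smooth_near (cmap (chart_at p) p) (cmap c \o cinv (chart_at p)).

End FunctionsAndForms.

(* A (1,1)-form i \sum_{j,k} g_{jk} dz_j /\ d\bar z_k is represented at p by
   its coefficient matrix g in the chart chart_at p. *)
Definition form11 (R : realType) n (M : charted R n) := M -> 'M[Cplx R]_n.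

(* The matrix of the d^2 u / dz_j d\bar z_k at z, from
   d/dz = (d/dx - i d/dy) / 2 and d/d\bar z = (d/dx + i d/dy) / 2. *)
Definition levi (R : realType) n (u : 'rV[Cplx R]_n -> R) (z : 'rV[Cplx R]_n) :
    'M[Cplx R]_n :=
  let V : normedModType R := ('rV[R]_n * 'rV[R]_n)%type in
  let f : V -> R := u \o (@cplxify R 1 n) in
  let dx (j : 'I_n) (h : V -> R) : V -> R := fun a => 'D_(delta_mx 0 j, 0) h a in
  let dy (j : 'I_n) (h : V -> R) : V -> R := fun a => 'D_(0, delta_mx 0 j) h a in
  \matrix_(j, k)
    mkC ((dx j (dx k f) (realify z) + dy j (dy k f) (realify z)) / 4)
        ((dx j (dy k f) (realify z) - dy j (dx k f) (realify z)) / 4).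

Section Forms.
Context {R : realType} {n : nat} {M : charted R n}.
Local Notation C := (Cplx R).

(* i \partial \bar\partial f *)
Definition iddbar (f : M -> R) : form11 M := fun p =>
  levi (f \o cinv (chart_at p)) (cmap (chart_at p) p).

Definition pullback m (N : charted R m) (F : M -> N) (w : form11 N) : form11 M :=
  fun p => jac F p *m w (F p) *m adjmx (jac F p).

(* The coefficient matrix of w at p in an arbitrary chart c. *)
Definition coef (w : form11 M) (c : chart M 'rV[C]_n) (p : M) : 'M[C]_n :=
  let J := 'J (cmap (chart_at p) \o cinv c) (cmap c p) in
  J *m w p *m adjmx J.

End Forms.

Section ProjectiveSpace.
Context {R : realType} (N : nat).
Local Notation C := (Cplx R).

Definition nzset : set 'rV[C]_N.+1 := [set Z | Z != 0].
Local Notation nzrow := (set_type nzset).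

Lemma ones_nz : (const_mx 1 : 'rV[C]_N.+1) \in nzset.
Proof.
apply/mem_set/negP => /eqP/matrixP/(_ 0 0)/eqP.
by rewrite !mxE oner_eq0.
Qed.

Definition ones : nzrow := SigSub ones_nz.

Definition nzval (Z : nzrow) : 'rV[C]_N.+1 := set_val Z.

Definition prop_to (Z W : nzrow) : bool :=
  `[< exists2 c : C, c != 0 & nzval W = c *: nzval Z >].

Lemma prop_to_equiv : equiv_class_of prop_to.
Proof.
split=> [Z|Z W|W Z T].
- by apply/asboolP; exists 1; rewrite ?oner_neq0 ?scale1r.
- apply/idP/idP => /asboolP[c c0 e]; apply/asboolP; exists c^-1;
    by rewrite ?invr_eq0 // e scalerA mulVf ?scale1r.
- move=> /asboolP[c c0 e] /asboolP[d d0 f]; apply/asboolP.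
  by exists (d * c); rewrite ?mulf_neq0 // f e scalerA.
Qed.

Canonical prop_to_equiv_rel := EquivRelPack prop_to_equiv.

Definition CPpoints : Type :=
  quotient_topology {eq_quot prop_to_equiv_rel}%qT.
HB.instance Definition _ := Quotient.on CPpoints.
HB.instance Definition _ := Topological.on CPpoints.
HB.instance Definition _ := isPointed.Build CPpoints (\pi_CPpoints ones)%qT.

(* The class [Z]; a default value if Z = 0. *)
Definition hclass (Z : 'rV[C]_N.+1) : CPpoints :=
  (\pi_CPpoints (insubd ones Z))%qT.

Definition hcoord (x : CPpoints) : 'rV[C]_N.+1 := nzval (repr x).

(* The local section w |-> (w_0, .., 1, .., w_N), with 1 in position j. *)
Definition affine_lift (j : 'I_N.+1) (w : 'rV[C]_N) : 'rV[C]_N.+1 :=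
  \row_l (if unlift j l is Some i then w 0 i else 1).

Definition affine_chart (j : 'I_N.+1) : chart CPpoints 'rV[C]_N := {|
  cdom := [set x | hcoord x 0 j != 0];
  cmap := fun x => \row_i (hcoord x 0 (lift j i) / hcoord x 0 j);
  cinv := fun w => hclass (affine_lift j w) |}.

Definition pivot (x : CPpoints) : 'I_N.+1 :=
  odflt ord0 [pick j | hcoord x 0 j != 0].

Definition CP : charted R N :=
  @Charted R N CPpoints (fun x => affine_chart (pivot x)).

Definition sqnorm (Z : 'rV[C]_N.+1) : R :=
  \sum_l (reC (Z 0 l) ^+ 2 + imC (Z 0 l) ^+ 2).

(* (i / 2 pi) \partial \bar\partial log |Z|^2, for the local lift
   Z = affine_lift j. *)
Definition fubini_study : form11 CP := fun x =>
  mkC (2 * pi)^-1 0 *: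
  levi (fun w => ln (sqnorm (affine_lift (pivot x) w)))
       (cmap (affine_chart (pivot x)) x).

End ProjectiveSpace.
Arguments CP : clear implicits.
Arguments fubini_study : clear implicits.

Definition projective_manifold (R : realType) n (M : charted R n) : Prop :=
  [/\ complex_manifold M, compact [set: M], connected [set: M] &
      exists N (F : M -> CP R N), embedding F].

(* A line bundle given by transition functions btrans i j over an open cover
   bdom i, together with a preferred trivialization btriv x around each x,
   through which the fibre at x is identified with C. *)
Record line_bundle (R : realType) n (M : charted R n) := LineBundle {
  bindex : Type;
  bdom : bindex -> set M;
  btrans : bindex -> bindex -> M -> Cplx R;
  btriv : M -> bindex }.

Section LineBundles.
Context {R : realType} {n : nat} {M : charted R n}.
Local Notation C := (Cplx R).

Definition holomorphic_line_bundle (L : line_bundle M) : Prop :=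
  [/\ (forall i : bindex L, open (bdom i)) /\ (forall x, bdom (btriv L x) x),
      (forall i j : bindex L,
         holomorphic_fun_on (bdom i `&` bdom j) (btrans i j)),
      (forall (i : bindex L) x, bdom i x -> btrans i i x = 1) &
      forall (i j k : bindex L) x, bdom i x -> bdom j x -> bdom k x ->
        btrans i j x * btrans j k x = btrans i k x].

Definition power (L : line_bundle M) (k : nat) : line_bundle M := {|
  bindex := bindex L;
  bdom := @bdom _ _ _ L;
  btrans := fun i j x => btrans i j x ^+ k;
  btriv := btriv L |}.

Definition pullback_bundle (g : M -> M) (L : line_bundle M) : line_bundle M := {|
  bindex := bindex L;
  bdom := fun i => g @^-1` bdom i;
  btrans := fun i j x => btrans i j (g x);
  btriv := btriv L \o g |}.

(* A section is given by its value s x at each x through btriv L x; its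
   component in the i-th trivialization is btrans i (btriv L x) x * s x. *)
Definition H0 (L : line_bundle M) : set (M -> C) :=
  [set s | forall i : bindex L,
     holomorphic_fun_on (bdom i) (fun x => btrans i (btriv L x) x * s x)].

Definition is_basis (L : line_bundle M) m (S : 'I_m -> M -> C) : Prop :=
  (forall i, H0 L (S i)) /\
  forall s, H0 L s ->
    exists! a : 'rV[C]_m, s = (fun x => \sum_i a 0 i * S i x).

Definition dimH0 (L : line_bundle M) : nat :=
  xget 0 [set m | exists S : 'I_m -> M -> C, is_basis L S].

Definition kodaira_map N (S : 'I_N.+1 -> M -> C) : M -> CP R N :=
  fun x => hclass (\row_i S i x).

Definition very_ample (L : line_bundle M) : Prop :=
  holomorphic_line_bundle L /\
  exists N (S : 'I_N.+1 -> M -> C),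
    [/\ is_basis L S, (forall x, exists i, S i x != 0) &
        embedding (kodaira_map S)].

(* N_k *)
Definition projdim (L : line_bundle M) (k : nat) : nat :=
  (dimH0 (power L k)).-1.

Definition bergman_form (k : nat) N (S : 'I_N.+1 -> M -> C) : form11 M :=
  fun p => k%:R^-1 *: pullback (kodaira_map S) (fubini_study R N) p.

Definition bergman (L : line_bundle M) (k : nat) : set (form11 M) :=
  [set w | exists S : 'I_(projdim L k).+1 -> M -> C,
     is_basis (power L k) S /\ w = bergman_form k S].

Definition act_basis N (A : 'M[C]_N.+1) (S : 'I_N.+1 -> M -> C) :
    'I_N.+1 -> M -> C :=
  fun i x => \sum_j A i j * S j x.

End LineBundles.

Section HomogeneousSpace.
Context {R : realType} (N : nat).
Local Notation C := (Cplx R).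

Definition SLn : set 'M[C]_N.+1 := [set A | \det A = 1].
Definition SUn : set 'M[C]_N.+1 := [set U | \det U = 1 /\ U *m adjmx U = 1%:M].

(* [A] in SU \ SL *)
Definition coset_SU (A : 'M[C]_N.+1) : set 'M[C]_N.+1 :=
  [set U *m A | U in SUn].

Definition homdim : nat := N.+1 ^ 2 - 1.

(* Smoothness on an open subset W of the submanifold SL: local smooth
   extendability to the ambient real vector space. *)
Definition smooth_on_SL (V : normedModType R) (W : set 'M[C]_N.+1)
    (f : 'M[C]_N.+1 -> V) : Prop :=
  forall A, SLn A -> W A ->
    exists O (G : 'M[R]_N.+1 * 'M[R]_N.+1 -> V),
      [/\ open_nbhs (realify A) O, smooth_on O G &
          forall B, SLn B -> W B -> O (realify B) -> G (realify B) = f B].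

Definition open_in_SL (W : set 'M[C]_N.+1) : Prop :=
  exists2 O : set 'M[C]_N.+1, open O & forall A, SLn A -> (W A <-> O A).

(* The charts of the quotient manifold SU \ SL: its smooth structure is the
   one for which the projection SL -> SU \ SL is smooth and has smooth local
   sections, i.e. is a smooth submersion. *)
Definition homogeneous_chart
    (h : chart (set 'M[C]_N.+1) 'rV[R]_homdim) : Prop :=
  [/\ cdom h `<=` coset_SU @` SLn /\ open_in_SL (coset_SU @^-1` cdom h),
      (forall X, cdom h X -> cinv h (cmap h X) = X),
      open (cmap h @` cdom h),
      smooth_on_SL (coset_SU @^-1` cdom h) (cmap h \o coset_SU) &
      forall y, (cmap h @` cdom h) y ->
        exists2 s : 'rV[R]_homdim -> 'M[C]_N.+1,
          smooth_near y (@realify R _ _ \o s) &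
          \forall z \near y, [/\ SLn (s z), cdom h (coset_SU (s z)) &
                                 cmap h (coset_SU (s z)) = z]].

End HomogeneousSpace.

(* A smooth manifold whose points form a subset of T. *)
Record smooth_manifold (R : realType) (T : Type) := SmoothManifold {
  points : set T;
  opens : set (set T);
  sdim : nat;
  charts : set (chart T 'rV[R]_sdim) }.

Arguments charts {R T} s _.

Definition smooth_map (R : realType) (T T' : Type)
    (X : smooth_manifold R T) (Y : smooth_manifold R T') (f : T -> T') : Prop :=
  [/\ (forall p, points X p -> points Y (f p)),
      (forall V, opens Y V -> opens X (points X `&` f @^-1` V)) &
      forall c c', charts X c -> charts Y c' ->
        smooth_on (cmap c @` (cdom c `&` f @^-1` cdom c'))
                  (cmap c' \o f \o cinv c)].

Definition diffeomorphism (R : realType) (T T' : Type)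
    (X : smooth_manifold R T) (Y : smooth_manifold R T') (f : T -> T') : Prop :=
  smooth_map X Y f /\
  exists g : T' -> T, [/\ smooth_map Y X g,
    (forall p, points X p -> g (f p) = p) &
    (forall q, points Y q -> f (g q) = q)].

Definition smooth_curve (R : realType) (T : Type) (X : smooth_manifold R T)
     (c : R -> T) : Prop :=
  exists h, [/\ charts X h, (\forall t \near (0 : R), cdom h (c t)) &
                smooth_near (0 : R) (cmap h \o c)].

Section BergmanSpace.
Context {R : realType} {n : nat} {M : charted R n}.
Local Notation C := (Cplx R).

(* The Bergman space with the smooth structure making [A] |-> omega_A a
   diffeomorphism from SU \ SL, for a given basis S of H^0(M, L^k). *)
Definition bergman_manifold (L : line_bundle M) (k : nat)
    (S : 'I_(projdim L k).+1 -> M -> C) : smooth_manifold R (form11 M) :=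
  let omega A := bergman_form k (act_basis A S) in {|
  points := bergman L k;
  opens := [set W | W `<=` bergman L k /\ open_in_SL (omega @^-1` W)];
  sdim := homdim (projdim L k);
  charts := [set c | [/\ cdom c `<=` bergman L k,
    (forall w, cdom c w -> cinv c (cmap c w) = w) &
    exists2 h, homogeneous_chart h &
      forall A, SLn A ->
        (cdom c (omega A) <-> cdom h (coset_SU A)) /\
        (cdom c (omega A) -> cmap c (omega A) = cmap h (coset_SU A))]] |}.

(* Derivative at t = 0 of a curve of forms. *)
Definition velocity (w : R -> form11 M) (v : form11 M) : Prop :=
  forall p j k,
    is_derive (0 : R) (1 : R) (fun t => reC (w t p j k)) (reC (v p j k)) /\
    is_derive (0 : R) (1 : R) (fun t => imC (w t p j k)) (imC (v p j k)).

(* Tangent vectors of X at w are represented by potentials: phi stands for the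
   tangent vector i \partial \bar\partial phi, the velocity of the curve c. *)
Definition tangent_along (X : smooth_manifold R (form11 M)) (w : form11 M)
    (c : R -> form11 M) (phi : M -> R) : Prop :=
  [/\ smooth_curve X c, c 0 = w, smooth_fun phi & velocity c (iddbar phi)].

Definition tangent (X : smooth_manifold R (form11 M)) (w : form11 M)
    (phi : M -> R) : Prop := exists c, tangent_along X w c phi.

(* The differential of f at w maps the tangent vector phi to psi. *)
Definition differential_maps (X Y : smooth_manifold R (form11 M))
    (f : form11 M -> form11 M) (w : form11 M) (phi psi : M -> R) : Prop :=
  exists c, tangent_along X w c phi /\ tangent_along Y (f w) (f \o c) psi.

Definition metric := form11 M -> (M -> R) -> (M -> R) -> R.

(* The transport of G along f is G'. *)
Definition transports (X Y : smooth_manifold R (form11 M))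
    (f : form11 M -> form11 M) (G G' : metric) : Prop :=
  forall w, points X w ->
    (forall phi, tangent X w phi ->
       exists psi, differential_maps X Y f w phi psi) /\
    (forall phi1 phi2 psi1 psi2,
       differential_maps X Y f w phi1 psi1 ->
       differential_maps X Y f w phi2 psi2 ->
       G' (f w) psi1 psi2 = G w phi1 phi2).

End BergmanSpace.

(* Lebesgue integrals over R^m and C^n, as iterated integrals. *)
Fixpoint integral_Rn (R : realType) m : ('rV[R]_m -> \bar R) -> \bar R :=
  if m is m'.+1 then fun f =>
    (\int[lebesgue_measure]_x
       integral_Rn (fun v : 'rV[R]_m' => f (row_mx (x%:M : 'rV_1) v)))%E
  else fun f => f 0.

Definition integral_Cn (R : realType) n (f : 'rV[Cplx R]_n -> \bar R) : \bar R :=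
  integral_Rn (fun x : 'rV[R]_n => integral_Rn (fun y => f (cplxify (x, y)))).

Section Metrics.
Context {R : realType} {n : nat} {M : charted R n}.
Local Notation C := (Cplx R).

Local Notation borel := (g_sigma_algebraType (@open M)).

(* mu is the measure dV = w^n / n!: in any holomorphic chart the latter is
   det g times the product of the i dz_j /\ d\bar z_j = 2 dx_j /\ dy_j. *)
Definition volume_measure (w : form11 M) (mu : {measure set borel -> \bar R}) :
    Prop :=
  forall c : chart M 'rV[C]_n, holomorphic_chart c ->
  forall A : set borel, measurable A -> A `<=` cdom c ->
    mu A = integral_Cn (fun z =>
      (2 ^+ n * reC (\det (coef w c (cinv c z))) * \1_(cmap c @` A) z)%:E).

Definition vol (w : form11 M) : {measure set borel -> \bar R} :=
  if pselect (exists mu, volume_measure w mu) is left e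
  then projT1 (cid e) else mzero.

Definition integralM (w : form11 M) (f : M -> R) : R :=
  Rintegral (vol w) [set: borel] f.

Definition laplacian (w : form11 M) (phi : M -> R) : M -> R :=
  fun p => reC (\tr (invmx (w p) *m iddbar phi p)).

Definition mean (w : form11 M) (phi : M -> R) : R :=
  (fine (vol w [set: borel]))^-1 * integralM w phi.

Definition calabi : @metric R n M := fun w phi psi =>
  integralM w (fun p => laplacian w phi p * laplacian w psi p).

Definition mabuchi : @metric R n M := fun w phi psi =>
  integralM w (fun p => (phi p - mean w phi) * (psi p - mean w psi)).

End Metrics.

(* Main.v *)
(** If S is a basis of H^0(M, L^k), the sections S_i o g form a basis of
H^0(M, g^*L^k), and the map they define is F_S o g; so g^* sends
(1/k) F_S^* omega_FS to (1/k) F_(S o g)^* omega_FS.  Writing S o g = Q S', with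
Q normalized to determinant 1 (which changes no projective class), pullback
becomes the map [A] |-> [A Q] of SU \ SL, a diffeomorphism with inverse
[A] |-> [A Q^-1].

On potentials, i ddbar (phi o g) = g^* (i ddbar phi), so the differential of g^*
sends phi to phi o g, up to an additive constant: a real function u with
i ddbar u = 0 on a compact connected M is constant, by Hopf's maximum principle.
Since Laplacians and volume measures commute with g^*, both metrics are
preserved by the change of variables g.  For the Mabuchi metric the additive
constants drop out only because the volume is finite: the density of the
volume form is locally bounded and M is compact. *)

From HB Require Import structures.
Require Import Defs.
From mathcomp Require Import all_boot all_order all_algebra.
From mathcomp Require Import complex ring lra.
From mathcomp Require Import all_classical all_reals all_analysis.
From mathcomp Require Import measurable_realfun.

Set Implicit Arguments.
Unset Strict Implicit.
Unset Printing Implicit Defensive.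

Import Order.TTheory GRing.Theory Num.Theory.
Import numFieldNormedType.Exports.

Local Open Scope classical_set_scope.
Local Open Scope ring_scope.

(** * Calculus of smooth maps *)

(** [laplacian] divides by the matrix of the form with [invmx], a true inverse only where that
    matrix is invertible, so Bergman forms must be shown nondegenerate. For an arbitrary basis of
    H^0(M, L^k) this comes from very ampleness of L: the products S_a S_b^(k-1) are sections of L^k,
    so a vector killed by the differential of the Kodaira map of L^k is killed by that of L. To see
    this, the pulled-back Fubini-Study form is computed from arbitrary holomorphic lifts, where its
    kernel is the equality case of Cauchy-Schwarz.

    A form is stored at each point in a chart that jumps with the point. Statements about
    neighbouring points are therefore moved to one fixed chart before a bound, a continuity or a
    second derivative is taken. Volumes are compared through transported charts in which g is the
    identity in coordinates, so that integrals over C^n agree integrand by integrand. As [vol] falls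
    back on the zero measure when no volume measure exists, both cases are carried through. *)

Section ScaleBilinear.
Variables (K : numFieldType) (W : normedModType K).

(** Declared as a bilinear map, so that the product rule below is the differential of a bilinear map
    composed with a pair. *)
Definition scale_fun (a : K) (w : W) : W := a *: w.

Lemma scale_fun_is_bilinear :
  bilinear_for
    (GRing.Scale.Law.clone _ _ *:%R _) (GRing.Scale.Law.clone _ _ *:%R _)
    scale_fun.
Proof.
split=> [u'|u] a x y /=; rewrite /scale_fun.
- by rewrite scalerDl -scalerA.
- by rewrite scalerDr !scalerA mulrC.
Qed.
HB.instance Definition _ := bilinear_isBilinear.Build K K W W _ _ scale_fun
  scale_fun_is_bilinear.

End ScaleBilinear.

Section Calculus.
Variables (K : numFieldType).
Implicit Types V W : normedModType K.

Lemma scale_fun_continuous W : continuous (fun p : K * W => scale_fun p.1 p.2).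
Proof. by move=> p; apply: scale_continuous. Qed.

Lemma is_diff_scale V W (a : V -> K) (b : V -> W) x :
  differentiable a x -> differentiable b x ->
  differentiable (fun y => a y *: b y) x /\
  forall v, 'D_v (fun y => a y *: b y) x = a x *: 'D_v b x + 'D_v a x *: b x.
Proof.
move=> da db.
have dab := differentiable_pair da db.
have ds := @differentiable_bilin _ _ _ _ (@scale_fun K W) (a x, b x)
  (@scale_fun_continuous W).
have dc : differentiable (fun y => a y *: b y) x
  by apply: (differentiable_comp dab ds).
split=> // v; rewrite !deriveE //.
have -> : 'd (fun y => a y *: b y) x v =
    ('d (fun p : K * W => scale_fun p.1 p.2) (a x, b x)
       \o 'd (fun y => (a y, b y)) x) v.
  by rewrite -(diff_comp dab ds).
rewrite /= (@diff_pair _ _ _ _ a b x da db).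
by rewrite (@diff_bilin _ _ _ _ (@scale_fun K W) (a x, b x)) //;
  exact: scale_fun_continuous.
Qed.

Lemma differentiable_epsP V W (f : V -> W) x :
  differentiable f x -> forall e, 0 < e ->
  \forall h \near 0, `|f (h + x) - f x - 'd f x h| <= e * `|h|.
Proof.
move=> df e e0; have /eqaddoP/(_ e e0) E := diff_locally df.
by apply: filterS E => h; rewrite /= opprD addrA.
Qed.

(** The epsilon form lets a differential be carried over to another function by comparing estimates,
    also from complex to real scalars. *)
Lemma differentiable_eps V W (f : V -> W) x (L : {linear V -> W}) :
  continuous L ->
  (forall e, 0 < e ->
    \forall h \near 0, `|f (h + x) - f x - L h| <= e * `|h|) ->
  differentiable f x /\ 'd f x = L :> (V -> W).
Proof.
move=> Lc E.
have fL : f \o shift x = cst (f x) + (L : V -> W) +o_ 0 id.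
  apply/eqaddoP => e e0; apply: filterS (E e e0) => h.
  by rewrite /= opprD addrA.
have dL := diff_unique Lc fL; split=> //.
by apply/diff_locallyP; rewrite dL.
Qed.

Lemma near_shift0 V (P : set V) x :
  (\forall y \near x, P y) -> \forall h \near (0 : V), P (h + x).
Proof. by rewrite (near_shift 0 x) subr0. Qed.

Lemma differentiable_near_eq V W (f g : V -> W) x :
  {near x, f =1 g} -> differentiable f x -> differentiable g x.
Proof.
move=> fg df.
have fgx := nbhs_singleton fg.
suff: differentiable g x /\ 'd g x = 'd f x :> (V -> W) by case.
apply: differentiable_eps; first exact: diff_continuous.
move=> e e0; near=> h.
have <- : f (h + x) = g (h + x) by near: h; exact: (near_shift0 fg).
by rewrite -fgx; near: h; exact: (differentiable_epsP df e0).
Unshelve. all: by end_near. Qed.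

Lemma differentiable_linear_comp V W (U : normedModType K) (f : V -> W) (L : {linear W -> U}) x :
  continuous L -> differentiable f x ->
  differentiable (L \o f) x /\ forall v, 'D_v (L \o f) x = L ('D_v f x).
Proof.
move=> Lc df; have dL := @linear_differentiable _ _ _ L (f x) Lc.
have dc : differentiable (L \o f) x by apply: differentiable_comp.
split=> // v; rewrite !deriveE // (diff_comp df dL) /=.
by rewrite (diff_lin (f x) Lc).
Qed.

Lemma diff_order_eq V W k (U : set V) (f g : V -> W) :
  open U -> (forall x, U x -> f x = g x) ->
  diff_order k U f -> diff_order k U g.
Proof.
move=> Uo; have near x : U x -> \forall y \near x, U y.
  by move=> Ux; apply: open_nbhs_nbhs.
elim: k f g => [|k IH] f g fg /=.
  move=> fc x Ux; rewrite /prop_for /continuous_at -fg //.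
  apply: cvg_trans (fc x Ux); apply: near_eq_cvg.
  by apply: filterS (near x Ux) => y; exact: fg.
move=> [df dDf]; split=> [x Ux|v].
  apply: differentiable_near_eq (df x Ux).
  by apply: filterS (near x Ux) => y; exact: fg.
apply: IH (dDf v) => x Ux; apply: near_eq_derive.
by apply: filterS (near x Ux) => y; exact: fg.
Qed.

Lemma diff_order_sub V W k (U U' : set V) (f : V -> W) :
  U' `<=` U -> diff_order k U f -> diff_order k U' f.
Proof.
move=> sub; elim: k f => [|k IH] f /=; first by move=> fc x /sub; exact: fc.
by move=> [df dDf]; split=> [x /sub|v]; [exact: df | exact: IH].
Qed.

(** In [diff_order] the derivative ['D_v f] is that of [f] on the whole space, and [U] only says
    where the conditions are tested. The order can thus be checked one point at a time, although a
    singleton need not be open. *)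
Lemma diff_order_pointwise V W k (U : set V) (f : V -> W) :
  (forall x, U x -> diff_order k [set x] f) -> diff_order k U f.
Proof.
elim: k f => [|k IH] f /= H; first by move=> x /H; apply.
split=> [x /H [df _]|v]; first exact: df.
by apply: IH => x /H [].
Qed.

Lemma diff_orderS V W k (U : set V) (f : V -> W) :
  diff_order k.+1 U f -> diff_order k U f.
Proof.
elim: k f => [|k IH] f [df dDf].
  by move=> x Ux; apply: differentiable_continuous; exact: df.
by split=> // v; apply: IH; apply: dDf.
Qed.

Lemma diff_order_cst V W k (U : set V) (w : W) :
  diff_order k U (fun=> w).
Proof.
elim: k w => [|k IH] w /=; first by move=> x _; exact: cvg_cst.
split=> [x _|v]; first exact: differentiable_cst.
have -> : 'D_v (fun=> w) = (fun=> 0) :> (V -> W).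
  by apply/funext => x; exact: derive_cst.
exact: IH.
Qed.

Lemma diff_orderD V W k (U : set V) (f g : V -> W) : open U ->
  diff_order k U f -> diff_order k U g -> diff_order k U (fun x => f x + g x).
Proof.
move=> Uo; elim: k f g => [|k IH] f g /=.
  by move=> fc gc x Ux; apply: cvgD; [exact: fc | exact: gc].
move=> [df dDf] [dg dDg]; split=> [x Ux|v].
  by apply: differentiableD; [exact: df | exact: dg].
apply: (diff_order_eq (f := fun x => 'D_v f x + 'D_v g x)) => //.
  move=> x Ux; symmetry.
  by apply: deriveD; apply: diff_derivable; [exact: df | exact: dg].
by apply: IH.
Qed.

Lemma diff_order_sum V W k (U : set V) (I : Type) (r : seq I)
    (f : I -> V -> W) : open U ->
  (forall i, diff_order k U (f i)) ->
  diff_order k U (fun x => \sum_(i <- r) f i x).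
Proof.
move=> Uo df; elim: r => [|i r IH].
  apply: (diff_order_eq (f := fun=> 0)) => //; last exact: diff_order_cst.
  by move=> x _; rewrite big_nil.
apply: (diff_order_eq (f := fun x => f i x + \sum_(i <- r) f i x)) => //.
  by move=> x _; rewrite big_cons.
exact: diff_orderD.
Qed.

Lemma diff_order_scale V W k (U : set V) (a : V -> K) (f : V -> W) : open U ->
  diff_order k U a -> diff_order k U f -> diff_order k U (fun x => a x *: f x).
Proof.
move=> Uo; elim: k a f => [|k IH] a f.
  by move=> ac fc x Ux; apply: cvgZ; [exact: ac | exact: fc].
move=> /[dup] /diff_orderS ak [da dDa] /[dup] /diff_orderS fk [df dDf].
split=> [x Ux|v].
  by have [] := is_diff_scale (da x Ux) (df x Ux).
apply: (diff_order_eq (f := fun x => a x *: 'D_v f x + 'D_v a x *: f x)) => //.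
  by move=> x Ux; have [_ ->] := is_diff_scale (da x Ux) (df x Ux).
by apply: diff_orderD => //; [exact: IH ak (dDf v) | exact: IH (dDa v) fk].
Qed.

Lemma diff_order_linear_comp V W W' k (U : set V) (f : V -> W)
    (L : {linear W -> W'}) : open U -> continuous L ->
  diff_order k U f -> diff_order k U (L \o f).
Proof.
move=> Uo Lc; elim: k f => [|k IH] f.
  by move=> fc x Ux; apply: continuous_comp; [exact: fc | exact: Lc].
move=> [df dDf]; split=> [x Ux|v].
  by have [] := differentiable_linear_comp Lc (df x Ux).
apply: (diff_order_eq (f := L \o 'D_v f)) => //.
  by move=> x Ux; have [_ ->] := differentiable_linear_comp Lc (df x Ux).
exact: IH (dDf v).
Qed.

Lemma diff_order_id V k (U : set V) : open U -> diff_order k U (@id V).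
Proof.
move=> Uo; case: k => [|k]; first by move=> x _; exact: cvg_id.
split=> [x _|v]; first exact: ex_diff.
apply: (diff_order_eq (f := fun=> v)) => //; last exact: diff_order_cst.
by move=> x _; rewrite derive_id.
Qed.

Lemma diff_order_linear V W k (U : set V) (L : {linear V -> W}) :
  open U -> continuous L -> diff_order k U L.
Proof.
by move=> Uo Lc; apply: (diff_order_linear_comp (f := id)) => //;
  exact: diff_order_id.
Qed.

(* Finite dimensionality, with continuous coordinates. *)
Definition finite_frame (U : normedModType K) : Prop :=
  exists m (e : 'I_m -> U) (xi : 'I_m -> {linear U -> K}),
    (forall i, continuous (xi i)) /\ forall u, u = \sum_i xi i u *: e i.

(** The chain rule gives the derivative of [g] in a direction ['D_v f x] that varies with [x],
    whereas [diff_order] speaks of fixed directions. Expanding that direction in a frame gives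
    products of a coordinate of ['D_v f] with a composite ['D_(e i) g \o f], to which the induction
    applies. *)
Lemma diff_order_comp V (U : normedModType K) W k (O : set V) (P : set U) (f : V -> U)
    (g : U -> W) : finite_frame U -> open O -> open P ->
  (forall x, O x -> P (f x)) ->
  diff_order k O f -> diff_order k P g -> diff_order k O (g \o f).
Proof.
move=> [m [e [xi [xic xiE]]]] Oo Po OP.
elim: k g => [|k IH] g.
  move=> fc gc x Ox; apply: continuous_comp; first exact: fc.
  by apply: gc; exact: OP.
move=> /[dup] /diff_orderS fk [df dDf] [dg dDg]; split=> [x Ox|v].
  by apply: differentiable_comp; [exact: df | apply: dg; exact: OP].
apply: (diff_order_eq (f := fun x => \sum_i
    (xi i \o 'D_v f) x *: ('D_(e i) g \o f) x)) => //.
  move=> x Ox; have dfx := df x Ox; have dgx := dg _ (OP x Ox).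
  rewrite deriveE; last exact: differentiable_comp.
  rewrite (diff_comp dfx dgx) /= [in RHS](xiE ('d f x v)) linear_sum.
  apply: eq_bigr => i _; rewrite linearZ /=.
  by rewrite (deriveE v dfx) (deriveE (e i) dgx).
apply: diff_order_sum => // i; apply: diff_order_scale => //.
  by apply: diff_order_linear_comp => //; exact: dDf.
by apply: IH => //; exact: dDg.
Qed.

Lemma smooth_on_near V W (U : set V) (f : V -> W) :
  (forall x, U x -> smooth_near x f) -> smooth_on U f.
Proof.
move=> H k; apply: diff_order_pointwise => x /H [D [_ Dx] sf].
by apply: diff_order_sub (sf k) => y ->.
Qed.

Lemma smooth_near_on V W (U : set V) (f : V -> W) x :
  open U -> smooth_on U f -> U x -> smooth_near x f.
Proof. by move=> Uo sf Ux; exists U. Qed.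

Lemma smooth_near_near V W (f : V -> W) x :
  smooth_near x f -> \forall y \near x, smooth_near y f.
Proof.
move=> [U [Uo Ux] sf]; apply: filterS (open_nbhs_nbhs (conj Uo Ux)) => y Uy.
exact: smooth_near_on sf Uy.
Qed.

Lemma smooth_near_within V W (f : V -> W) x (P : set V) :
  (\forall y \near x, P y) -> smooth_near x f ->
  exists U, [/\ open U, U x, U `<=` P & smooth_on U f].
Proof.
move=> Px [U [Uo Ux] sf].
exists (U `&` P°); split; first exact: openI Uo (open_interior P).
- by split=> //; exact: nbhs_singleton (nbhs_interior Px).
- by move=> y [_ /interior_subset].
- by move=> k; apply: diff_order_sub (sf k) => y [].
Qed.

Lemma smooth_near_eq V W (x : V) (f g : V -> W) :
  {near x, f =1 g} -> smooth_near x f -> smooth_near x g.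
Proof.
move=> fg /(smooth_near_within fg) [U [Uo Ux UE sf]]; exists U => // k.
exact: diff_order_eq (sf k).
Qed.

Lemma smooth_near_cst V W (x : V) (w : W) : smooth_near x (fun=> w).
Proof.
by exists setT; [split=> //; exact: openT | move=> k; exact: diff_order_cst].
Qed.

Lemma smooth_near_both V W W' (x : V) (f : V -> W) (g : V -> W') :
  smooth_near x f -> smooth_near x g ->
  exists U, [/\ open U, U x, smooth_on U f & smooth_on U g].
Proof.
move=> sf [U [Uo Ux] sg].
have [D [Do Dx DU sfD]] := smooth_near_within (open_nbhs_nbhs (conj Uo Ux)) sf.
by exists D; split=> // k; exact: diff_order_sub (sg k).
Qed.

Lemma smooth_near_add V W (x : V) (f g : V -> W) :
  smooth_near x f -> smooth_near x g -> smooth_near x (fun y => f y + g y).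
Proof.
move=> sf sg; have [U [Uo Ux fU gU]] := smooth_near_both sf sg.
by exists U => // k; apply: diff_orderD.
Qed.

Lemma smooth_near_scale V W (x : V) (a : V -> K) (f : V -> W) :
  smooth_near x a -> smooth_near x f -> smooth_near x (fun y => a y *: f y).
Proof.
move=> sf sg; have [U [Uo Ux fU gU]] := smooth_near_both sf sg.
by exists U => // k; apply: diff_order_scale.
Qed.

Lemma smooth_near_mul V (x : V) (a b : V -> K) :
  smooth_near x a -> smooth_near x b -> smooth_near x (fun y => a y * b y).
Proof. exact: smooth_near_scale. Qed.

Lemma smooth_near_exp V (x : V) (a : V -> K) m :
  smooth_near x a -> smooth_near x (fun y => a y ^+ m).
Proof.
move=> sa; elim: m => [|m IH]; first exact: smooth_near_cst.
by under eq_fun do rewrite exprS; apply: smooth_near_mul.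
Qed.

Lemma smooth_near_sum V W (x : V) (I : Type) (r : seq I) (f : I -> V -> W) :
  (forall i, smooth_near x (f i)) ->
  smooth_near x (fun y => \sum_(i <- r) f i y).
Proof.
move=> sf; elim: r => [|i r IH].
  by under eq_fun do rewrite big_nil; exact: smooth_near_cst.
by under eq_fun do rewrite big_cons; apply: smooth_near_add.
Qed.

Lemma smooth_near_linear_comp V W W' (x : V) (f : V -> W)
    (L : {linear W -> W'}) : continuous L ->
  smooth_near x f -> smooth_near x (L \o f).
Proof.
by move=> Lc [U [Uo Ux] sf]; exists U => // k; apply: diff_order_linear_comp.
Qed.

Lemma smooth_near_linear V W (x : V) (L : {linear V -> W}) :
  continuous L -> smooth_near x L.
Proof.
by move=> Lc; exists setT;
  [split=> //; exact: openT | move=> k; apply: diff_order_linear => //; exact: openT].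
Qed.

Lemma smooth_near_differentiable V W (x : V) (f : V -> W) :
  smooth_near x f -> differentiable f x.
Proof. by move=> [U [Uo Ux] sf]; have [] := sf 1%N => + _; apply. Qed.

Lemma smooth_near_continuous V W (x : V) (f : V -> W) :
  smooth_near x f -> {for x, continuous f}.
Proof. by move/smooth_near_differentiable/differentiable_continuous. Qed.

Lemma smooth_near_derive V W (x v : V) (f : V -> W) :
  smooth_near x f -> smooth_near x ('D_v f).
Proof.
by move=> [U [Uo Ux] sf]; exists U => // k; have [_ /(_ v)] := sf k.+1.
Qed.

Lemma smooth_near_comp V (U : normedModType K) W (f : V -> U) (g : U -> W) x : finite_frame U ->
  smooth_near x f -> smooth_near (f x) g -> smooth_near x (g \o f).
Proof.
move=> fr sf [P [Po Pfx] sg].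
have [D [Do Dx DP sfD]] := smooth_near_within
  (smooth_near_continuous sf (open_nbhs_nbhs (conj Po Pfx))) sf.
by exists D => // k; apply: diff_order_comp (sg k).
Qed.

End Calculus.

Section Frames.
Variable K : numFieldType.

Definition mx_coord m n (i : 'I_m) (j : 'I_n) (A : 'M[K]_(m, n)) : K := A i j.

Lemma mx_coord_is_linear m n i j : linear (@mx_coord m n i j).
Proof. by move=> a A B; rewrite /mx_coord !mxE. Qed.
HB.instance Definition _ m n i j := GRing.isLinear.Build K 'M[K]_(m, n) K _
  (@mx_coord m n i j) (@mx_coord_is_linear m n i j).

Lemma mx_coord_continuous m n i j : continuous (@mx_coord m n i j).
Proof. exact: coord_continuous. Qed.

Lemma finite_frame_mx m n : finite_frame ('M[K]_(m, n) : normedModType K).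
Proof.
pose T := ('I_m * 'I_n)%type.
exists #|{: T}|, (fun k => delta_mx (enum_val k).1 (enum_val k).2),
  (fun k => @mx_coord m n (enum_val k).1 (enum_val k).2).
split=> [k|A]; first exact: mx_coord_continuous.
rewrite [LHS]matrix_sum_delta pair_bigA /=.
rewrite (reindex (@enum_val T predT)) //=.
exact/onW_bij/enum_val_bij.
Qed.

Lemma finite_frame_pair (U V : normedModType K) :
  finite_frame U -> finite_frame V ->
  finite_frame ((U * V)%type : normedModType K).
Proof.
move=> [m [e [xi [xic xiE]]]] [n [f [yi [yic yiE]]]].
exists (m + n)%N, (fun k => match fintype.split k with
    inl i => (e i, 0) | inr j => (0, f j) end),
  (fun k => match fintype.split k with
    inl i => (xi i \o fst : {linear _ -> _})
  | inr j => (yi j \o snd : {linear _ -> _}) end).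
split=> [k|[u v]].
  case: (fintype.split k) => i p; apply: continuous_comp.
  - exact: cvg_fst.
  - exact: xic.
  - exact: cvg_snd.
  - exact: yic.
rewrite big_split_ord /=.
under eq_bigr do rewrite (unsplitK (inl _)) /=.
under [X in _ + X]eq_bigr do rewrite (unsplitK (inr _)) /=.
rewrite [in LHS](xiE u) [in LHS](yiE v).
have -> : (\sum_(i < m) xi i u *: e i, \sum_(j < n) yi j v *: f j) =
    (\sum_(i < m) xi i u *: e i, 0) + (0, \sum_(j < n) yi j v *: f j).
  by congr pair; rewrite ?addr0 ?add0r.
congr (_ + _).
  apply: (big_ind2 (fun a b => (a, 0) = b)) => [//|a b c d <- <-|i _].
    by congr pair; rewrite /= addr0.
  by congr pair; rewrite /= scaler0.
apply: (big_ind2 (fun a b => (0, a) = b)) => [//|a b c d <- <-|i _].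
  by congr pair; rewrite /= addr0.
by congr pair; rewrite /= scaler0.
Qed.
End Frames.

(** * Real coordinates on complex vector spaces *)

Section CplxReal.
Variable R : realType.
Local Notation C := (Cplx R).
Implicit Types (x y : C) (r s : R).

Lemma cplx_eqP x y : reC x = reC y -> imC x = imC y -> x = y.
Proof. by case: x y => [a b] [c d] /= -> ->. Qed.

Lemma reC_mkC r s : reC (mkC r s) = r. Proof. by []. Qed.
Lemma imC_mkC r s : imC (mkC r s) = s. Proof. by []. Qed.
Lemma mkC_re_im x : mkC (reC x) (imC x) = x. Proof. by case: x. Qed.

Lemma reCD x y : reC (x + y) = reC x + reC y.
Proof. by case: x y => [a b] [c d]. Qed.
Lemma imCD x y : imC (x + y) = imC x + imC y.
Proof. by case: x y => [a b] [c d]. Qed.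
Lemma reCN x : reC (- x) = - reC x. Proof. by case: x. Qed.
Lemma imCN x : imC (- x) = - imC x. Proof. by case: x. Qed.
Lemma reC0 : reC (0 : C) = 0. Proof. by []. Qed.
Lemma imC0 : imC (0 : C) = 0. Proof. by []. Qed.
Lemma reCM x y : reC (x * y) = reC x * reC y - imC x * imC y.
Proof. by case: x y => [a b] [c d]. Qed.
Lemma imCM x y : imC (x * y) = reC x * imC y + imC x * reC y.
Proof. by case: x y => [a b] [c d]. Qed.
Lemma conjC_complex x : Num.conj x = mkC (reC x) (- imC x).
Proof.
by case: x. Qed.
Lemma reC_sum I (r : seq I) (P : pred I) (F : I -> C) :
  reC (\sum_(i <- r | P i) F i) = \sum_(i <- r | P i) reC (F i).
Proof. exact: (big_morph _ reCD reC0). Qed.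
Lemma imC_sum I (r : seq I) (P : pred I) (F : I -> C) :
  imC (\sum_(i <- r | P i) F i) = \sum_(i <- r | P i) imC (F i).
Proof. exact: (big_morph _ imCD imC0). Qed.

Lemma reC_conj x : reC (Num.conj x) = reC x. Proof. by rewrite conjC_complex. Qed.
Lemma imC_conj x : imC (Num.conj x) = - imC x. Proof. by rewrite conjC_complex. Qed.

Definition cR r : C := mkC r 0.

Lemma ler_cR r s : (cR r <= cR s) = (r <= s). Proof. exact: lecR. Qed.
Lemma ltr_cR r s : (cR r < cR s) = (r < s). Proof. exact: ltcR. Qed.
Lemma cRD r s : cR (r + s) = cR r + cR s.
Proof. by apply: cplx_eqP; rewrite ?reCD ?imCD //= addr0. Qed.
Lemma cRM r s : cR (r * s) = cR r * cR s.
Proof. by apply: cplx_eqP; rewrite ?reCM ?imCM /= ?mul0r ?mulr0 ?subr0 ?addr0. Qed.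
Lemma cR0 : cR 0 = 0. Proof. by []. Qed.
Lemma cR1 : cR 1 = 1. Proof. by []. Qed.
Lemma cR_gt0 r : (0 < cR r) = (0 < r). Proof. by rewrite -cR0 ltr_cR. Qed.
Lemma cR_ge0 r : (0 <= cR r) = (0 <= r). Proof. by rewrite -cR0 ler_cR. Qed.

Lemma cR_reC x : 0 <= x -> cR (reC x) = x.
Proof. by move=> /(@ger0_Im R) x0; apply: cplx_eqP. Qed.

Lemma gt0_cR x : 0 < x -> exists2 r, 0 < r & x = cR r.
Proof.
by move=> x0; exists (reC x); rewrite -?cR_gt0 cR_reC // ltW.
Qed.

Lemma norm_cplx x : `|x| = cR (Num.sqrt (reC x ^+ 2 + imC x ^+ 2)).
Proof. exact: normc_def. Qed.

Lemma norm_reC x : cR `|reC x| <= `|x|. Proof. exact: normc_ge_Re. Qed.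
Lemma norm_imC x : cR `|imC x| <= `|x|.
Proof.
rewrite norm_cplx ler_cR -sqrtr_sqr ler_sqrt.
  by rewrite lerDr sqr_ge0.
by rewrite addr_ge0 ?sqr_ge0.
Qed.

End CplxReal.

Section MxNorm.
Variables (K : numFieldType) (m n : nat).
Implicit Type A : 'M[K]_(m, n).

Lemma mx_norm_ge A i j : `|A i j| <= `|A|.
Proof.
rewrite [leRHS]/Num.Def.normr /= mx_normE -[leLHS]nngE num_le.
exact: (le_bigmax _ (fun ij => `|A ij.1 ij.2|%:nng) (i, j)).
Qed.

Lemma mx_norm_le A (c : K) : 0 <= c ->
  (forall i j, `|A i j| <= c) -> `|A| <= c.
Proof.
move=> c0 H; rewrite [leLHS]/Num.Def.normr /= mx_normE.
have [x xc] : exists x : {nonneg K}, c = x%:num by exists (NngNum c0).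
rewrite xc num_le; apply/bigmax_leP; split=> [|ij _].
  by rewrite -num_le /= -xc.
by rewrite -num_le /= -xc; exact: H.
Qed.
End MxNorm.

Section Realify.
Variable R : realType.
Local Notation C := (Cplx R).
Local Notation CM m n := ('M[C]_(m, n) : normedModType C).
Local Notation RM m n := (('M[R]_(m, n) * 'M[R]_(m, n))%type : normedModType R).

Lemma cplxifyK m n : cancel (@cplxify R m n) (@realify R m n).
Proof.
by move=> [X Y]; congr pair; apply/matrixP => i j; rewrite !mxE.
Qed.
Lemma realifyK m n : cancel (@realify R m n) (@cplxify R m n).
Proof. by move=> A; apply/matrixP => i j; rewrite !mxE mkC_re_im. Qed.

Lemma cplxifyD m n (X Y : 'M[R]_(m, n) * 'M[R]_(m, n)) :
  cplxify (X + Y) = cplxify X + cplxify Y.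
Proof.
by apply/matrixP => i j; rewrite !mxE; apply: cplx_eqP; rewrite ?reCD ?imCD.
Qed.
Lemma realifyD m n (A B : 'M[C]_(m, n)) :
  realify (A + B) = realify A + realify B.
Proof. by apply: (can_inj (@cplxifyK m n)); rewrite cplxifyD !realifyK. Qed.
Lemma cplxifyZ m n r (X : 'M[R]_(m, n) * 'M[R]_(m, n)) :
  cplxify (r *: X) = cR r *: cplxify X.
Proof.
apply/matrixP => i j; rewrite !mxE; apply: cplx_eqP; rewrite ?reCM ?imCM //=.
  by rewrite mul0r subr0.
by rewrite mul0r addr0.
Qed.
Lemma realifyZ m n r (A : 'M[C]_(m, n)) : realify (cR r *: A) = r *: realify A.
Proof. by apply: (can_inj (@cplxifyK m n)); rewrite cplxifyZ !realifyK. Qed.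
Lemma cplxifyN m n (X : 'M[R]_(m, n) * 'M[R]_(m, n)) :
  cplxify (- X) = - cplxify X.
Proof.
by apply/matrixP => i j; rewrite !mxE; apply: cplx_eqP; rewrite ?reCN ?imCN.
Qed.
Lemma realifyN m n (A : 'M[C]_(m, n)) : realify (- A) = - realify A.
Proof. by apply: (can_inj (@cplxifyK m n)); rewrite cplxifyN !realifyK. Qed.

Lemma cplxifyB m n (X Y : 'M[R]_(m, n) * 'M[R]_(m, n)) :
  cplxify (X - Y) = cplxify X - cplxify Y.
Proof. by rewrite cplxifyD cplxifyN. Qed.
Lemma realifyB m n (A B : 'M[C]_(m, n)) :
  realify (A - B) = realify A - realify B.
Proof. by rewrite realifyD realifyN. Qed.

Lemma norm_realify m n (A : 'M[C]_(m, n)) : cR `|realify A| <= `|A|.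
Proof.
have H (B : 'M[R]_(m, n)) : (forall i j, cR `|B i j| <= `|A i j|) -> cR (`|B| : R) <= `|A|.
  move=> BA; rewrite -[leRHS]cR_reC ?normr_ge0 // ler_cR.
  apply: mx_norm_le => [|i j]; rewrite -?ler_cR cR_reC ?normr_ge0 //.
  exact: le_trans (BA i j) (mx_norm_ge _ _ _).
rewrite prod_normE /=; case: (leP _ _) => _; apply: H => i j; rewrite !mxE.
  exact: norm_imC.
exact: norm_reC.
Qed.

(** The constant 2 is a crude form of the square root of 2; any constant gives continuity. *)
Lemma norm_cplxify m n (X : 'M[R]_(m, n) * 'M[R]_(m, n)) :
  `|cplxify X| <= cR (2 * `|X|).
Proof.
apply: mx_norm_le => [|i j]; first by rewrite cR_ge0 mulr_ge0.
rewrite mxE norm_cplx ler_cR /=.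
have X1 : `|X.1 i j| <= `|X|.
  by apply: le_trans (mx_norm_ge X.1 i j) _; rewrite prod_normE le_max lexx.
have X2 : `|X.2 i j| <= `|X|.
  by apply: le_trans (mx_norm_ge X.2 i j) _; rewrite prod_normE le_max lexx orbT.
rewrite -[leRHS]ger0_norm ?mulr_ge0 // -sqrtr_sqr ler_sqrt ?sqr_ge0 //.
rewrite -(real_normK (num_real (X.1 i j))) -(real_normK (num_real (X.2 i j))).
have := normr_ge0 X; have := normr_ge0 (X.1 i j); have := normr_ge0 (X.2 i j).
nra.
Qed.

Lemma realify_continuous m n : continuous (@realify R m n : CM m n -> RM m n).
Proof.
move=> A; have FA : Filter (nbhs (A : CM m n)) by exact: nbhs_filter.
apply/(@cvgrPdist_lt _ _ _ _ FA) => e e0.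
have : \forall B \near A, `|A - B| < cR e.
  have := @cvgr_dist_lt _ _ _ (nbhs (A : ('M[C]_(m, n) : normedModType C))) _ id A
    cvg_id (cR e).
  by rewrite cR_gt0; apply.
apply: filterS => B AB; rewrite -realifyB -ltr_cR.
exact: le_lt_trans (norm_realify _) AB.
Qed.

Lemma cplxify_continuous m n : continuous (@cplxify R m n : RM m n -> CM m n).
Proof.
move=> A; apply/cvgrPdist_lt => _ /gt0_cR [e e0 ->].
have : \forall B \near A, `|A - B| < e / 2.
  have e2 : 0 < e / 2 by rewrite divr_gt0.
  exact: (@cvgr_dist_lt _ _ _ (nbhs A) _ id A cvg_id _ e2).
apply: filterS => B AB; rewrite -cplxifyB.
apply: le_lt_trans (norm_cplxify _) _.
by rewrite ltr_cR mulrC -ltr_pdivlMr.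
Qed.

Section RLinear.
Variables (m n p q : nat) (L : {linear 'M[C]_(m, n) -> 'M[C]_(p, q)}).

Definition rlinear (X : 'M[R]_(m, n) * 'M[R]_(m, n)) := realify (L (cplxify X)).

Lemma rlinear_is_linear : linear rlinear.
Proof.
move=> a X Y.
by rewrite /rlinear cplxifyD cplxifyZ linearD linearZ realifyD realifyZ.
Qed.
HB.instance Definition _ := GRing.isLinear.Build R
  ('M[R]_(m, n) * 'M[R]_(m, n))%type ('M[R]_(p, q) * 'M[R]_(p, q))%type _
  rlinear rlinear_is_linear.

Lemma rlinear_continuous : continuous (L : CM m n -> CM p q) ->
  continuous (rlinear : RM m n -> RM p q).
Proof.
move=> Lc X; apply: continuous_comp; last exact: realify_continuous.
apply: continuous_comp; [exact: cplxify_continuous | exact: Lc].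
Qed.
End RLinear.

Definition rfun m n p q (F : 'M[C]_(m, n) -> 'M[C]_(p, q)) :
    RM m n -> RM p q := @realify R p q \o F \o @cplxify R m n.

(** The complex differential, read in real coordinates, satisfies the same first-order estimate up
    to the comparison of norms; [e / 2] absorbs the factor 2 of [norm_cplxify]. *)
Lemma differentiable_rfun m n p q (F : CM m n -> CM p q) (X : RM m n) :
  differentiable F (cplxify X) ->
  differentiable (rfun F) X /\
  forall v, 'D_v (rfun F) X = realify ('D_(cplxify v) F (cplxify X)).
Proof.
move=> dF.
have dLc : continuous ('d F (cplxify X)) by exact: diff_continuous.
suff [d1 d2] : differentiable (rfun F) X /\
    'd (rfun F) X = rlinear ('d F (cplxify X)) :> (RM m n -> RM p q).
  by split=> // v; rewrite deriveE // d2 /rlinear deriveE.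
apply: differentiable_eps; first exact: rlinear_continuous.
move=> e e0; have e2 : 0 < cR (e / 2) by rewrite cR_gt0 divr_gt0.
have := differentiable_epsP dF e2 => near0.
have : \forall h \near (0 : RM m n), `|F (cplxify h + cplxify X)
    - F (cplxify X) - 'd F (cplxify X) (cplxify h)| <= cR (e / 2) * `|cplxify h|.
  have c0 : cplxify (0 : RM m n) = 0.
    by apply/matrixP => i j; rewrite !mxE.
  by have := @cplxify_continuous m n 0; rewrite /continuous_at c0 => /(_ _ near0).
apply: filterS => h H.
rewrite /rlinear /rfun /= cplxifyD -!realifyB -ler_cR.
apply: le_trans (norm_realify _) _; apply: le_trans H _.
apply: le_trans (ler_wpM2l (ltW e2) (norm_cplxify h)) _.
by rewrite -cRM ler_cR mulrA divfK.
Qed.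

Lemma diff_order_rfun m n p q k (U : set 'M[C]_(m, n)) (F : CM m n -> CM p q) :
  open U -> diff_order k U F -> diff_order k (@cplxify R m n @^-1` U) (rfun F).
Proof.
move=> Uo; have Vo : open ((@cplxify R m n : RM m n -> CM m n) @^-1` U).
  by apply: open_comp => // X _; exact: cplxify_continuous.
elim: k F => [|k IH] F.
  move=> Fc X UX; apply: continuous_comp.
    exact: cplxify_continuous.
  by apply: continuous_comp; [exact: Fc | exact: realify_continuous].
move=> [dF dDF]; split=> [X UX|v].
  by have [] := differentiable_rfun (dF _ UX).
apply: (diff_order_eq (f := rfun ('D_(cplxify v) F))) => //.
  by move=> X UX; have [_ ->] := differentiable_rfun (dF _ UX).
by apply: IH; exact: dDF.
Qed.

Lemma smooth_near_rfun m n p q (A : 'M[C]_(m, n)) (F : CM m n -> CM p q) :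
  smooth_near A F -> smooth_near (realify A) (rfun F).
Proof.
move=> [U [Uo UA] sF]; exists (@cplxify R m n @^-1` U).
  split; last by rewrite /= realifyK.
  by apply: open_comp Uo => // X _; exact: cplxify_continuous.
by move=> k; apply: diff_order_rfun.
Qed.

End Realify.

Lemma jacobianE (K : numFieldType) m n (f : 'rV[K]_m -> 'rV[K]_n) x i l :
  differentiable f x -> 'J f x i l = 'D_(delta_mx 0 i) f x 0 l.
Proof. by move=> df; rewrite (deriveEjacobian (delta_mx 0 i) df) -rowE [RHS]mxE. Qed.

Section LeviAlgebra.
Variable R : realType.

(** The algebraic half of the chain rule for the Levi matrix: [p + i q] stands for first derivatives
    of a holomorphic map, [hr + i hi] for its second derivatives, [fx], [fy] and [xx], [xy], [yx],
    [yy] for derivatives of the function. With signs dictated by Cauchy-Riemann, the terms in [hr]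
    and [hi] cancel, leaving J L J^*. *)
Lemma levi_algebra m (pj qj : 'I_m -> R) n (pk qk hr hi fx fy : 'I_n -> R)
    (xx xy yx yy : 'I_m -> 'I_n -> R) (I := index_enum 'I_m) :
  let dxx l := \sum_i (pj i * xx i l + qj i * yx i l) in
  let dxy l := \sum_i (pj i * xy i l + qj i * yy i l) in
  let dyx l := \sum_i (- qj i * xx i l + pj i * yx i l) in
  let dyy l := \sum_i (- qj i * xy i l + pj i * yy i l) in
  mkC ((\sum_l (pk l * dxx l + hr l * fx l + (qk l * dxy l + hi l * fy l)) +
        \sum_l (- qk l * dyx l + - hr l * fx l + (pk l * dyy l + - hi l * fy l))) / 4)
      ((\sum_l (- qk l * dxx l + - hi l * fx l + (pk l * dxy l + hr l * fy l)) -
        \sum_l (pk l * dyx l + - hi l * fx l + (qk l * dyy l + hr l * fy l))) / 4) =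
  \sum_l (\sum_i mkC (pj i) (qj i) * mkC ((xx i l + yy i l) / 4)
      ((xy i l - yx i l) / 4) * mkC (pk l) (- qk l)).
Proof.
move=> dxx dxy dyx dyy.
apply: cplx_eqP.
  rewrite reC_mkC reC_sum -big_split /= mulr_suml; apply: eq_bigr => l _; rewrite reC_sum.
  rewrite [LHS](_ : _ = (pk l * (dxx l + dyy l) + qk l * (dxy l - dyx l)) / 4);
    last by ring.
  rewrite /dxx /dxy /dyx /dyy -big_split -sumrB /= !mulr_sumr -big_split mulr_suml.
  by apply: eq_bigr => i _;
  rewrite ?reCM ?imCM ?reCM ?imCM ?reC_mkC ?imC_mkC /=; field.
rewrite imC_mkC imC_sum -sumrB /= mulr_suml; apply: eq_bigr => l _; rewrite imC_sum.
rewrite [LHS](_ : _ = (pk l * (dxy l - dyx l) - qk l * (dxx l + dyy l)) / 4);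
  last by ring.
rewrite /dxx /dxy /dyx /dyy -big_split -sumrB /= !mulr_sumr -sumrB mulr_suml.
by apply: eq_bigr => i _;
  rewrite ?reCM ?imCM ?reCM ?imCM ?reC_mkC ?imC_mkC /=; field.
Qed.

Lemma eq_sum4 (a b c d e f g h a' b' c' e' f' g' : R) :
  a = a' -> b = b' -> c = c' -> e = e' -> f = f' -> g = g' ->
  a * b + c * d + (e * f + g * h) = a' * b' + c' * d + (e' * f' + g' * h).
Proof. by move=> -> -> -> -> -> ->. Qed.

End LeviAlgebra.

(** * The chain rule for the Levi matrix *)

Section LeviChain.
Variable R : realType.
Local Notation C := (Cplx R).
Local Notation CV n := ('rV[C]_n : normedModType C).
Local Notation RV n := (('rV[R]_n * 'rV[R]_n)%type : normedModType R).

Definition dirx n (j : 'I_n) : RV n := (delta_mx 0 j, 0).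
Definition diry n (j : 'I_n) : RV n := (0, delta_mx 0 j).

Definition cxpart n (l : 'I_n) : {linear RV n -> R} :=
  @mx_coord R 1 n 0 l \o (@fst 'rV[R]_n 'rV[R]_n).
Definition cypart n (l : 'I_n) : {linear RV n -> R} :=
  @mx_coord R 1 n 0 l \o (@snd 'rV[R]_n 'rV[R]_n).

Lemma cxpart_continuous n (l : 'I_n) : continuous (cxpart l).
Proof.
by move=> X; apply: continuous_comp; [exact: cvg_fst | exact: mx_coord_continuous].
Qed.
Lemma cypart_continuous n (l : 'I_n) : continuous (cypart l).
Proof.
by move=> X; apply: continuous_comp; [exact: cvg_snd | exact: mx_coord_continuous].
Qed.

Lemma RV_dir_sum n (X : RV n) :
  X = \sum_l (cxpart l X *: dirx l + cypart l X *: diry l).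
Proof.
case: X => x y; apply: injective_projections.
  rewrite (raddf_sum (@fst 'rV[R]_n 'rV[R]_n)) /=.
  by rewrite [LHS]row_sum_delta; apply: eq_bigr => l _; rewrite scaler0 addr0.
rewrite (raddf_sum (@snd 'rV[R]_n 'rV[R]_n)) /=.
by rewrite [LHS]row_sum_delta; apply: eq_bigr => l _; rewrite scaler0 add0r.
Qed.

Lemma cplxify_dirx n (j : 'I_n) : cplxify (dirx j) = delta_mx 0 j.
Proof.
apply/matrixP => a b; rewrite !mxE; apply: cplx_eqP => //=.
  by case: (_ && _).
by case: (_ && _).
Qed.

Definition iC : C := mkC 0 1.

Lemma cplxify_diry n (j : 'I_n) : cplxify (diry j) = iC *: delta_mx 0 j.
Proof.
apply/matrixP => a b; rewrite !mxE; apply: cplx_eqP; rewrite ?reCM ?imCM /=.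
  by case: (_ && _) => /=; rewrite ?mulr0 ?mul0r subrr.
by case: (_ && _) => /=; rewrite ?mulr0 ?mul0r ?mulr1 ?add0r ?addr0.
Qed.

Section Pair.
Variables (m n : nat) (G : CV m -> CV n).

Definition pd (k : 'I_m) : CV m -> CV n := 'D_(delta_mx 0 k) G.

Lemma derive_rfun_x k X : differentiable G (cplxify X) ->
  'D_(dirx k) (rfun G) X = realify (pd k (cplxify X)).
Proof.
by move=> /differentiable_rfun [_ ->]; rewrite cplxify_dirx.
Qed.

(** The Cauchy-Riemann equations: [diry] is i times [dirx], and the complex differential is linear
    over C. *)
Lemma derive_rfun_y k X : differentiable G (cplxify X) ->
  'D_(diry k) (rfun G) X = realify (iC *: pd k (cplxify X)).
Proof.
move=> dG; have [_ ->] := differentiable_rfun dG.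
by rewrite cplxify_diry !deriveE // linearZ /pd deriveE.
Qed.

Let A k l (X : RV m) : R := reC (pd k (cplxify X) 0 l).
Let B k l (X : RV m) : R := imC (pd k (cplxify X) 0 l).

Lemma derive_comp_rfun (g : RV n -> R) X v :
  differentiable G (cplxify X) -> differentiable g (rfun G X) ->
  'D_v (g \o rfun G) X = \sum_l (cxpart l ('D_v (rfun G) X) * 'D_(dirx l) g (rfun G X)
     + cypart l ('D_v (rfun G) X) * 'D_(diry l) g (rfun G X)).
Proof.
move=> dG dg; have [drG _] := differentiable_rfun dG.
rewrite deriveE; last exact: differentiable_comp.
rewrite (diff_comp drG dg) /= deriveE //.
rewrite {1}(RV_dir_sum ('d (rfun G) X v)) linear_sum; apply: eq_bigr => l _.
by rewrite linearD !linearZ /= !deriveE.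
Qed.

Lemma derive_comp_x (g : RV n -> R) X k :
  differentiable G (cplxify X) -> differentiable g (rfun G X) ->
  'D_(dirx k) (g \o rfun G) X =
  \sum_l (A k l X * 'D_(dirx l) g (rfun G X) + B k l X * 'D_(diry l) g (rfun G X)).
Proof.
move=> dG dg; rewrite derive_comp_rfun // derive_rfun_x //.
by apply: eq_bigr => l _; rewrite /A /B /= /mx_coord !mxE.
Qed.

Lemma derive_comp_y (g : RV n -> R) X k :
  differentiable G (cplxify X) -> differentiable g (rfun G X) ->
  'D_(diry k) (g \o rfun G) X =
  \sum_l (- B k l X * 'D_(dirx l) g (rfun G X) + A k l X * 'D_(diry l) g (rfun G X)).
Proof.
move=> dG dg; rewrite derive_comp_rfun // derive_rfun_y //.
apply: eq_bigr => l _; rewrite /A /B /= /mx_coord !mxE reCM imCM /=.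
by rewrite !mul0r !mul1r sub0r add0r.
Qed.

End Pair.

Definition repart m n (h : CV m -> CV n) (l : 'I_n) : RV m -> R :=
  cxpart l \o rfun h.
Definition impart m n (h : CV m -> CV n) (l : 'I_n) : RV m -> R :=
  cypart l \o rfun h.

Lemma derive_parts m n (h : CV m -> CV n) l X : differentiable h (cplxify X) ->
  [/\ differentiable (repart h l) X, differentiable (impart h l) X &
      forall j, [/\ 'D_(dirx j) (repart h l) X = reC (pd h j (cplxify X) 0 l),
      'D_(dirx j) (impart h l) X = imC (pd h j (cplxify X) 0 l),
      'D_(diry j) (repart h l) X = - imC (pd h j (cplxify X) 0 l) &
      'D_(diry j) (impart h l) X = reC (pd h j (cplxify X) 0 l)]].
Proof.
move=> dh; have [drh _] := differentiable_rfun dh.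
have [dre Dre] := differentiable_linear_comp (@cxpart_continuous n l) drh.
have [dim Dim] := differentiable_linear_comp (@cypart_continuous n l) drh.
split=> // j; rewrite !Dre !Dim derive_rfun_x // derive_rfun_y //.
rewrite /= /mx_coord !mxE ?reCM ?imCM /=.
by rewrite !mul0r !mul1r sub0r add0r.
Qed.

(** Differentiating twice by the real chain rule produces second derivatives of [G], which
    holomorphy makes cancel in [levi_algebra]. *)
Lemma levi_comp m n (u : CV n -> R) (G : CV m -> CV n) z :
  smooth_near z G ->
  smooth_near (realify (G z)) (u \o @cplxify R 1 n) ->
  levi (u \o G) z = 'J G z *m levi u (G z) *m adjmx ('J G z).
Proof.
move=> sG su; pose f : RV n -> R := u \o @cplxify R 1 n.
have dGz := smooth_near_differentiable sG.
have uGE : (u \o G) \o @cplxify R 1 m = f \o rfun G.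
  by apply/funext => X; rewrite /f /rfun /= realifyK.
pose a := realify z; have aE : cplxify a = z by rewrite realifyK.
have bE : rfun G a = realify (G z) by rewrite /rfun /= aE.
have nearG : \forall X \near (a : RV m), smooth_near (cplxify X) G.
  by have := @cplxify_continuous R 1 m a; rewrite /continuous_at aE => /(_ _ (smooth_near_near sG)).
have rGc : {for a, continuous (rfun G)}.
  by apply: smooth_near_continuous; exact: smooth_near_rfun.
have nearf : \forall X \near (a : RV m), smooth_near (rfun G X) f.
  by move: rGc; rewrite /prop_for /continuous_at bE => /(_ _ (smooth_near_near su)).
have sf1 v : smooth_near (rfun G a) ('D_v f).
  by rewrite bE; apply: smooth_near_derive.
have df1 v := smooth_near_differentiable (sf1 v).
have spd k : smooth_near (cplxify a) (pd G k).
  by rewrite aE; apply: smooth_near_derive.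
have dpd k := smooth_near_differentiable (spd k).
have dGa : differentiable G (cplxify a) by rewrite aE.
have drG : differentiable (rfun G) a by have [] := differentiable_rfun dGa.
have dfx v : differentiable ('D_v f \o rfun G) a.
  exact: differentiable_comp.
(* The first-order formulas are needed on a neighbourhood of [a], since they are differentiated once
   more. *)
have Dx k : {near a, 'D_(dirx k) (f \o rfun G) =1
  (fun X => \sum_l (repart (pd G k) l X * ('D_(dirx l) f \o rfun G) X
                  + impart (pd G k) l X * ('D_(diry l) f \o rfun G) X))}.
  near=> X; have /smooth_near_differentiable dGX : smooth_near (cplxify X) G.
    by near: X.
  have /smooth_near_differentiable dfX : smooth_near (rfun G X) f by near: X.
  rewrite derive_comp_x //; apply: eq_bigr => l _.
  by rewrite /repart /impart /= /mx_coord /rfun /= !mxE.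
have Dy k : {near a, 'D_(diry k) (f \o rfun G) =1
  (fun X => \sum_l (- impart (pd G k) l X * ('D_(dirx l) f \o rfun G) X
                  + repart (pd G k) l X * ('D_(diry l) f \o rfun G) X))}.
  near=> X; have /smooth_near_differentiable dGX : smooth_near (cplxify X) G.
    by near: X.
  have /smooth_near_differentiable dfX : smooth_near (rfun G X) f by near: X.
  rewrite derive_comp_y //; apply: eq_bigr => l _.
  by rewrite /repart /impart /= /mx_coord /rfun /= !mxE.
have Dsum v (al be : 'I_n -> RV m -> R) :
  (forall l, differentiable (al l) a) -> (forall l, differentiable (be l) a) ->
  'D_v (fun X => \sum_l (al l X * ('D_(dirx l) f \o rfun G) X
                  + be l X * ('D_(diry l) f \o rfun G) X)) a =
  \sum_l (al l a * 'D_v ('D_(dirx l) f \o rfun G) a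
    + 'D_v (al l) a * 'D_(dirx l) f (rfun G a)
    + (be l a * 'D_v ('D_(diry l) f \o rfun G) a
    + 'D_v (be l) a * 'D_(diry l) f (rfun G a))).
  move=> dal dbe.
  have sE : (fun X => \sum_l (al l X * ('D_(dirx l) f \o rfun G) X
                  + be l X * ('D_(diry l) f \o rfun G) X)) =
    \sum_l ((fun X => al l X * ('D_(dirx l) f \o rfun G) X)
                  + (fun X => be l X * ('D_(diry l) f \o rfun G) X)).
    by apply/funext => X; rewrite fct_sumE.
  have d1 l := is_diff_scale (dal l) (dfx (dirx l)).
  have d2 l := is_diff_scale (dbe l) (dfx (diry l)).
  rewrite sE derive_sum => [|l]; last first.
    by apply: derivableD; apply: diff_derivable; [case: (d1 l) | case: (d2 l)].
  apply: eq_bigr => l _; rewrite deriveD.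
  - by congr (_ + _); [exact: (d1 l).2 v | exact: (d2 l).2 v].
  - by apply: diff_derivable; case: (d1 l).
  - by apply: diff_derivable; case: (d2 l).
apply/matrixP => j k.
have JE i l : 'J G z i l = pd G i z 0 l.
  exact: (jacobianE i l dGz).
have parts k' l := derive_parts l (dpd k').
have dre k' l : differentiable (repart (pd G k') l) a by have [] := parts k' l.
have dim k' l : differentiable (impart (pd G k') l) a by have [] := parts k' l.
have dNim k' l : differentiable (fun X => - impart (pd G k') l X) a.
  exact: differentiableN.
have DNim v k' l : 'D_v (fun X => - impart (pd G k') l X) a =
   - 'D_v (impart (pd G k') l) a.
  by apply: deriveN; apply: diff_derivable.
have reE k' l : repart (pd G k') l a = reC (pd G k' z 0 l).
  by rewrite /repart /= /mx_coord /rfun /= aE mxE.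
have imE k' l : impart (pd G k') l a = imC (pd G k' z 0 l).
  by rewrite /impart /= /mx_coord /rfun /= aE mxE.
pose xx i l := 'D_(dirx i) ('D_(dirx l) f) (rfun G a).
pose xy i l := 'D_(dirx i) ('D_(diry l) f) (rfun G a).
pose yx i l := 'D_(diry i) ('D_(dirx l) f) (rfun G a).
pose yy i l := 'D_(diry i) ('D_(diry l) f) (rfun G a).
pose p i l := reC (pd G i z 0 l).
pose q i l := imC (pd G i z 0 l).
pose hr l := reC (pd (pd G k) j (cplxify a) 0 l).
pose hi l := imC (pd (pd G k) j (cplxify a) 0 l).
pose fx l := 'D_(dirx l) f (rfun G a).
pose fy l := 'D_(diry l) f (rfun G a).
have Xx l : 'D_(dirx j) ('D_(dirx l) f \o rfun G) a =
    \sum_i (p j i * xx i l + q j i * yx i l).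
  by rewrite (derive_comp_x _ dGa (df1 _)) aE.
have Xy l : 'D_(dirx j) ('D_(diry l) f \o rfun G) a =
    \sum_i (p j i * xy i l + q j i * yy i l).
  by rewrite (derive_comp_x _ dGa (df1 _)) aE.
have Yx l : 'D_(diry j) ('D_(dirx l) f \o rfun G) a =
    \sum_i (- q j i * xx i l + p j i * yx i l).
  by rewrite (derive_comp_y _ dGa (df1 _)) aE.
have Yy l : 'D_(diry j) ('D_(diry l) f \o rfun G) a =
    \sum_i (- q j i * xy i l + p j i * yy i l).
  by rewrite (derive_comp_y _ dGa (df1 _)) aE.
have Exx : 'D_(dirx j) ('D_(dirx k) (f \o rfun G)) a =
  \sum_l (p k l * (\sum_i (p j i * xx i l + q j i * yx i l)) + hr l * fx l
    + (q k l * (\sum_i (p j i * xy i l + q j i * yy i l)) + hi l * fy l)).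
  rewrite (near_eq_derive (dirx j) (Dx k)) (Dsum _ _ _ (dre k) (dim k)).
  apply: eq_bigr => l _; have [_ _ /(_ j) [e1 e2 _ _]] := parts k l.
  exact: (eq_sum4 _ _ (reE k l) (Xx l) e1 (imE k l) (Xy l) e2).
have Exy : 'D_(dirx j) ('D_(diry k) (f \o rfun G)) a =
  \sum_l (- q k l * (\sum_i (p j i * xx i l + q j i * yx i l)) + - hi l * fx l
    + (p k l * (\sum_i (p j i * xy i l + q j i * yy i l)) + hr l * fy l)).
  rewrite (near_eq_derive (dirx j) (Dy k)) (Dsum _ _ _ (dNim k) (dre k)).
  apply: eq_bigr => l _; have [_ _ /(_ j) [e1 e2 _ _]] := parts k l.
  exact: (eq_sum4 _ _ (f_equal -%R (imE k l)) (Xx l)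
    (etrans (DNim _ k l) (f_equal -%R e2)) (reE k l) (Xy l) e1).
have Eyx : 'D_(diry j) ('D_(dirx k) (f \o rfun G)) a =
  \sum_l (p k l * (\sum_i (- q j i * xx i l + p j i * yx i l)) + - hi l * fx l
    + (q k l * (\sum_i (- q j i * xy i l + p j i * yy i l)) + hr l * fy l)).
  rewrite (near_eq_derive (diry j) (Dx k)) (Dsum _ _ _ (dre k) (dim k)).
  apply: eq_bigr => l _; have [_ _ /(_ j) [_ _ e1 e2]] := parts k l.
  exact: (eq_sum4 _ _ (reE k l) (Yx l) e1 (imE k l) (Yy l) e2).
have Eyy : 'D_(diry j) ('D_(diry k) (f \o rfun G)) a =
  \sum_l (- q k l * (\sum_i (- q j i * xx i l + p j i * yx i l)) + - hr l * fx l
    + (p k l * (\sum_i (- q j i * xy i l + p j i * yy i l)) + - hi l * fy l)).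
  rewrite (near_eq_derive (diry j) (Dy k)) (Dsum _ _ _ (dNim k) (dre k)).
  apply: eq_bigr => l _; have [_ _ /(_ j) [_ _ e1 e2]] := parts k l.
  exact: (eq_sum4 _ _ (f_equal -%R (imE k l)) (Yx l)
    (etrans (DNim _ k l) (f_equal -%R e2)) (reE k l) (Yy l) e1).
have lE i l : levi u (G z) i l =
    mkC ((xx i l + yy i l) / 4) ((xy i l - yx i l) / 4).
  by rewrite mxE -bE.
have -> : levi (u \o G) z j k =
    mkC (('D_(dirx j) ('D_(dirx k) (f \o rfun G)) a +
          'D_(diry j) ('D_(diry k) (f \o rfun G)) a) / 4)
        (('D_(dirx j) ('D_(diry k) (f \o rfun G)) a -
          'D_(diry j) ('D_(dirx k) (f \o rfun G)) a) / 4).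
  by rewrite mxE uGE.
apply: etrans; first exact: (f_equal2 (@mkC R) (f_equal2 (fun a b => (a + b) / 4) Exx Eyy)
  (f_equal2 (fun a b => (a - b) / 4) Exy Eyx)).
rewrite [RHS]mxE.
have -> : \sum_j0 ('J G z *m levi u (G z)) j j0 * adjmx ('J G z) j0 k =
   \sum_l (\sum_i mkC (p j i) (q j i) * mkC ((xx i l + yy i l) / 4)
      ((xy i l - yx i l) / 4) * mkC (p k l) (- q k l)).
  apply: eq_bigr => l _; rewrite mxE mulr_suml; apply: eq_bigr => i _.
  rewrite lE JE [adjmx _ _ _]mxE [map_mx _ _ _ _]mxE JE conjC_complex.
  by rewrite /p /q mkC_re_im.
exact: levi_algebra.
Unshelve. all: by end_near.
Qed.
End LeviChain.

(** * Charts and holomorphic maps *)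

Section Jacobian.
Variable K : numFieldType.

Lemma jacobian_near_eq m n (f g : 'rV[K]_m -> 'rV[K]_n) x :
  differentiable f x -> {near x, f =1 g} -> 'J f x = 'J g x.
Proof.
move=> df fg; apply/matrixP => i j.
have dg := differentiable_near_eq fg df.
have D := f_equal (fun A : 'rV_n => A 0 j) (near_eq_derive (delta_mx 0 i) fg).
exact (etrans (jacobianE i j df) (etrans D (esym (jacobianE i j dg)))).
Qed.

Lemma jacobian_comp m n p (f : 'rV[K]_m -> 'rV[K]_n) (g : 'rV[K]_n -> 'rV[K]_p) x :
  differentiable f x -> differentiable g (f x) ->
  'J (g \o f) x = 'J f x *m 'J g (f x).
Proof.
move=> df dg; apply/row_matrixP => i; rewrite row_mul !rowE -!deriveEjacobian //.
  by rewrite deriveE ?(diff_comp df dg) ?deriveE //; exact: differentiable_comp.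
exact: differentiable_comp.
Qed.

Lemma jacobian_id m (x : 'rV[K]_m) : 'J id x = 1%:M.
Proof.
have did : differentiable (@id 'rV[K]_m) x by exact: ex_diff.
apply/row_matrixP => i; rewrite !rowE -deriveEjacobian // derive_id.
by rewrite mulmx1.
Qed.

End Jacobian.

Section TopChart.
Variables (T E : topologicalType) (c : chart T E).
Hypothesis ctop : topological_chart c.

Lemma cmap_cvg p : cdom c p -> {for p, continuous (cmap c)}.
Proof.
case: ctop => [[co _] _ cc _] cp.
by move: cc; rewrite continuous_open_subspace // => /(_ p); apply; rewrite inE.
Qed.

Lemma cinv_cvg p : cdom c p -> {for cmap c p, continuous (cinv c)}.
Proof.
case: ctop => [[_ co] _ _ cc] cp.
move: cc; rewrite continuous_open_subspace // => /(_ (cmap c p)); apply.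
by rewrite inE; exists p.
Qed.

Lemma cmapK p : cdom c p -> cinv c (cmap c p) = p.
Proof. by case: ctop => _ + _ _ => /(_ p). Qed.

Lemma cdom_near p : cdom c p -> \forall q \near p, cdom c q.
Proof. by case: ctop => [[co _] _ _ _] cp; exact: open_nbhs_nbhs. Qed.

Lemma cimage_near p : cdom c p -> \forall y \near cmap c p, (cmap c @` cdom c) y.
Proof.
case: ctop => [[_ co] _ _ _] cp; apply: open_nbhs_nbhs; split=> //.
Qed.

Lemma cinvK_near p : cdom c p -> {near cmap c p, cmap c \o cinv c =1 id}.
Proof.
by move=> cp; apply: filterS (cimage_near cp) => _ [q cq <-] /=; rewrite cmapK.
Qed.

Lemma near_chart p (P : set T) : cdom c p ->
  (\forall q \near p, P q) -> \forall y \near cmap c p, P (cinv c y).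
Proof.
move=> cp; have := cinv_cvg cp; rewrite /prop_for /continuous_at cmapK //.
by apply.
Qed.

Lemma near_of_chart p (P : set E) : cdom c p ->
  (\forall y \near cmap c p, P y) -> \forall q \near p, P (cmap c q).
Proof. by move=> cp Pc; exact: (cmap_cvg cp). Qed.

End TopChart.

(** Inserting [cinv d \o cmap d] is legitimate only near [p], where continuity keeps [g] inside the
    domain of [d]. Changes of chart are reduced to this. *)
Lemma through_chart (T T' E E' : topologicalType) (Z : Type) (c : chart T E)
    (d : chart T' E') (g : T -> T') (f : T' -> Z) p :
  topological_chart c -> topological_chart d -> cdom c p -> cdom d (g p) ->
  {for p, continuous g} ->
  {near cmap c p, (f \o cinv d) \o (cmap d \o g \o cinv c) =1 f \o g \o cinv c}.
Proof.
move=> ct dt cp dgp gc.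
have : \forall q \near p, cdom d (g q) by apply: gc; exact: (cdom_near dt dgp).
by move=> /(near_chart ct cp); apply: filterS => y dy; rewrite /= (cmapK dt).
Qed.

Definition atlas (R : realType) n (M : charted R n) : Prop :=
  forall p : M, topological_chart (chart_at p) /\ cdom (chart_at p) p.

Section ChartMaps.
Context {R : realType} {n m : nat} {M : charted R n} {M' : charted R m}.
Hypotheses (aM : atlas M) (aM' : atlas M').
Local Notation C := (Cplx R).

Lemma in_chartsE (g : M -> M') p :
  in_charts g p (cmap (chart_at p) p) = cmap (chart_at (g p)) (g p).
Proof. by have [t d] := aM p; rewrite /in_charts /= (cmapK t). Qed.

Lemma through_in_charts (Z : Type) (g : M -> M') (f : M' -> Z) p :
  {for p, continuous g} ->
  {near cmap (chart_at p) p,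
    (f \o cinv (chart_at (g p))) \o in_charts g p =1 f \o g \o cinv (chart_at p)}.
Proof.
by have [t d] := aM p; have [t' d'] := aM' (g p); exact: through_chart.
Qed.

Lemma holomorphic_differentiable (g : M -> M') p : holomorphic g ->
  differentiable (in_charts g p) (cmap (chart_at p) p).
Proof. by move=> /(_ p) [_ /smooth_near_differentiable]. Qed.

(** Stated with differentiability at a point, because the Kodaira map of an arbitrary basis will be
    known only to be differentiable in charts. *)
Lemma jac_comp k (M'' : charted R k) (g : M -> M') (F : M' -> M'') p :
  {for p, continuous g} ->
  differentiable (in_charts g p) (cmap (chart_at p) p) ->
  differentiable (in_charts F (g p)) (cmap (chart_at (g p)) (g p)) ->
  differentiable (in_charts (F \o g) p) (cmap (chart_at p) p) /\
  jac (F \o g) p = jac g p *m jac F (g p).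
Proof.
move=> gc dg; rewrite -in_chartsE => dF.
have E : {near cmap (chart_at p) p,
    in_charts F (g p) \o in_charts g p =1 in_charts (F \o g) p}.
  exact: (through_in_charts (cmap (chart_at (F (g p))) \o F) gc).
have dc : differentiable (in_charts F (g p) \o in_charts g p)
    (cmap (chart_at p) p) by exact: differentiable_comp.
split; first exact: differentiable_near_eq dc.
apply: etrans (esym (jacobian_near_eq dc E)) _.
by apply: etrans (jacobian_comp dg dF) _; rewrite in_chartsE.
Qed.

Lemma holomorphic_fun_on_comp (g : M -> M') (U : set M') (f : M' -> C) :
  holomorphic g -> holomorphic_fun_on U f ->
  holomorphic_fun_on (g @^-1` U) (f \o g).
Proof.
move=> hg hf p Up; have [gc sg] := hg p.
apply: smooth_near_eq (through_in_charts f gc) _.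
apply: smooth_near_comp; [exact: finite_frame_mx | exact: sg |].
by rewrite in_chartsE; exact: hf.
Qed.

Lemma near_realify (Z : Type) (f g : 'rV[C]_n -> Z) z : {near z, f =1 g} ->
  {near realify z, f \o (@cplxify R 1 n) =1 g \o (@cplxify R 1 n)}.
Proof.
by move=> fg; have := @cplxify_continuous R 1 n (realify z);
  rewrite /continuous_at realifyK => /(_ _ fg).
Qed.

Lemma levi_near_eq (f g : 'rV[C]_n -> R) z : {near z, f =1 g} ->
  levi f z = levi g z.
Proof.
move=> /near_realify /near_join fg.
have D v : {near realify z, 'D_v (f \o @cplxify R 1 n) =1 'D_v (g \o @cplxify R 1 n)}.
  by apply: filterS fg => X; exact: near_eq_derive.
apply/matrixP => i j; rewrite [LHS]mxE [RHS]mxE.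
have Dxx := near_eq_derive (dirx R i) (D (dirx R j)).
have Dyy := near_eq_derive (diry R i) (D (diry R j)).
have Dxy := near_eq_derive (dirx R i) (D (diry R j)).
have Dyx := near_eq_derive (diry R i) (D (dirx R j)).
exact (f_equal2 (@mkC R) (f_equal2 (fun a b => (a + b) / 4) Dxx Dyy)
  (f_equal2 (fun a b => (a - b) / 4) Dxy Dyx)).
Qed.

Lemma smooth_fun_comp (g : M -> M') (f : M' -> R) :
  holomorphic g -> smooth_fun f -> smooth_fun (f \o g).
Proof.
move=> hg sf p; have [gc sg] := hg p.
apply: smooth_near_eq (near_realify (through_in_charts f gc)) _.
have -> : ((f \o cinv (chart_at (g p))) \o in_charts g p) \o @cplxify R 1 n =
    ((f \o cinv (chart_at (g p))) \o @cplxify R 1 m) \o rfun (in_charts g p).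
  by apply/funext => X; rewrite /rfun /= realifyK.
apply: smooth_near_comp.
- exact: finite_frame_pair (finite_frame_mx _ _ _) (finite_frame_mx _ _ _).
- exact: smooth_near_rfun.
- by rewrite /rfun /= realifyK in_chartsE; exact: sf.
Qed.

Lemma iddbar_comp (g : M -> M') (f : M' -> R) :
  holomorphic g -> smooth_fun f -> iddbar (f \o g) = pullback g (iddbar f).
Proof.
move=> hg sf; apply/funext => p; have [gc sg] := hg p.
apply: etrans (esym (levi_near_eq (through_in_charts f gc))) _.
have sf' := sf (g p); rewrite -in_chartsE in sf'.
by apply: etrans (levi_comp sg sf') _; rewrite in_chartsE.
Qed.

End ChartMaps.

Section Functoriality.
Context {R : realType} {n : nat} {M : charted R n}.
Hypothesis aM : atlas M.

Lemma adjmxM m p q (A : 'M[Cplx R]_(m, p)) (B : 'M[Cplx R]_(p, q)) :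
  adjmx (A *m B) = adjmx B *m adjmx A.
Proof. by rewrite /adjmx map_mxM trmx_mul. Qed.

Lemma adjmx1 m : adjmx (1%:M : 'M[Cplx R]_m) = 1%:M.
Proof. by rewrite /adjmx map_mx1 trmx1. Qed.

Lemma pullback_comp m (N : charted R m) (g : M -> M) (F : M -> N) (w : form11 N) :
  holomorphic g ->
  (forall p, differentiable (in_charts F p) (cmap (chart_at p) p)) ->
  pullback (F \o g) w = pullback g (pullback F w).
Proof.
move=> hg dF; apply/funext => p; rewrite /pullback.
have [gc _] := hg p.
have [_ ->] := jac_comp aM aM gc (holomorphic_differentiable _ hg) (dF _).
by rewrite adjmxM !mulmxA.
Qed.

Lemma jac_id (p : M) : jac id p = 1%:M.
Proof.
have [t d] := aM p.
rewrite -(jacobian_id (cmap (chart_at p) p)); apply/esym/jacobian_near_eq.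
  exact: ex_diff.
by apply: filterS (cinvK_near t d) => y /esym.
Qed.

Lemma jac_inverse (g h : M -> M) p : holomorphic g -> holomorphic h ->
  cancel g h -> jac g p *m jac h (g p) = 1%:M.
Proof.
move=> hg hh gh; have [gc _] := hg p.
have [_ <-] := jac_comp aM aM gc (holomorphic_differentiable _ hg)
  (holomorphic_differentiable _ hh).
have -> : h \o g = id by apply/funext => x; exact: gh.
exact: jac_id.
Qed.

Lemma pullback_cancel (g h : M -> M) (w : form11 M) :
  holomorphic g -> holomorphic h -> cancel g h ->
  pullback g (pullback h w) = w.
Proof.
move=> hg hh gh.
have /= <- := pullback_comp w hg (fun p => holomorphic_differentiable p hh).
have -> : h \o g = id by apply/funext => x; exact: gh.
by apply/funext => p; rewrite /pullback jac_id adjmx1 mulmx1 mul1mx.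
Qed.

End Functoriality.

(** * The Fubini-Study form and Kodaira maps *)

Lemma is_diff_sum_fun (K : numFieldType) (V W : normedModType K) m
    (f : 'I_m -> V -> W) x : (forall i, differentiable (f i) x) ->
  differentiable (fun y => \sum_i f i y) x /\
  forall v, 'D_v (fun y => \sum_i f i y) x = \sum_i 'D_v (f i) x.
Proof.
move=> df; have E : (fun y => \sum_i f i y) = \sum_i f i.
  by apply/funext => y; rewrite fct_sumE.
rewrite E; split=> [|v]; first exact: differentiable_sum.
by rewrite derive_sum // => i; exact: diff_derivable.
Qed.

Lemma is_diff_quot (K : numFieldType) (V : normedModType K) (f g : V -> K) x :
  differentiable f x -> differentiable g x -> g x != 0 ->
  differentiable (fun y => f y / g y) x /\
  forall v, 'D_v (fun y => f y / g y) x =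
    ('D_v f x - f x / g x * 'D_v g x) / g x.
Proof.
move=> df dg g0; have dgV := differentiableV dg g0.
have [d D] := is_diff_scale df dgV; split=> // v.
have DV : 'D_v (fun y => (g y)^-1) x = - (g x) ^- 2 *: 'D_v g x.
  by apply: deriveV => //; exact: diff_derivable.
apply: etrans (D v) _; rewrite DV /GRing.scale /=; field.
by [].
Qed.

Lemma is_diff_row (K : numFieldType) (V : normedModType K) m
    (f : 'I_m -> V -> K) x : (forall i, differentiable (f i) x) ->
  differentiable (fun y => \row_i f i y) x /\
  forall v, 'D_v (fun y => \row_i f i y) x = \row_i 'D_v (f i) x.
Proof.
move=> df.
have E : (fun y => \row_i f i y) =
    (fun y => \sum_i f i y *: (delta_mx 0 i : 'rV[K]_m)).
  apply/funext => y; rewrite [LHS]row_sum_delta.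
  by apply: eq_bigr => i _; rewrite mxE.
have d i := is_diff_scale (df i) (differentiable_cst (delta_mx 0 i : 'rV[K]_m) x).
have [ds Ds] := is_diff_sum_fun (fun i => (d i).1).
rewrite E; split=> // v; rewrite Ds [RHS]row_sum_delta.
apply: eq_bigr => i _; have [_ ->] := d i.
by rewrite derive_cst scaler0 add0r !mxE.
Qed.

Lemma is_diff_comp_ln (R : realType) (V : normedModType R) (f : V -> R) x :
  differentiable f x -> 0 < f x ->
  differentiable (fun y => ln (f y)) x /\
  forall v, 'D_v (fun y => ln (f y)) x = 'D_v f x / f x.
Proof.
move=> df f0; have [dl Dl] := is_derive1_ln f0.
have dln : differentiable (@ln R) (f x) by apply/derivable1_diffP.
have dc : differentiable ((@ln R) \o f) x by exact: differentiable_comp.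
split=> // v; apply: etrans (deriveE v dc) _.
rewrite (diff_comp df dln) /= -(deriveE v df).
rewrite -[X in 'd _ _ X]mulr1 -[X in 'd _ _ X]/('D_v f x *: (1 : R)) linearZ.
by rewrite -deriveE // Dl.
Qed.

(** * The Euclidean inner product in real coordinates *)

Section InnerProduct.
Variables (R : realType) (n : nat).
Local Notation RV := (('rV[R]_n * 'rV[R]_n)%type : normedModType R).
Local Notation cx := (@cxpart R n).
Local Notation cy := (@cypart R n).

Lemma cxP l a X Y : cx l (a *: X + Y) = a * cx l X + cx l Y.
Proof. exact: linearP. Qed.
Lemma cyP l a X Y : cy l (a *: X + Y) = a * cy l X + cy l Y.
Proof. exact: linearP. Qed.
Lemma cxB l X Y : cx l (X - Y) = cx l X - cx l Y.
Proof. exact: linearB. Qed.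
Lemma cyB l X Y : cy l (X - Y) = cy l X - cy l Y.
Proof. exact: linearB. Qed.

(** The norm carried by the product space is a maximum norm, which is not smooth; the Fubini-Study
    potential and the barrier of the maximum principle both require the Euclidean structure. *)
Definition ip (X Y : RV) : R := \sum_l (cx l X * cx l Y + cy l X * cy l Y).

Lemma ip_is_linear X : linear (ip X).
Proof.
move=> a Y Z; rewrite /ip scaler_sumr -big_split.
apply: (eq_bigr (fun l => a * (cx l X * cx l Y + cy l X * cy l Y) +
  (cx l X * cx l Z + cy l X * cy l Z))) => l _.
by rewrite cxP cyP; ring.
Qed.
HB.instance Definition _ X := GRing.isLinear.Build R RV R _ (ip X) (ip_is_linear X).

Lemma ipC X Y : ip X Y = ip Y X.
Proof. by apply: eq_bigr => l _; rewrite ![cx l X * _]mulrC ![cy l X * _]mulrC. Qed.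

Lemma ip_continuous Y : continuous (ip Y : RV -> R).
Proof.
move=> X; apply: cvg_big => [|l _]; first exact: add_continuous.
by apply: cvgD; apply: cvgM; (exact: cvg_cst || exact: cxpart_continuous
  || exact: cypart_continuous).
Qed.

Lemma is_diff_ip X Y : differentiable (ip Y : RV -> R) X /\
  forall v, 'D_v (ip Y : RV -> R) X = ip Y v.
Proof.
have d : differentiable (ip Y : RV -> R) X.
  by apply: linear_differentiable; exact: ip_continuous.
split=> // v; rewrite deriveE // diff_lin //; exact: ip_continuous.
Qed.

Lemma ip_dirx k X : ip (dirx R k) X = cx k X.
Proof.
rewrite /ip (bigD1 k) //= big1 => [|l lk].
  by rewrite /mx_coord !mxE !eqxx /= mul1r mul0r !addr0.
by rewrite /mx_coord !mxE /= (negbTE lk) !mul0r addr0.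
Qed.

Lemma ip_diry k X : ip (diry R k) X = cy k X.
Proof.
rewrite /ip (bigD1 k) //= big1 => [|l lk].
  by rewrite /mx_coord !mxE !eqxx /= mul1r mul0r add0r addr0.
by rewrite /mx_coord !mxE /= (negbTE lk) !mul0r addr0.
Qed.

Lemma ip_ge0 X : 0 <= ip X X.
Proof. by apply: sumr_ge0 => l _; rewrite -!expr2 addr_ge0 // sqr_ge0. Qed.

Lemma ip_eq0 X : ip X X = 0 -> X = 0.
Proof.
move=> /eqP; rewrite psumr_eq0 => [/allP H|l _]; last first.
  by rewrite -!expr2 addr_ge0 // sqr_ge0.
rewrite (RV_dir_sum X) big1 // => l _.
have := H l (mem_index_enum _); rewrite -!expr2 paddr_eq0 ?sqr_ge0 //.
by rewrite !sqrf_eq0 => /andP [/eqP -> /eqP ->]; rewrite !scale0r addr0.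
Qed.

Definition sqdist (X0 X : RV) : R := ip (X - X0) (X - X0).

Lemma is_diff_sqdist X0 X :
  differentiable (sqdist X0) X /\
  forall v, 'D_v (sqdist X0) X = 2 * ip v (X - X0).
Proof.
pose ax l (X : RV) : R := cx l X - cx l X0.
pose ay l (X : RV) : R := cy l X - cy l X0.
have E : sqdist X0 = fun X => \sum_l (ax l X *: ax l X + ay l X *: ay l X).
  by apply/funext => Y; rewrite /sqdist /ip; apply: eq_bigr => l _; rewrite !cxB !cyB.
have dcx l : differentiable (cx l) X.
  by apply: linear_differentiable; exact: cxpart_continuous.
have dcy l : differentiable (cy l) X.
  by apply: linear_differentiable; exact: cypart_continuous.
have dx l : differentiable (ax l) X.
  by apply: differentiableB => //; exact: differentiable_cst.
have dy l : differentiable (ay l) X.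
  by apply: differentiableB => //; exact: differentiable_cst.
have Dx l v : 'D_v (ax l) X = cx l v.
  apply: etrans (deriveB (diff_derivable (dcx l)) (derivable_cst _ _ _)) _.
  rewrite derive_cst subr0 deriveE // diff_lin //; exact: cxpart_continuous.
have Dy l v : 'D_v (ay l) X = cy l v.
  apply: etrans (deriveB (diff_derivable (dcy l)) (derivable_cst _ _ _)) _.
  rewrite derive_cst subr0 deriveE // diff_lin //; exact: cypart_continuous.
have sx l := is_diff_scale (dx l) (dx l).
have sy l := is_diff_scale (dy l) (dy l).
have ds l := differentiableD (sx l).1 (sy l).1.
have [d D] := is_diff_sum_fun ds.
rewrite E; split=> // v; apply: etrans (D v) _.
rewrite /ip mulr_sumr; apply: eq_bigr => l _.
apply: etrans (deriveD (diff_derivable (sx l).1) (diff_derivable (sy l).1)) _.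
rewrite (sx l).2 (sy l).2 Dx Dy cxB cyB /ax /ay /GRing.scale /=; ring.
Qed.

End InnerProduct.

(** * The Levi matrix of the Fubini-Study potential *)

Section FubiniStudy.
Variables (R : realType) (n : nat).
Local Notation RV := (('rV[R]_n * 'rV[R]_n)%type : normedModType R).
Local Notation C := (Cplx R).

(** The Fubini-Study potential log(1 + |w|^2) of an affine chart. It is the same for every [j], as
    slot [j] of the lift contributes only the 1. *)
Definition lnQ (X : RV) : R := ln (1 + sqdist 0 X).

Lemma derive2_lnQ v w X :
  'D_w ('D_v lnQ) X = 2 * ip v w / (1 + ip X X)
     - 4 * ip v X * ip w X / (1 + ip X X) ^+ 2.
Proof.
have sE (Y : RV) : sqdist 0 Y = ip Y Y by rewrite /sqdist !subr0.
have Q0 (Y : RV) : 0 < 1 + sqdist 0 Y :> R by rewrite sE ltr_pwDl // ip_ge0.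
have dQ Y : differentiable (fun Y : RV => 1 + sqdist 0 Y) Y.
  apply: differentiableD; first exact: differentiable_cst.
  by have [] := is_diff_sqdist 0 Y.
have DQ Y u : 'D_u (fun Y : RV => 1 + sqdist 0 Y) Y = 2 * ip u Y.
  have [d D] := is_diff_sqdist 0 Y.
  apply: etrans (deriveD (derivable_cst _ _ _) (diff_derivable d)) _.
  by rewrite derive_cst D subr0 add0r.
have D1 : 'D_v lnQ = fun Y => (2 *: ip v Y) / (1 + sqdist 0 Y).
  by apply/funext => Y; have [_ ->] := is_diff_comp_ln (dQ Y) (Q0 Y); rewrite DQ.
have [di Di] := is_diff_ip X v.
have d2 : differentiable (fun Y : RV => 2 *: ip v Y : R) X.
  exact: differentiableZ.
have D2 : 'D_w (fun Y : RV => 2 *: ip v Y : R) X = 2 * ip v w.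
  by apply: etrans (deriveZ 2 (diff_derivable di)) _; rewrite Di.
have [_ D] := is_diff_quot d2 (dQ X) (lt0r_neq0 (Q0 X)).
rewrite D1; apply: etrans (D w) _; rewrite D2 DQ -sE.
move: (1 + sqdist 0 X) (lt0r_neq0 (Q0 X)) => q q0.
by rewrite -[_ *: _]/(2 * ip v X); field.
Qed.

Lemma levi_ln_sqnorm (j : 'I_n.+1) (z : 'rV[C]_n) a b :
  let Q := 1 + \sum_i z 0 i * Num.conj (z 0 i) in
  levi (fun w => ln (sqnorm (affine_lift j w))) z a b =
  (a == b)%:R / Q - Num.conj (z 0 a) * z 0 b / Q ^+ 2.
Proof.
move=> Q.
have fE : (fun w : 'rV[C]_n => ln (sqnorm (affine_lift j w))) \o @cplxify R 1 n = lnQ.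
  apply/funext => X /=; rewrite /lnQ /sqnorm (bigD1_ord j) //= !mxE unlift_none /=.
  congr (ln (_ + _)); first by rewrite expr1n expr0n addr0.
  rewrite /sqdist subr0 /ip; apply: eq_bigr => l _.
  by rewrite !mxE liftK !mxE /= /mx_coord -!expr2.
rewrite [LHS]mxE fE.
rewrite -/(dirx R a) -/(dirx R b) -/(diry R a) -/(diry R b).
set X := realify z.
have E v w := derive2_lnQ v w X.
apply: etrans (f_equal2 (@mkC R)
  (f_equal2 (fun s t => (s + t) / 4) (E (dirx R b) (dirx R a)) (E (diry R b) (diry R a)))
  (f_equal2 (fun s t => (s - t) / 4) (E (diry R b) (dirx R a)) (E (dirx R b) (diry R a)))) _.
have QE : Q = cR (1 + ip X X).
  rewrite /Q cRD cR1; congr (_ + _); apply: cplx_eqP; rewrite ?reC_sum ?imC_sum.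
    apply: eq_bigr => i _; rewrite reCM reC_conj imC_conj /= /mx_coord !mxE.
    by rewrite mulrN opprK.
  by rewrite big1 //= => i _; rewrite imCM reC_conj imC_conj; ring.
have Q0 : 1 + ip X X != 0 :> R by rewrite lt0r_neq0 // ltr_pwDl // ip_ge0.
have QV : Q^-1 = cR (1 + ip X X)^-1.
  apply: (mulfI (x := Q)); first by rewrite QE -cR0; apply: contra_neq Q0 => -[].
  by rewrite mulfV ?QE -?cRM ?mulfV // -cR0; apply: contra_neq Q0 => -[].
rewrite [Q ^+ 2]expr2 [(Q * Q)^-1]invfM QV !ip_dirx !ip_diry.
have cxd (k l : 'I_n) : cxpart R k (dirx R l) = (k == l)%:R.
  by rewrite /= /mx_coord !mxE eqxx.
have cyd (k l : 'I_n) : cypart R k (diry R l) = (k == l)%:R.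
  by rewrite /= /mx_coord !mxE eqxx.
have cxy (k l : 'I_n) : cxpart R k (diry R l) = 0 by rewrite /= /mx_coord !mxE.
have cyx (k l : 'I_n) : cypart R k (dirx R l) = 0 by rewrite /= /mx_coord !mxE.
rewrite cxd cyd cxy cyx (eq_sym b a).
have zE i : z 0 i = mkC (cxpart R i X) (cypart R i X).
  by rewrite /= /mx_coord !mxE mkC_re_im.
rewrite !zE; move: (cxpart R a X) (cypart R a X) (cxpart R b X) (cypart R b X).
move: (1 + ip X X) Q0 => q q0 xa ya xb yb.
have -> : ((a == b)%:R : C) = cR (a == b)%:R by case: (a == b).
move: ((a == b)%:R : R) => d.
rewrite /cR; apply: cplx_eqP.
  rewrite !(reCD, reCN, imCD, imCN, reCM, imCM, reC_conj, imC_conj, reC_mkC, imC_mkC).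
  by field.
rewrite !(reCD, reCN, imCD, imCN, reCM, imCM, reC_conj, imC_conj, reC_mkC, imC_mkC).
by field.
Qed.

End FubiniStudy.

(** * Hermitian algebra of the Fubini-Study form *)

Section HermitianAlgebra.
Variables (R : realType).
Local Notation C := (Cplx R).

Definition hip m (U V : 'I_m -> C) : C := \sum_l U l * Num.conj (V l).

Lemma hip_gt0 m (U : 'I_m -> C) l : U l != 0 -> 0 < hip U U.
Proof.
move=> Ul; rewrite /hip (bigD1 l) //= ltr_pwDl ?mul_conjC_gt0 //.
by apply: sumr_ge0 => i _; exact: mul_conjC_ge0.
Qed.

Lemma conj_hip m (U V : 'I_m -> C) : Num.conj (hip U V) = hip V U.
Proof.
rewrite /hip rmorph_sum; apply: eq_bigr => l _.
by rewrite rmorphM /= conjCK mulrC.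
Qed.

(* The Hermitian form of ddbar log |Z|^2 on tangent vectors U, V, for any
   nonvanishing local lift Z; it does not change when a multiple of Z is added to
   U or V. *)
Definition fsform m (Z U V : 'I_m -> C) : C :=
  (hip U V * hip Z Z - hip U Z * hip Z V) / hip Z Z ^+ 2.

(** The equality case of Cauchy-Schwarz: [D] is |Z|^2 times the component of [U] orthogonal to [Z],
    and its squared length is |Z|^2 times the Gram determinant of [U] and [Z]. *)
Lemma fsform_eq0 m (Z U : 'I_m -> C) : hip Z Z != 0 -> fsform Z U U = 0 ->
  exists t, forall l, U l = t * Z l.
Proof.
move=> Z0 /eqP; rewrite mulf_eq0 invr_eq0 expf_eq0 /= (negbTE Z0) orbF => /eqP E.
pose D l := hip Z Z * U l - hip U Z * Z l.
have DE : hip D D = hip Z Z * (hip U U * hip Z Z - hip U Z * hip Z U).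
  have -> : hip D D = \sum_l (hip Z Z ^+ 2 * (U l * Num.conj (U l))
     - hip Z Z * hip Z U * (U l * Num.conj (Z l))
     - hip U Z * hip Z Z * (Z l * Num.conj (U l))
     + hip U Z * hip Z U * (Z l * Num.conj (Z l))).
    apply: eq_bigr => l _; rewrite /D rmorphB !rmorphM /= !conj_hip; ring.
  rewrite big_split !sumrB /= -!mulr_sumr -!/(hip _ _); ring.
have D0 l : D l = 0.
  apply/eqP; apply: contra_eqT DE => /hip_gt0 Dp.
  by rewrite E mulr0 gt_eqF.
exists (hip U Z / hip Z Z) => l.
have /eqP := D0 l; rewrite subr_eq0 => /eqP DD.
by rewrite mulrAC -DD mulrC mulKf.
Qed.

(** By the quotient rule, [u] and [v] are the derivatives of the affine coordinates [z = Z / Z j]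
    when [Z] moves along [U] and [V]. Homogeneity then replaces the affine lift by the given lift
    [Z], whatever its normalization. *)
Lemma fsform_affine N (j : 'I_N.+1) (Z U V : 'I_N.+1 -> C)
    (z u v : 'I_N -> C) (Q : C) : Z j != 0 ->
  (forall a, z a = Z (lift j a) / Z j) ->
  (forall a, u a = (U (lift j a) - z a * U j) / Z j) ->
  (forall a, v a = (V (lift j a) - z a * V j) / Z j) ->
  Q = 1 + \sum_i z i * Num.conj (z i) ->
  \sum_b (\sum_a u a * ((a == b)%:R / Q - Num.conj (z a) * z b / Q ^+ 2))
    * Num.conj (v b) = fsform Z U V.
Proof.
move=> Zj zE uE vE QE.
have Zj' : Num.conj (Z j) != 0 by rewrite conjC_eq0.
have Q0 : Q != 0.
  rewrite QE gt_eqF // ltr_pwDl // sumr_ge0 // => i _; exact: mul_conjC_ge0.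
pose S1 := \sum_a u a * Num.conj (v a).
pose S2 := \sum_a u a * Num.conj (z a).
pose S3 := \sum_a z a * Num.conj (v a).
have -> : \sum_b (\sum_a u a * ((a == b)%:R / Q - Num.conj (z a) * z b / Q ^+ 2))
    * Num.conj (v b) = S1 / Q - S2 * S3 / Q ^+ 2.
  rewrite /S3 mulr_sumr !mulr_suml -sumrB; apply: eq_bigr => b _.
  rewrite (eq_bigr (fun a => (a == b)%:R * u a / Q -
     u a * Num.conj (z a) * (z b / Q ^+ 2))); last by move=> a _; ring.
  rewrite sumrB -!mulr_suml -/S2 (bigD1 b) //= eqxx mul1r big1 => [|a ab].
    by ring.
  by rewrite (negbTE ab) mul0r.
have lE (W : 'I_N.+1 -> C) w : (forall a, w a = (W (lift j a) - z a * W j) / Z j) ->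
    forall a, W (lift j a) = Z j * w a + z a * W j.
  by move=> wE a; rewrite wE mulrCA mulfV // mulr1 subrK.
have UE := lE _ _ uE; have VE := lE _ _ vE.
have ZE a : Z (lift j a) = Z j * z a by rewrite zE mulrCA mulfV ?mulr1.
have split_hip (A B : 'I_N.+1 -> C) : hip A B = A j * Num.conj (B j) +
    \sum_a A (lift j a) * Num.conj (B (lift j a)).
  by rewrite /hip (bigD1_ord j).
pose S4 := \sum_i z i * Num.conj (z i).
have hUV : hip U V = U j * Num.conj (V j) * Q + Z j * Num.conj (Z j) * S1
    + Z j * Num.conj (V j) * S2 + U j * Num.conj (Z j) * S3.
  rewrite split_hip QE mulrDr mulr1 -!addrA; congr (_ + _).
  rewrite !mulr_sumr -!big_split /=; apply: eq_bigr => a _.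
  by rewrite UE VE rmorphD !rmorphM /=; ring.
have hUZ : hip U Z = Num.conj (Z j) * (U j * Q + Z j * S2).
  have -> : hip U Z = U j * Num.conj (Z j) +
     Num.conj (Z j) * (U j * S4 + Z j * S2).
    rewrite split_hip; congr (_ + _).
    rewrite /S4 /S2 !mulr_sumr -big_split mulr_sumr; apply: eq_bigr => a _ /=.
    by rewrite UE ZE !rmorphM /=; ring.
  by rewrite QE -/S4; ring.
have hZV : hip Z V = Z j * (Num.conj (V j) * Q + Num.conj (Z j) * S3).
  have -> : hip Z V = Z j * Num.conj (V j) +
     Z j * (Num.conj (V j) * S4 + Num.conj (Z j) * S3).
    rewrite split_hip; congr (_ + _).
    rewrite /S4 /S3 !mulr_sumr -big_split mulr_sumr; apply: eq_bigr => a _ /=.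
    by rewrite VE ZE rmorphD !rmorphM /=; ring.
  by rewrite QE -/S4; ring.
have hZZ : hip Z Z = Z j * Num.conj (Z j) * Q.
  rewrite split_hip QE mulrDr mulr1; congr (_ + _).
  by rewrite !mulr_sumr; apply: eq_bigr => a _; rewrite ZE rmorphM /=; ring.
rewrite /fsform hUV hUZ hZV hZZ; field.
by rewrite Zj Zj' Q0.
Qed.

End HermitianAlgebra.

(** * Homogeneous coordinates of points *)

Section ProjectivePoints.
Variables (R : realType) (N : nat).
Local Notation C := (Cplx R).
Implicit Type Z : 'rV[C]_N.+1.

Lemma nzval_insubd Z : Z != 0 -> nzval (insubd (ones N) Z) = Z.
Proof.
move=> Z0; rewrite /nzval /insubd insubT //; exact/mem_set.
Qed.

Lemma hcoord_hclass Z : Z != 0 -> exists2 c, c != 0 & hcoord (hclass Z) = c *: Z.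
Proof.
move=> Z0; rewrite /hcoord /hclass.
set x := (\pi_(@CPpoints R N) (insubd (ones N) Z))%qT.
have : prop_to (insubd (ones N) Z) (repr x).
  by apply/(@eqmodP _ (@prop_to_equiv_rel R N)); exact: (esym (reprK x)).
by move=> /asboolP [c c0]; rewrite nzval_insubd // => E; exists c.
Qed.

Lemma hclassZ c Z : c != 0 -> hclass (c *: Z) = hclass Z.
Proof.
move=> c0; have [->|Z0] := eqVneq Z 0; first by rewrite scaler0.
apply/(@eqmodP _ (@prop_to_equiv_rel R N)) => /=; apply/asboolP.
exists c^-1; first by rewrite invr_eq0.
by rewrite !nzval_insubd ?scaler_eq0 ?negb_or ?c0 // scalerA mulVf // scale1r.
Qed.

Lemma hcoord_neq0 (x : @CPpoints R N) : hcoord x != 0.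
Proof. by rewrite /hcoord /nzval; have := set_valP (repr x). Qed.

Lemma pivotP (x : @CPpoints R N) : hcoord x 0 (pivot x) != 0.
Proof.
rewrite /pivot; case: pickP => [j //|H].
have /negP [] := hcoord_neq0 x; apply/eqP/matrixP => i j.
by rewrite ord1 mxE; apply/eqP; have /negbFE := H j.
Qed.

Lemma hcoord_ratio Z i j : Z != 0 ->
  hcoord (hclass Z) 0 i / hcoord (hclass Z) 0 j = Z 0 i / Z 0 j.
Proof.
move=> /hcoord_hclass [c c0 ->]; rewrite !mxE.
(* Both quotients are 0 here, by the convention on the inverse of 0. *)
have [->|Zj] := eqVneq (Z 0 j) 0; first by rewrite mulr0 !invr0 !mulr0.
by rewrite -mulf_div mulfV // mul1r.
Qed.

Lemma pivot_hclass Z : Z != 0 -> Z 0 (pivot (hclass Z)) != 0.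
Proof.
move=> Z0; have := pivotP (hclass Z).
by have [c c0 ->] := hcoord_hclass Z0; rewrite mxE mulf_eq0 negb_or => /andP [].
Qed.

End ProjectivePoints.

(** * Local lifts of Kodaira maps *)

Section LocalLift.
Context {R : realType} {n : nat} {M : charted R n}.
Local Notation C := (Cplx R).
Variable P : line_bundle M.
Hypotheses (aM : atlas M) (hP : holomorphic_line_bundle P).

Lemma btrans_neq0 (i j : bindex P) x :
  bdom i x -> bdom j x -> btrans i j x != 0.
Proof.
case: hP => _ _ tr1 trM ix jx; apply/eqP => E.
have := trM i j i x ix jx ix; rewrite E mul0r tr1 // => /eqP.
by rewrite eq_sym oner_eq0.
Qed.

Lemma bdom_btriv x : bdom (btriv P x) x.
Proof. by case: hP => [[_ +]]. Qed.

(** The component in a fixed trivialization. The raw value [s x] refers to [btriv P x], which jumps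
    with [x], so only the component of a holomorphic section is holomorphic. *)
Definition lrep (i : bindex P) (s : M -> C) (x : M) : C :=
  btrans i (btriv P x) x * s x.

Lemma lrep_eq0 i s x : bdom i x -> (lrep i s x == 0) = (s x == 0).
Proof.
by move=> ix; rewrite mulf_eq0 (negbTE (btrans_neq0 ix (bdom_btriv x))).
Qed.

Lemma lrep_ratio i s t x : bdom i x -> lrep i s x / lrep i t x = s x / t x.
Proof.
move=> ix; have b0 := btrans_neq0 ix (bdom_btriv x).
by rewrite /lrep -mulf_div mulfV // mul1r.
Qed.

Lemma bdom_near (i : bindex P) x : bdom i x -> nbhs x (bdom i).
Proof. by move=> ix; case: hP => [[bo _] _ _ _]; apply: open_nbhs_nbhs. Qed.

Section Kodaira.
Variables (N : nat) (T : 'I_N.+1 -> M -> C).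

Lemma row_neq0 x j : T j x != 0 -> \row_l T l x != 0.
Proof. by apply: contra_neqN => /eqP /rowP /(_ j); rewrite !mxE. Qed.

Section AtPoint.
Variables (c : chart M 'rV[C]_n) (q : M) (i : bindex P) (j : 'I_N.+1).
Hypotheses (ct : topological_chart c) (cq : cdom c q) (iq : bdom i q).
Let Z l := lrep i (T l) \o cinv c.
Hypotheses (dZ : forall l, differentiable (Z l) (cmap c q)) (Tj : T j q != 0).

Let y0 := cmap c q.

Lemma lift_neq0 : Z j y0 != 0.
Proof. by rewrite /Z /y0 /= (cmapK ct) // lrep_eq0. Qed.

(** In a ratio of two sections the transition factor cancels, so the Kodaira map defined by raw
    values can be differentiated through the components. *)
Lemma lift_ratio_near : {near y0, (fun y => \row_a (Z (lift j a) y / Z j y)) =1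
   cmap (affine_chart j) \o kodaira_map T \o cinv c}.
Proof.
have Zc : {for y0, continuous (Z j)} by apply: differentiable_continuous; exact: dZ.
have Z0 : \forall y \near y0, Z j y != 0.
  exact: (@cvgr_neq0 _ _ _ (nbhs y0) _ (Z j) (Z j y0) Zc lift_neq0).
have bi : \forall y \near y0, bdom i (cinv c y).
  by apply: near_chart => //; exact: bdom_near.
near=> y; apply/rowP => a; rewrite !mxE.
have iy : bdom i (cinv c y) by near: y.
have Tjy : T j (cinv c y) != 0.
  by rewrite -(lrep_eq0 _ iy); near: y.
by rewrite hcoord_ratio ?(row_neq0 Tjy) // !mxE /Z /= lrep_ratio.
Unshelve. all: by end_near. Qed.

Let zz a := Z (lift j a) y0 / Z j y0.

Lemma is_diff_lift_ratio :
  differentiable (cmap (affine_chart j) \o kodaira_map T \o cinv c) y0 /\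
  forall v, 'D_v (cmap (affine_chart j) \o kodaira_map T \o cinv c) y0 =
   \row_a (('D_v (Z (lift j a)) y0 - zz a * 'D_v (Z j) y0) / Z j y0).
Proof.
have dq a := is_diff_quot (dZ (lift j a)) (dZ j) lift_neq0.
have [dr Dr] := is_diff_row (fun a => (dq a).1).
split; first exact: differentiable_near_eq lift_ratio_near dr.
move=> v; apply: etrans (esym (near_eq_derive v lift_ratio_near)) _.
apply: etrans (Dr v) _; apply/rowP => a; rewrite !mxE; exact: (dq a).2.
Qed.

End AtPoint.

Section FSPullback.
Variables (c : chart M 'rV[C]_n) (q : M) (i : bindex P).
Hypotheses (ct : topological_chart c) (cq : cdom c q) (iq : bdom i q).
Let Z l := lrep i (T l) \o cinv c.
Hypothesis (dZ : forall l, differentiable (Z l) (cmap c q)).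
Hypothesis (nz : exists l, T l q != 0).
Let y0 := cmap c q.
Let F := kodaira_map T.
Let FJ := 'J (cmap (chart_at (F q)) \o F \o cinv c) y0.

Lemma kodaira_pivot_neq0 : T (pivot (F q)) q != 0.
Proof.
case: nz => l /row_neq0 Tq; have := pivot_hclass Tq.
by rewrite mxE.
Qed.

Lemma differentiable_kodaira_chart :
  differentiable (cmap (chart_at (F q)) \o F \o cinv c) y0.
Proof. by have [] := is_diff_lift_ratio ct cq iq dZ kodaira_pivot_neq0. Qed.

(** The vectors are arbitrary because two uses follow: basis vectors give the coefficients of the
    pulled-back form, and [v = w] tests degeneracy. *)
Lemma fs_pullback_entry (v w : 'rV[C]_n) :
  ((v *m FJ) *m fubini_study R N (F q) *m adjmx (w *m FJ)) 0 0 =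
  mkC (2 * pi)^-1 0 * fsform (fun l => Z l y0) (fun l => 'D_v (Z l) y0)
    (fun l => 'D_w (Z l) y0).
Proof.
pose j := pivot (F q); have Tj := kodaira_pivot_neq0.
have Zj := lift_neq0 ct cq iq Tj; rewrite -/(Z j) -/y0 in Zj.
have [dr Dr] := is_diff_lift_ratio ct cq iq dZ Tj.
pose z a := Z (lift j a) y0 / Z j y0.
have FJv u : u *m FJ = \row_a (('D_u (Z (lift j a)) y0 - z a * 'D_u (Z j) y0) / Z j y0).
  exact: etrans (esym (deriveEjacobian u dr)) (Dr u).
have cE : cmap (affine_chart j) (F q) = \row_a z a.
  have := nbhs_singleton (lift_ratio_near ct cq iq dZ Tj).
  by rewrite /= [in kodaira_map _ _](cmapK ct cq) => <-.
rewrite !FJv.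
rewrite -(fsform_affine (j := j) (z := z) Zj (fun a => erefl) (fun a => erefl)
  (fun a => erefl) erefl).
rewrite mxE mulr_sumr; apply: eq_bigr => b _.
rewrite [adjmx _ _ _]mxE [map_mx _ _ _ _]mxE [in Num.conj _]mxE mulrA.
congr (_ * _); rewrite mxE mulr_sumr; apply: eq_bigr => a _.
rewrite [_ 0 a]mxE mulrCA; congr (_ * _).
rewrite /fubini_study mxE; congr (_ * _); rewrite -/j cE levi_ln_sqnorm !mxE.
congr (_ / _ - _ * _ / _ ^+ 2); congr (_ + _);
  by apply: eq_bigr => l _; rewrite !mxE.
Qed.

End FSPullback.
End Kodaira.
End LocalLift.

Section Atlas.
Context {R : realType} {n : nat} {M : charted R n}.
Hypothesis hM : complex_manifold M.

Lemma complex_manifold_atlas : atlas M.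
Proof. by case: hM. Qed.

Lemma transition_smooth (p q x : M) : cdom (chart_at p) x -> cdom (chart_at q) x ->
  smooth_near (cmap (chart_at p) x) (cmap (chart_at q) \o cinv (chart_at p)).
Proof.
case: hM => _ aM tr px qx; apply: smooth_near_on (tr p q) _; last by exists x.
have [tp _] := aM p; have [tq _] := aM q.
rewrite openE => _ [y [py qy] <-].
apply: filterS2 (cimage_near tp py) (near_chart tp py (cdom_near tq qy)).
by move=> _ [z pz <-]; rewrite (cmapK tp) // => qz; exists z.
Qed.

End Atlas.

(** * From sections of a line bundle to sections of its powers *)

Section Powers.
Context {R : realType} {n : nat} {M : charted R n}.
Local Notation C := (Cplx R).
Variable L : line_bundle M.
Hypothesis aM : atlas M.

Lemma holomorphic_power k :
  holomorphic_line_bundle L -> holomorphic_line_bundle (power L k).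
Proof.
move=> [h1 h2 h3 h4]; split=> //.
- move=> i j p ij; exact: (smooth_near_exp k (h2 i j p ij)).
- by move=> i x ix; rewrite /= h3 // expr1n.
- by move=> i j l x ix jx lx; rewrite /= -exprMn h4.
Qed.

Lemma lrep_power k i s t x :
  lrep (P := power L k.+1) i (fun y => s y * t y ^+ k) x =
  lrep (P := L) i s x * lrep (P := L) i t x ^+ k.
Proof. by rewrite /lrep /= exprMn exprS; ring. Qed.

(** These products are how very ampleness of [L] is brought to bear on an arbitrary basis of
    sections of the power. *)
Lemma H0_power k s t : H0 L s -> H0 L t ->
  H0 (power L k.+1) (fun y => s y * t y ^+ k).
Proof.
move=> hs ht i p ip.
have sm := smooth_near_mul (hs i p ip) (smooth_near_exp k (ht i p ip)).
refine (eq_ind _ (smooth_near _) sm _ _); apply/funext => y /=.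
by rewrite exprMn exprS; ring.
Qed.

End Powers.

(** * Bergman forms: nondegeneracy and local bounds *)

Section Basis.
Context {R : realType} {n : nat} {M : charted R n}.
Local Notation C := (Cplx R).
Variables (L : line_bundle M) (k : nat).
Hypotheses (aM : atlas M) (hL : very_ample L).
Variables (N : nat) (T : 'I_N.+1 -> M -> C).
Hypothesis hT : is_basis (power L k.+1) T.

Let hP : holomorphic_line_bundle (power L k.+1).
Proof. by apply: holomorphic_power; case: hL. Qed.

(** Some section [S b] of [L] is nonzero at [q], and its power is a combination of the [T l], which
    therefore cannot all vanish there. *)
Lemma basis_neq0 q : exists l, T l q != 0.
Proof.
case: hL => hLb [N0 [S [[SH _] Snz _]]]; have [b Sb] := Snz q.
case: hT => _ /(_ _ (H0_power (SH b) (SH b))) [a [/(congr1 (@^~ q)) /= E _]].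
apply/not_existsP => H; have : S b q * S b q ^+ k != 0.
  by rewrite mulf_neq0 ?expf_neq0.
rewrite E big1 ?eqxx // => l _; have /negP := H l.
by rewrite negbK => /eqP ->; rewrite mulr0.
Qed.

Lemma lrep_smooth (i : bindex L) l p : bdom i p ->
  smooth_near (cmap (chart_at p) p)
    (lrep (P := power L k.+1) i (T l) \o cinv (chart_at p)).
Proof. by case: hT => /(_ l) H _; exact: H. Qed.

Lemma kodaira_differentiable p :
  differentiable (in_charts (kodaira_map T) p) (cmap (chart_at p) p).
Proof.
have [tp dp] := aM p; have bp := bdom_btriv hP p.
apply: (differentiable_kodaira_chart hP tp dp bp _ (basis_neq0 p)) => l.
by apply: smooth_near_differentiable; exact: lrep_smooth.
Qed.

(** The relation D_v Z = t Z passes to all combinations of the [Z l], in particular to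
    [Y a = U a * U b ^+ k]. The quotient [Y a / Y b = U a / U b] then has zero derivative along [v],
    so [v] lies in the kernel of the differential of the Kodaira map of [L], which is an
    immersion. *)
Lemma kodaira_immersive p v
    (Z := fun l => lrep (P := power L k.+1) (btriv L p) (T l) \o cinv (chart_at p)) t :
  (forall l, 'D_v (Z l) (cmap (chart_at p) p) = t * Z l (cmap (chart_at p) p)) ->
  v = 0.
Proof.
move=> DZ; have [tp dp] := aM p; have bp := bdom_btriv hP p.
case: (hL) => hLb [N0 [S [[SH Sb] Snz [hF _ /(_ p) immF _]]]].
pose b := pivot (kodaira_map S p).
pose y0 := cmap (chart_at p) p.
pose U a := lrep (P := L) (btriv L p) (S a) \o cinv (chart_at p).
have dU a : differentiable (U a) y0.
  by apply: smooth_near_differentiable; exact: (SH a).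
have Sbp : S b p != 0 by exact: (kodaira_pivot_neq0 (Snz p)).
have Ub := lift_neq0 hLb tp dp bp Sbp.
have dZ l : differentiable (Z l) y0.
  by apply: smooth_near_differentiable; exact: lrep_smooth.
pose Y a y := U a y * U b y ^+ k.
have YE a : exists c : 'rV[C]_N.+1, Y a = fun y => \sum_l c 0 l *: Z l y.
  case: hT => _ /(_ _ (H0_power (SH a) (SH b))) [c [E _]].
  exists c; apply/funext => y; rewrite /Y /U /= -lrep_power E /lrep mulr_sumr.
  by apply: eq_bigr => l _; rewrite mulrCA.
have DY a : differentiable (Y a) y0 /\ 'D_v (Y a) y0 = t * Y a y0.
  have [c ->] := YE a.
  have ds l := is_diff_scale (differentiable_cst (c 0 l) y0) (dZ l).
  have [d D] := is_diff_sum_fun (fun l => (ds l).1).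
  split=> //; apply: etrans (D v) _; rewrite mulr_sumr; apply: eq_bigr => l _.
  apply: etrans ((ds l).2 v) _; rewrite derive_cst scale0r addr0 DZ.
  by rewrite -/y0 scalerAr.
have Yb : Y b y0 != 0 by rewrite mulf_neq0 ?expf_neq0.
have [dr Dr] := is_diff_lift_ratio hLb tp dp bp dU Sbp.
suff D0 : 'D_v (in_charts (kodaira_map S) p) y0 = 0.
  have E : v *m jac (kodaira_map S) p = 0.
    by apply: etrans (esym (deriveEjacobian v dr)) D0.
  by apply: (row_free_inj immF); rewrite mul0mx.
apply: etrans (Dr v) _; apply/rowP => a; rewrite mxE [RHS]mxE.
have qE : {near y0, (fun y => Y (lift b a) y / Y b y) =1 (fun y => U (lift b a) y / U b y)}.
  have Uc : {for y0, continuous (U b)} by apply: differentiable_continuous; exact: dU.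
  have nU : \forall y \near y0, U b y != 0 := @cvgr_neq0 _ _ _ (nbhs y0) _ (U b) (U b y0) Uc Ub.
  near=> y; have Uby : U b y != 0 by near: y; exact: nU.
  by rewrite /Y -mulf_div mulfV ?mulr1 //; exact: expf_neq0.
have [_ /(_ v)] := is_diff_quot (dU (lift b a)) (dU b) Ub.
have [_ /(_ v)] := is_diff_quot (DY (lift b a)).1 (DY b).1 Yb.
rewrite (DY (lift b a)).2 (DY b).2 (near_eq_derive v qE) => -> E.
apply: etrans (esym E) _.
by move: (Y (lift b a) y0) (Y b y0) Yb => ya yb yb0; field.
Unshelve. all: by end_near. Qed.

(** The form at [q] is stored in [chart_at q]. Expressing it in a chart [c] and a trivialization [i]
    independent of [q] makes its dependence on [q] accessible to continuity. *)
Lemma bergman_form_entry (c : chart M 'rV[C]_n) (i : bindex L) q a b :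
  topological_chart c -> cdom c q -> bdom i q ->
  differentiable (cmap (chart_at q) \o cinv c) (cmap c q) ->
  (forall l, differentiable (lrep (P := power L k.+1) i (T l) \o cinv c) (cmap c q)) ->
  coef (bergman_form k.+1 T) c q a b = k.+1%:R^-1 * (mkC (2 * pi)^-1 0 *
    fsform (fun l => lrep (P := power L k.+1) i (T l) (cinv c (cmap c q)))
     (fun l => 'D_(delta_mx 0 a) (lrep (P := power L k.+1) i (T l) \o cinv c) (cmap c q))
     (fun l => 'D_(delta_mx 0 b) (lrep (P := power L k.+1) i (T l) \o cinv c) (cmap c q))).
Proof.
move=> ct cq iq dtr dZ; have nz := basis_neq0 q.
have dFc := differentiable_kodaira_chart hP ct cq iq dZ nz.
have [tq dq] := aM q.
have idc : {for q, continuous (@id M)} by exact: cvg_id.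
have thr := through_chart (cmap (chart_at (kodaira_map T q)) \o kodaira_map T)
  ct tq cq dq idc.
have E0 : (cmap (chart_at q) \o cinv c) (cmap c q) = cmap (chart_at q) q.
  by rewrite /= (cmapK ct).
have dF := kodaira_differentiable q; rewrite -E0 in dF.
have JE : 'J (cmap (chart_at (kodaira_map T q)) \o kodaira_map T \o cinv c) (cmap c q)
   = 'J (cmap (chart_at q) \o cinv c) (cmap c q) *m jac (kodaira_map T) q.
  apply: etrans (esym (jacobian_near_eq (differentiable_comp dtr dF) thr)) _.
  by apply: etrans (jacobian_comp dtr dF) _; rewrite E0.
have := fs_pullback_entry hP ct cq iq dZ nz (delta_mx 0 a) (delta_mx 0 b).
move=> /= <-.
rewrite JE /coef /bergman_form /pullback; set J := 'J _ _; set K := jac _ _.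
set W := fubini_study _ _ _.
rewrite -scalemxAr -scalemxAl mxE; congr (_ * _).
have -> : J *m (K *m W *m adjmx K) *m adjmx J = (J *m K) *m W *m adjmx (J *m K).
  by rewrite adjmxM !mulmxA.
rewrite -!rowE; set X := J *m K.
rewrite mxE [RHS]mxE; apply: eq_bigr => l _.
rewrite -row_mul [row a _ _ _]mxE; congr (_ * _).
by rewrite ![adjmx _ _ _]mxE ![map_mx _ _ _ _]mxE [row b _ _ _]mxE.
Qed.

Lemma fs_constant_neq0 : mkC (2 * pi)^-1 0 != 0 :> C.
Proof.
rewrite -/(cR _) -(cR0 R); apply: contra_neq (lt0r_neq0 (pi_gt0 R)) => -[/eqP].
by rewrite invr_eq0 mulf_eq0 pnatr_eq0 /= => /eqP.
Qed.

(** A vector in the kernel has zero Fubini-Study length, so by the equality case of Cauchy-Schwarz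
    the derivative of the lift is proportional to the lift, and [kodaira_immersive] applies.
    Invertibility is what gives [invmx] its meaning in [laplacian]. *)
Lemma bergman_form_unit p : bergman_form k.+1 T p \in unitmx.
Proof.
rewrite -row_free_unit; apply: inj_row_free => v vw.
have [tp dp] := aM p; have bp := bdom_btriv hP p.
have dZ l : differentiable (lrep (P := power L k.+1) (btriv L p) (T l)
    \o cinv (chart_at p)) (cmap (chart_at p) p).
  by apply: smooth_near_differentiable; exact: lrep_smooth.
have nz := basis_neq0 p.
have E := fs_pullback_entry hP tp dp bp dZ nz v v.
have E0 : (v *m jac (kodaira_map T) p) *m fubini_study R N (kodaira_map T p) *m
   adjmx (v *m jac (kodaira_map T) p) = 0.
  have wE : jac (kodaira_map T) p *m fubini_study R N (kodaira_map T p) *m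
      adjmx (jac (kodaira_map T) p) = k.+1%:R *: bergman_form k.+1 T p.
    by rewrite scalerA mulfV ?pnatr_eq0 // scale1r.
  have -> : (v *m jac (kodaira_map T) p) *m fubini_study R N (kodaira_map T p) *m
     adjmx (v *m jac (kodaira_map T) p) = v *m (jac (kodaira_map T) p *m
     fubini_study R N (kodaira_map T p) *m adjmx (jac (kodaira_map T) p)) *m adjmx v.
    by rewrite adjmxM !mulmxA.
  rewrite wE.
  by rewrite -scalemxAr vw scaler0 mul0mx.
have /eqP := etrans (esym E) (congr1 (fun A : 'M[C]_1 => A 0 0) E0).
rewrite mxE mulf_eq0 (negbTE fs_constant_neq0) /= => /eqP fs0.
have [t Ht] := fsform_eq0 (lt0r_neq0 (hip_gt0 (lift_neq0 hP tp dp bp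
  (kodaira_pivot_neq0 nz)))) fs0.
exact: kodaira_immersive Ht.
Qed.

Lemma conj_continuous : continuous (Num.conj : C -> C).
Proof.
move=> x; have FA : Filter (nbhs (x : (C : normedModType C))) by exact: nbhs_filter.
apply/(@cvgrPdist_lt _ _ _ _ FA) => e e0.
have nx : \forall y \near x, `|x - y| < e := @cvgr_dist_lt _ _ _ (nbhs x) _ id x cvg_id e e0.
near=> y; rewrite -rmorphB norm_conjC; near: y; exact: nx.
Unshelve. all: by end_near. Qed.

Section Continuity.
Variables (X : topologicalType) (x0 : X) (m : nat).
Implicit Types U V Z : 'I_m -> X -> C.

Lemma hip_continuous U V :
  (forall l, {for x0, continuous (U l)}) ->
  (forall l, {for x0, continuous (V l)}) ->
  {for x0, continuous (fun x => hip (U^~ x) (V^~ x))}.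
Proof.
move=> Uc Vc; apply: cvg_big => [|l _]; first exact: add_continuous.
apply: cvgM; first exact: Uc.
by apply: (@continuous_comp _ _ _ (V l) Num.conj x0 (Vc l)); exact: conj_continuous.
Qed.

Lemma fsform_continuous Z U V :
  (forall l, {for x0, continuous (Z l)}) ->
  (forall l, {for x0, continuous (U l)}) ->
  (forall l, {for x0, continuous (V l)}) ->
  hip (Z^~ x0) (Z^~ x0) != 0 ->
  {for x0, continuous (fun x => fsform (Z^~ x) (U^~ x) (V^~ x))}.
Proof.
move=> Zc Uc Vc Z0; rewrite /fsform; apply: cvgM.
  by apply: cvgB; apply: cvgM; exact: hip_continuous.
apply: cvgV; first by rewrite expf_neq0.
by rewrite expr2; under eq_fun do rewrite expr2; apply: cvgM; exact: hip_continuous.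
Qed.

Lemma mulc_continuous (a : C) (f : X -> C) : {for x0, continuous f} ->
  {for x0, continuous (fun x => a * f x)}.
Proof. exact: (@cvgM C X (nbhs x0) _ (fun=> a) f _ _ (cvg_cst _)). Qed.

Lemma det_continuous (A : X -> 'M[C]_m) :
  (forall i j, {for x0, continuous (fun x => A x i j)}) ->
  {for x0, continuous (fun x => \det (A x))}.
Proof.
move=> Ac; rewrite /prop_for /continuous_at /determinant.
apply: cvg_big => [|s _]; first exact: add_continuous.
apply: (@mulc_continuous _ (fun x => \prod_i A x i (perm.fun_of_perm.body s i))).
by apply: cvg_big => [|i _]; [exact: mul_continuous | exact: Ac].
Qed.

End Continuity.

(** In the chart of [p] and one trivialization, the coefficients are continuous expressions in the
    components of the sections and their partial derivatives. The bound is the value at [p] plus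
    1. *)
Lemma bergman_form_det_bounded (hM : complex_manifold M) p :
  exists B : R, \forall q \near p,
    reC (\det (coef (bergman_form k.+1 T) (chart_at p) q)) <= B.
Proof.
have [tp dp] := aM p; have bp := bdom_btriv hP p.
pose c := chart_at p; pose y0 := cmap c p.
pose Z l := lrep (P := power L k.+1) (btriv L p) (T l) \o cinv c.
have sZ l : smooth_near y0 (Z l) by exact: lrep_smooth.
pose h a b y := k.+1%:R^-1 * (mkC (2 * pi)^-1 0 *
    fsform (fun l => Z l y) (fun l => 'D_(delta_mx 0 a) (Z l) y)
     (fun l => 'D_(delta_mx 0 b) (Z l) y)).
pose A y := \matrix_(a, b) h a b y.
have Z0 : hip (fun l => Z l y0) (fun l => Z l y0) != 0.
  have [l Tl] := basis_neq0 p.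
  exact: (lt0r_neq0 (hip_gt0 (lift_neq0 hP tp dp bp Tl))).
have cZ l : {for y0, continuous (Z l)} by exact: smooth_near_continuous.
have cD a l : {for y0, continuous ('D_(delta_mx 0 a) (Z l))}.
  by apply: smooth_near_continuous; exact: smooth_near_derive.
have cA a b : {for y0, continuous (fun y => A y a b)}.
  have -> : (fun y => A y a b) = h a b by apply/funext => y; rewrite mxE.
  exact: (mulc_continuous (mulc_continuous (fsform_continuous cZ (cD a) (cD b) Z0))).
have cdet := det_continuous cA.
exists (reC (\det (A y0)) + 1).
have nD : \forall y \near y0, reC (\det (A y)) <= reC (\det (A y0)) + 1.
  have nd : \forall y \near y0, `|\det (A y0) - \det (A y)| < 1 :=
    @cvgr_dist_lt _ _ _ (nbhs y0) _ _ _ cdet 1 ltr01.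
  near=> y; have : `|\det (A y0) - \det (A y)| < 1 by near: y; exact: nd.
  rewrite -(cR1 R) distrC => /(le_lt_trans (norm_reC _)).
  rewrite ltr_cR reCD reCN => /ltW /ler_normlP [_].
  by rewrite lerBlDl.
have nZ l : \forall y \near y0, differentiable (Z l) y.
  by apply: filterS (smooth_near_near (sZ l)) => y; exact: smooth_near_differentiable.
have nZ' : \forall y \near y0, forall l, differentiable (Z l) y.
  have FF : Filter (nbhs (y0 : ('rV[C]_n : normedModType C))) by exact: nbhs_filter.
  exact: (@filter_forall _ _ (fun l y => differentiable (Z l) y) _ FF nZ).
near=> q.
have cq : cdom c q by near: q; exact: cdom_near.
have bq : bdom (btriv L p) q by near: q; exact: (bdom_near hP bp).
have [tq dq] := aM q.
have dtr : differentiable (cmap (chart_at q) \o cinv c) (cmap c q).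
  by apply: smooth_near_differentiable; exact: transition_smooth.
have dZ : forall l, differentiable (Z l) (cmap c q).
  by near: q; exact: (near_of_chart tp dp nZ').
have -> : coef (bergman_form k.+1 T) c q = A (cmap c q).
  apply/matrixP => a b; rewrite [RHS]mxE.
  exact: (bergman_form_entry a b tp cq bq dtr dZ).
by near: q; exact: (near_of_chart tp dp nD).
Unshelve. all: by end_near. Qed.

End Basis.

(** * Pullback of Bergman forms *)

Section BergmanPullback.
Context {R : realType} {n : nat} {M : charted R n}.
Local Notation C := (Cplx R).
Hypothesis aM : atlas M.

Lemma pullbackZ (g : M -> M) a (w : form11 M) :
  pullback g (fun p => a *: w p) = (fun p => a *: pullback g w p).
Proof. by apply/funext => p; rewrite /pullback -scalemxAr -scalemxAl. Qed.

Lemma bergman_form_pullback k N (T : 'I_N.+1 -> M -> C) (g : M -> M) :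
  holomorphic g ->
  (forall p, differentiable (in_charts (kodaira_map T) p) (cmap (chart_at p) p)) ->
  pullback g (bergman_form k T) = bergman_form k (fun i => T i \o g).
Proof.
by move=> hg dT; rewrite pullbackZ -(pullback_comp aM (fubini_study R N) hg dT).
Qed.

Lemma kodaira_comp_differentiable N (T : 'I_N.+1 -> M -> C) (g : M -> M) :
  holomorphic g ->
  (forall p, differentiable (in_charts (kodaira_map T) p) (cmap (chart_at p) p)) ->
  forall p, differentiable (in_charts (kodaira_map (fun i => T i \o g)) p)
    (cmap (chart_at p) p).
Proof.
move=> hg dT p; have [gc _] := hg p.
by have [] := jac_comp aM aM gc (holomorphic_differentiable _ hg) (dT _).
Qed.

End BergmanPullback.

(** * The maximum principle *)

Lemma half_lt (R : realType) (x : R) : 0 < x -> x / 2 < x.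
Proof. lra. Qed.

Lemma barrier_constant (R : realType) (a : R) : 0 <= a -> 0 < 8 * (a + 1) - 4 * a.
Proof. lra. Qed.

Lemma le0_combine (R : realType) (x y e a b : R) :
  x + e * a <= 0 -> y + e * b <= 0 -> (x + y) + e * (a + b) <= 0.
Proof. by rewrite mulrDr; lra. Qed.

Lemma lt_of_margin (R : realType) (d m v b : R) :
  0 < d -> v <= m - d -> b <= d / 2 -> v + b < m.
Proof. lra. Qed.

Section SecondDerivativeTest.
Variables (R : realType) (V : normedModType R).

Lemma is_derive_line (w : V -> R) x v t :
  differentiable w (t *: v + x) ->
  is_derive t (1 : R) (fun s => w (s *: v + x)) ('D_v w (t *: v + x)).
Proof.
move=> dw; have E : (fun h : R => h^-1 *: (((fun s => w (s *: v + x)) \o shift t) (h *: (1 : R))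
    - w (t *: v + x))) = (fun h => h^-1 *: ((w \o shift (t *: v + x)) (h *: v) - w (t *: v + x))).
  by apply/funext => h /=; rewrite addrA -scalerDl -[h *: (1 : R)]/(h * 1) mulr1.
by split; rewrite /derivable /derive E //; exact: diff_derivable.
Qed.

(** On the line through [x] along [v] the first derivative vanishes at the maximum. If the second
    derivative were positive, the first would be positive just after [x], and the mean value theorem
    would produce a value above the maximum. *)
Lemma second_derivative_le0 (w : V -> R) x v :
  (\forall y \near x, differentiable w y) -> differentiable ('D_v w) x ->
  (\forall y \near x, w y <= w x) -> 'D_v ('D_v w) x <= 0.
Proof.
move=> dw ddw wmax; rewrite leNgt; apply/negP => s0.
pose phi t := w (t *: v + x).
have line_cvg : {for (0 : R), continuous (fun t : R => t *: v + x)}.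
  apply: cvgD; last exact: cvg_cst.
  by apply: cvgZ; [exact: cvg_id | exact: cvg_cst].
have near_line (P : set V) : (\forall y \near x, P y) -> \forall t \near (0 : R), P (t *: v + x).
  move=> Px; have : nbhs (0 *: v + x) P by rewrite scale0r add0r.
  exact: line_cvg.
have dphi : \forall t \near (0 : R), is_derive t (1 : R) phi ('D_v w (t *: v + x)).
  by apply: filterS (near_line _ dw) => t; exact: is_derive_line.
have phimax : \forall t \near (0 : R), phi t <= phi 0.
  by rewrite /phi scale0r add0r; exact: (near_line _ wmax).
have [d /= d0 dH] : exists2 d, 0 < d & forall t, `|t| < d ->
    is_derive t (1 : R) phi ('D_v w (t *: v + x)) /\ phi t <= phi 0.
  have : \forall t \near (0 : R), is_derive t (1 : R) phi ('D_v w (t *: v + x)) /\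
      phi t <= phi 0 by exact: filterI dphi phimax.
  move=> /nbhs_ballP [d d0 dH].
  by exists d => // t td; apply: dH; rewrite /ball /= sub0r normrN.
have itvE t : t \in `]- d, d[%R -> `|t| < d by rewrite in_itv /= ltr_norml.
have [_ phi0] : is_derive (0 : R) (1 : R) phi 0.
  apply: (@derive1_at_max R phi (- d) d 0).
  - by rewrite ge0_cp // ltW.
  - by move=> t /itvE /dH [[]].
  - by rewrite in_itv /= oppr_lt0 d0.
  - by move=> t /itvE /dH [].
have Dw0 : 'D_v w x = 0.
  have [|[_ E0] _] := dH 0; first by rewrite normr0.
  by move: E0; rewrite phi0 scale0r add0r.
have [dpsi Dpsi] : is_derive (0 : R) (1 : R) (fun s => 'D_v w (s *: v + x)) ('D_v ('D_v w) x).
  have := @is_derive_line ('D_v w) x v 0.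
  by rewrite scale0r add0r; apply.
have : \forall h \near (0 : R)^', 0 < h^-1 *: ('D_v w (h *: v + x)).
  have cv : h^-1 *: ('D_v w (h *: v + x)) @[h --> (0 : R)^'] --> 'D_v ('D_v w) x.
    move: dpsi; rewrite /derivable => /cvg_ex [l cl].
    have ll : l = 'D_v ('D_v w) x by rewrite -Dpsi; apply/esym/cvg_lim.
    rewrite ll in cl; apply: cvg_trans cl; apply: near_eq_cvg; near=> h.
    by rewrite /= scale0r !add0r Dw0 subr0 addr0 -[h *: (1 : R)]/(h * 1) mulr1.
  exact: (@cvgr_gt _ _ _ _ _ _ cv 0 s0).
rewrite /= near_withinE => /nbhs_ballP [e /= e0 eH].
have psi_gt0 t : 0 < t -> t < e -> 0 < 'D_v w (t *: v + x).
  move=> t0 te; have := eH t; rewrite /ball /= sub0r normrN (gtr0_norm t0) => /(_ te).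
  move=> /(_ (lt0r_neq0 t0)); have ti : 0 < t^-1 by rewrite invr_gt0.
  by rewrite -[_ *: _]/(_ * _) (pmulr_rgt0 _ ti).
pose b := Num.min d e / 2.
have m0 : 0 < Num.min d e by rewrite lt_min d0 e0.
have b0 : 0 < b by rewrite divr_gt0.
have bm : b < Num.min d e by exact: half_lt.
have bd : b < d by apply: lt_le_trans bm _; rewrite ge_min lexx.
have be : b < e by apply: lt_le_trans bm _; rewrite ge_min lexx orbT.
have phid t : 0 <= t -> t <= b -> is_derive t (1 : R) phi ('D_v w (t *: v + x)).
  move=> t0 tb; have tn : `|t| < d by rewrite (ger0_norm t0); exact: le_lt_trans tb bd.
  exact: (dH t tn).1.
have cphi : {within `[0, b], continuous phi}.
  apply: continuous_in_subspaceT => t /set_mem /= tb.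
  apply: differentiable_continuous; apply/derivable1_diffP.
  by move: tb; rewrite in_itv => /andP [t0 tb]; case: (phid t t0 tb).
have dMVT t : t \in `]0, b[%R -> is_derive t (1 : R) phi ('D_v w (t *: v + x)).
  by rewrite in_itv => /andP [t0 tb]; exact: phid (ltW t0) (ltW tb).
have [t] := MVT b0 dMVT cphi; rewrite in_itv => /andP [t0 tb] E.
have bn : `|b| < d by rewrite gtr0_norm.
have := (dH b bn).2; apply/negP; rewrite -ltNge -subr_gt0 E subr0.
exact: mulr_gt0 (psi_gt0 t t0 (lt_trans tb be)) b0.
Unshelve. all: by end_near. Qed.
End SecondDerivativeTest.

(** * The strong maximum principle for harmonic functions *)

Section StrongMaximum.
Variables (R : realType) (n : nat).
Local Notation RV := (('rV[R]_n * 'rV[R]_n)%type : normedModType R).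
Implicit Types X Y : RV.

Definition lap (u : RV -> R) X : R :=
  \sum_j ('D_(dirx R j) ('D_(dirx R j) u) X + 'D_(diry R j) ('D_(diry R j) u) X).

Lemma cballE X (r : R) : [set Y : RV | `|Y - X| <= r] =
  [set x | `|x - X.1| <= r] `*` [set y | `|y - X.2| <= r].
Proof.
apply/seteqP; split=> [[x y]|[x y] []] /=; rewrite prod_normE ge_max.
  by move/andP.
by move=> -> ->.
Qed.

Lemma cball_compact X (r : R) : compact [set Y : RV | `|Y - X| <= r].
Proof.
have H (x : 'rV[R]_n) : compact [set y : 'rV[R]_n | `|y - x| <= r].
  apply: bounded_closed_compact.
    exists (`|x| + `|r|); split; first exact: num_real.
    move=> M Mr y /= yx; apply: le_trans (ltW Mr).
    rewrite -[y](subrK x) (le_trans (ler_normD _ _)) // addrC lerD2l.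
    exact: le_trans yx (ler_norm r).
  have -> : [set y : 'rV[R]_n | `|y - x| <= r] =
     (fun y => `|y - x|) @^-1` [set t | t <= r] by [].
  apply: closed_comp => [y _|]; last exact: closed_le.
  exact: (@cvg_norm _ _ _ (nbhs y) _ (fun y => y - x) (y - x) (cvgB cvg_id (cvg_cst _))).
by rewrite cballE; exact: compact_setX.
Qed.

Lemma norm_sqr_ip X : `|X| ^+ 2 <= ip X X.
Proof.
have H (B : 'rV[R]_n) : (forall l, B 0 l ^+ 2 <= ip X X) -> `|B| ^+ 2 <= ip X X.
  move=> HB; rewrite -(sqr_sqrtr (ip_ge0 X)) ler_sqr ?nnegrE ?sqrtr_ge0 //.
  apply: mx_norm_le => [|i l]; first exact: sqrtr_ge0.
  by rewrite ord1 -sqrtr_sqr ler_sqrt ?ip_ge0.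
have xl l : X.1 0 l ^+ 2 + X.2 0 l ^+ 2 <= ip X X.
  rewrite /ip (bigD1 l) //= -!expr2 lerDl sumr_ge0 // => i _.
  by rewrite -!expr2 addr_ge0 // sqr_ge0.
rewrite prod_normE; case: (leP `|X.1| `|X.2|) => _; apply: H => l;
  by apply: le_trans (xl l); rewrite ?lerDl ?lerDr sqr_ge0.
Qed.

Lemma sqdist_continuous X0 : continuous (sqdist X0).
Proof. by move=> X; apply: differentiable_continuous; have [] := is_diff_sqdist X0 X. Qed.

Lemma sum_ip_basis Y :
  \sum_j (ip (dirx R j) Y ^+ 2 + ip (diry R j) Y ^+ 2) = ip Y Y.
Proof. by apply: eq_bigr => j _; rewrite ip_dirx ip_diry -!expr2. Qed.

Lemma sum_basis_norm :
  \sum_(j < n) (ip (dirx R j) (dirx R j) + ip (diry R j) (diry R j)) = n%:R *+ 2.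
Proof.
under eq_bigr => j _.
  rewrite ip_dirx ip_diry /= /mx_coord !mxE !eqxx -mulr2n; over.
by rewrite sumr_const card_ord -mulrnA mulnC mulrnA.
Qed.

(* Positive inside the sphere |X - X0|^2 = r, zero on it, negative just
   outside, and subharmonic near it once c is large. *)
Definition barrier X0 (r c : R) X : R :=
  (r - sqdist X0 X) * (1 + c * (r - sqdist X0 X)).

Lemma is_diff_barrier X0 r c X : differentiable (barrier X0 r c) X /\
  forall v, 'D_v (barrier X0 r c) X =
    - (1 + 2 * c * (r - sqdist X0 X)) * (2 * ip v (X - X0)).
Proof.
have [d D] := is_diff_sqdist X0 X.
have ds : differentiable (fun X => r - sqdist X0 X) X.
  by apply: differentiableB => //; exact: differentiable_cst.
have Ds v : 'D_v (fun X => r - sqdist X0 X) X = - (2 * ip v (X - X0)).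
  apply: etrans (deriveB (derivable_cst _ _ _) (diff_derivable d)) _.
  by rewrite derive_cst D sub0r.
have dcs : differentiable (fun X => c *: (r - sqdist X0 X)) X by exact: differentiableZ.
have Dcs v : 'D_v (fun X => c *: (r - sqdist X0 X)) X = - (c * (2 * ip v (X - X0))).
  by apply: etrans (deriveZ c (diff_derivable ds)) _; rewrite Ds; exact: mulrN.
have d1 : differentiable (fun X => 1 + c *: (r - sqdist X0 X)) X.
  by apply: differentiableD => //; exact: differentiable_cst.
have D1 v : 'D_v (fun X => 1 + c *: (r - sqdist X0 X)) X = - (c * (2 * ip v (X - X0))).
  apply: etrans (deriveD (derivable_cst _ _ _) (diff_derivable dcs)) _.
  by rewrite derive_cst Dcs add0r.
have [db Db] := is_diff_scale ds d1.
split=> // v; apply: etrans (Db v) _; rewrite Ds D1 /GRing.scale /=.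
by move: (ip v _) (sqdist X0 X) => a b; ring.
Qed.

Lemma differentiable_derive_barrier X0 r c X v :
  differentiable ('D_v (barrier X0 r c)) X /\
  'D_v ('D_v (barrier X0 r c)) X = 8 * c * ip v (X - X0) ^+ 2
    - 2 * (1 + 2 * c * (r - sqdist X0 X)) * ip v v.
Proof.
have -> : 'D_v (barrier X0 r c) =
    fun X => (- 2 * (1 + 2 * c * (r - sqdist X0 X))) *: ip v (X - X0).
  apply/funext => Y; have [_ ->] := is_diff_barrier X0 r c Y.
  by rewrite -[_ *: _]/(_ * _); ring.
have [d D] := is_diff_sqdist X0 X.
pose f Y := r - sqdist X0 Y.
have df : differentiable f X.
  by apply: differentiableB => //; exact: differentiable_cst.
have Df : 'D_v f X = - (2 * ip v (X - X0)).
  apply: etrans (deriveB (derivable_cst _ _ _) (diff_derivable d)) _.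
  by rewrite derive_cst D sub0r.
pose a Y := - 2 - (4 * c) *: f Y.
have dcf : differentiable (fun Y => (4 * c) *: f Y) X by exact: differentiableZ.
have da : differentiable a X.
  by apply: differentiableB => //; exact: differentiable_cst.
have Da : 'D_v a X = 4 * c * (2 * ip v (X - X0)).
  apply: etrans (deriveB (derivable_cst _ _ _) (diff_derivable dcf)) _.
  rewrite derive_cst sub0r (deriveZ (4 * c) (diff_derivable df)) Df.
  by rewrite -[_ *: _]/(_ * _); ring.
pose g Y := ip v (Y - X0).
have gE : g = fun Y => ip v Y - ip v X0 by apply/funext => Y; rewrite /g linearB.
have [di Di] := is_diff_ip X v.
have dg : differentiable g X.
  by rewrite gE; apply: differentiableB => //; exact: differentiable_cst.
have Dg : 'D_v g X = ip v v.
  rewrite gE; apply: etrans (deriveB (diff_derivable di) (derivable_cst _ _ _)) _.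
  by rewrite derive_cst subr0 Di.
have -> : (fun X => (- 2 * (1 + 2 * c * (r - sqdist X0 X))) *: ip v (X - X0)) =
    (fun Y => a Y *: g Y).
  apply/funext => Y; congr (_ *: _); rewrite /a /f -[_ *: _]/(_ * _); ring.
have [dag Dag] := is_diff_scale da dg.
split=> //; rewrite Dag Da Dg /a /f /g /GRing.scale /=.
by move: (ip v _) (ip v v) (sqdist X0 X) => x y z; ring.
Qed.

Lemma lap_barrier X0 r c X : lap (barrier X0 r c) X =
  8 * c * sqdist X0 X - 4 * n%:R * (1 + 2 * c * (r - sqdist X0 X)).
Proof.
rewrite /lap (eq_bigr (fun j => 8 * c * (ip (dirx R j) (X - X0) ^+ 2 +
     ip (diry R j) (X - X0) ^+ 2) - 2 * (1 + 2 * c * (r - sqdist X0 X)) *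
     (ip (dirx R j) (dirx R j) + ip (diry R j) (diry R j)))) => [|j _].
  by rewrite sumrB -!mulr_sumr sum_ip_basis sum_basis_norm -/(sqdist X0 X); ring.
have [_ Dx] := differentiable_derive_barrier X0 r c X (dirx R j).
have [_ Dy] := differentiable_derive_barrier X0 r c X (diry R j).
apply: etrans (f_equal2 +%R Dx Dy) _.
move: (ip (dirx R j) (X - X0)) (ip (diry R j) (X - X0)) (sqdist X0 X) => x y s.
by move: (ip (dirx R j) (dirx R j)) (ip (diry R j) (diry R j)) => p q; ring.
Qed.

Lemma compact_max (K : set RV) (f : RV -> R) : K !=set0 -> compact K ->
  (forall X, K X -> {for X, continuous f}) ->
  exists2 c, K c & forall X, K X -> f X <= f c.
Proof.
move=> K0 cK cf; have [|c /set_mem Kc H] := @compact_EVT_max RV R f K K0 cK.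
  by apply: continuous_in_subspaceT => X /set_mem; exact: cf.
by exists c => // X KX; apply: H; exact: mem_set.
Qed.

Lemma derive2_add (u b : RV -> R) e X v :
  (\forall Y \near X, differentiable u Y) -> differentiable ('D_v u) X ->
  (\forall Y \near X, differentiable b Y) -> differentiable ('D_v b) X ->
  [/\ \forall Y \near X, differentiable (fun Y => u Y + e *: b Y) Y,
      differentiable ('D_v (fun Y => u Y + e *: b Y)) X &
      'D_v ('D_v (fun Y => u Y + e *: b Y)) X =
      'D_v ('D_v u) X + e * 'D_v ('D_v b) X].
Proof.
move=> du ddu db ddb.
have dZ Y : differentiable b Y -> differentiable (fun Y => e *: b Y) Y.
  by move=> dbY; exact: differentiableZ.
have d Y : differentiable u Y -> differentiable b Y ->
    differentiable (fun Y => u Y + e *: b Y) Y.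
  by move=> duY dbY; exact: (differentiableD duY (dZ _ dbY)).
have DE : {near X, (fun Y => 'D_v u Y + e *: 'D_v b Y) =1 'D_v (fun Y => u Y + e *: b Y)}.
  apply: filterS2 du db => Y duY dbY; apply/esym.
  apply: etrans (deriveD (diff_derivable duY) (diff_derivable (dZ _ dbY))) _.
  by rewrite (deriveZ e (diff_derivable dbY)).
have ddZ : differentiable (fun Y => e *: 'D_v b Y) X by exact: differentiableZ.
have ddd := differentiableD ddu ddZ.
split.
- by apply: filterS2 du db => Y; exact: d.
- exact: differentiable_near_eq DE ddd.
- apply: etrans (esym (near_eq_derive v DE)) _.
  apply: etrans (deriveD (diff_derivable ddu) (diff_derivable ddZ)) _.
  by rewrite (deriveZ e (diff_derivable ddb)).
Qed.

Lemma lap_add_barrier (u : RV -> R) X0 r c e X : smooth_near X u ->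
  (\forall Y \near X, u Y + e *: barrier X0 r c Y <= u X + e *: barrier X0 r c X) ->
  lap u X + e * lap (barrier X0 r c) X <= 0.
Proof.
move=> su wmax.
have du : \forall Y \near X, differentiable u Y.
  by apply: filterS (smooth_near_near su) => Y; exact: smooth_near_differentiable.
have db : \forall Y \near X, differentiable (barrier X0 r c) Y.
  by apply: filterS du => Y _; exact: (is_diff_barrier X0 r c Y).1.
have H v : 'D_v ('D_v u) X + e * 'D_v ('D_v (barrier X0 r c)) X <= 0.
  have ddu := smooth_near_differentiable (smooth_near_derive v su).
  have ddb := (differentiable_derive_barrier X0 r c X v).1.
  have [dw ddw <-] := derive2_add e du ddu db ddb.
  exact: second_derivative_le0 dw ddw wmax.
rewrite /lap mulr_sumr -big_split /=; apply: sumr_le0 => j _.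
exact (le0_combine (H (dirx R j)) (H (diry R j))).
Qed.

Lemma ip_parallelogram (a h : RV) : ip (a + h) (a + h) + ip (a - h) (a - h) =
  2 * ip a a + 2 * ip h h.
Proof.
have E b : ip (a + b) (a + b) = ip a a + 2 * ip a b + ip b b.
  have D X Y Z : ip X (Y + Z) = ip X Y + ip X Z by exact: linearD.
  by rewrite D (ipC _ a) (ipC _ b) !D (ipC b a); ring.
have N X Y : ip X (- Y) = - ip X Y by exact: linearN.
by rewrite !E !N (ipC (- h)) N; ring.
Qed.

(** The ball with diameter from [x0] to [y] touches the sphere around [x0] through [y] only at [y]:
    by the parallelogram identity at the midpoint, |X - x0|^2 + |X - y|^2 is at most |x0 - y|^2 in
    that ball. *)
Lemma midpoint_ball (x0 y X : RV) : X != y ->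
  sqdist (2^-1 *: (x0 + y)) X <= sqdist x0 y / 4 ->
  sqdist x0 X < sqdist x0 y.
Proof.
move=> Xy; set X0 := 2^-1 *: (x0 + y); pose h := y - X0.
have half2 (a : RV) : 2^-1 *: a + 2^-1 *: a = a.
  by rewrite -scalerDl (_ : 2^-1 + 2^-1 = 1 :> R) ?scale1r //; lra.
have hE : h = X0 - x0.
  have X2 : X0 + X0 = x0 + y := half2 _.
  by apply/eqP; rewrite /h subr_eq addrAC X2 addrAC subrr add0r.
have yE : y - x0 = h + h by rewrite {2}hE /h addrA subrK.
have n4 : sqdist x0 y = 4 * ip h h.
  rewrite /sqdist yE; have := ip_parallelogram h h; rewrite subrr.
  have -> : ip (0 : RV) 0 = 0.
    by apply: big1 => l _; rewrite /= /mx_coord !mxE !mulr0 addr0.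
  by move=> E; rewrite -[LHS]addr0 E; ring.
have XE : X - x0 = (X - X0) + h by rewrite hE addrA subrK.
have XyE : X - y = (X - X0) - h by rewrite /h opprB addrA subrK.
have := ip_parallelogram (X - X0) h.
rewrite -XE -XyE n4 -!/(sqdist _ _).
have : 0 < ip (X - y) (X - y).
  rewrite lt_def ip_ge0 andbT; apply: contra_neq Xy => /ip_eq0 /eqP.
  by rewrite subr_eq0 => /eqP.
rewrite -/(sqdist y X).
move: (sqdist X0 X) (sqdist x0 X) (sqdist y X) (ip h h) => s1 s2 s3 s4; clear; lra.
Qed.

Lemma sqdist_gt0 (x y : RV) : y != x -> 0 < sqdist x y.
Proof.
move=> yx; rewrite lt_def ip_ge0 andbT; apply: contra_neq yx => /ip_eq0 /eqP.
by rewrite subr_eq0 => /eqP.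
Qed.

Lemma sqdist_ge0 (x y : RV) : 0 <= sqdist x y. Proof. exact: ip_ge0. Qed.

Lemma norm_lt_sqdist (x y : RV) d : 0 <= d -> sqdist x y < d ^+ 2 -> `|y - x| < d.
Proof.
move=> d0 H; rewrite -ltr_sqr ?nnegrE //.
exact: le_lt_trans (norm_sqr_ip _) H.
Qed.

Lemma sqdistC X Y : sqdist X Y = sqdist Y X.
Proof.
by apply: eq_bigr => l _; rewrite !cxB !cyB; ring.
Qed.

Section Contact.
Variables (u : RV -> R) (p : RV) (rho m : R).
Hypothesis su : forall X, `|X - p| < rho -> smooth_near X u.
Hypothesis lu : forall X, `|X - p| < rho -> lap u X = 0.
Hypothesis um : forall X, `|X - p| < rho -> u X <= m.

(* Hopf's boundary argument: y is the only maximum point of u in the closed ball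
   around X0, so u + e * barrier stays below m on the rest of a small sphere
   around y; as it equals m at y, it has a local maximum inside that sphere,
   where its Laplacian is positive. *)
Lemma no_contact (y X0 : RV) (r : R) : `|y - p| < rho -> u y = m -> 0 < r ->
  sqdist X0 y = r ->
  (forall X, `|X - p| < rho -> sqdist X0 X <= r -> X != y -> u X < m) -> False.
Proof.
move=> yp uy r0 sy ult.
(* At [y], where [s] vanishes and [sqdist X0 y = r], the Laplacian of the barrier is 8 c r - 4 n,
   which this choice turns into 8 (n + 1) - 4 n > 0. *)
pose c := n.+1%:R / r.
pose s X := r - sqdist X0 X.
pose E X := 8 * c * sqdist X0 X - 4 * n%:R * (1 + 2 * c * s X).
have sc : continuous s.
  by move=> X; apply: cvgB; [exact: cvg_cst | exact: sqdist_continuous].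
have sy0 : s y = 0 by rewrite /s sy subrr.
have nE : \forall X \near y, 0 < E X.
  have Ec : {for y, continuous E}.
    apply: cvgB.
      by apply: cvgM; [exact: cvg_cst | exact: sqdist_continuous].
    apply: cvgM; first exact: cvg_cst.
    apply: cvgD; first exact: cvg_cst.
    by apply: cvgM; [exact: cvg_cst | exact: sc].
  have Ey : 0 < E y.
    rewrite /E sy0 sy mulr0 addr0 mulr1 /c -mulrA divfK ?lt0r_neq0 //.
    by rewrite -[n.+1%:R]natr1; exact: barrier_constant (ler0n R n).
  exact: (@cvgr_gt _ _ _ _ _ _ Ec 0 Ey).
have nb : \forall X \near y, 0 < 1 + c * s X.
  have bc : {for y, continuous (fun X => 1 + c * s X)}.
    apply: cvgD; first exact: cvg_cst.
    by apply: cvgM; [exact: cvg_cst | exact: sc].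
  have b1 : 0 < 1 + c * s y by rewrite sy0 mulr0 addr0.
  exact: (@cvgr_gt _ _ _ _ _ _ bc 0 b1).
have np : \forall X \near y, `|X - p| < rho.
  have nc : {for y, continuous (fun X => `|X - p|)}.
    exact: (@cvg_norm _ _ _ (nbhs y) _ (fun y => y - p) (y - p) (cvgB cvg_id (cvg_cst _))).
  exact: (@cvgr_lt _ _ _ _ _ _ nc rho yp).
have [d d0 dH] : exists2 d, 0 < d & forall X, `|X - y| <= d ->
    [/\ 0 < E X, 0 < 1 + c * s X & `|X - p| < rho].
  have : \forall X \near y, 0 < E X /\ 0 < 1 + c * s X /\ `|X - p| < rho.
    exact: filterI nE (filterI nb np).
  move=> /nbhs_ballP [d /= d0 dH]; exists (d / 2); first by rewrite divr_gt0.
  move=> X Xy; have [|H1 [H2 H3]] := dH X; last by split.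
  by rewrite -ball_normE /= distrC (le_lt_trans Xy) // half_lt.
pose D := [set X : RV | `|X - y| <= d].
have Dy : D y by rewrite /D /= subrr normr0 ltW.
have uc X : D X -> {for X, continuous u}.
  by move=> /dH [_ _ /su]; exact: smooth_near_continuous.
have bc X : {for X, continuous (barrier X0 r c)}.
  by apply: differentiable_continuous; exact: (is_diff_barrier X0 r c X).1.
(* The part of the small sphere around [y] that lies in the closed ball around [X0]. It is compact
   and avoids [y], so [u] stays below [m] on it by a definite gap [del]. *)
pose S := [set X : RV | D X /\ d <= `|X - y| /\ 0 <= s X].
have S_compact : compact S.
  refine (@subclosed_compact RV S [set Y : RV | `|Y - y| <= d] _ (@cball_compact y d) _);
    last by move=> X [].
  have -> : S = D `&` ((fun X => `|X - y|) @^-1` [set t | d <= t] `&`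
     s @^-1` [set t | 0 <= t]) by [].
  apply: closedI.
    by apply: compact_closed; [exact: norm_hausdorff | exact: cball_compact].
  apply: closedI.
    apply: closed_comp => [X _|]; last exact: closed_ge.
    exact: (@cvg_norm _ _ _ (nbhs X) _ (fun X => X - y) (X - y) (cvgB cvg_id (cvg_cst _))).
  by apply: closed_comp => [X _|]; [exact: sc | exact: closed_ge].
have uS X : S X -> u X < m.
  move=> [DX [dX sX]]; have [_ _ Xp] := dH X DX; apply: ult => //.
    by move: sX; rewrite /s subr_ge0.
  by apply/eqP => Xy; move: dX; rewrite Xy subrr normr0 leNgt d0.
have [del del0 delS] : exists2 del, 0 < del & forall X, S X -> u X <= m - del.
  have [[X SX]|S0] := pselect (S !=set0); last first.
    by exists 1 => // X SX; case: S0; exists X.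
  have [||c0 Sc cH] := @compact_max S u _ S_compact.
  - by exists X.
  - by move=> Y [/uc].
  - by exists (m - u c0) => [|Y /cH]; rewrite ?subr_gt0 ?uS // opprB addrC subrK.
pose Bm := r * (1 + c * r).
have c0 : 0 < c by rewrite /c divr_gt0.
have Bm0 : 0 < Bm by rewrite mulr_gt0 // addr_gt0 // mulr_gt0.
(* [Bm] bounds the barrier on [S], so adding [e] times the barrier uses up at most half of the
   gap. *)
pose e := del / 2 / Bm.
have e0 : 0 < e by rewrite !divr_gt0.
pose w X := u X + e *: barrier X0 r c X.
have bE X : barrier X0 r c X = s X * (1 + c * s X) by [].
have wy : w y = m by rewrite /w bE sy0 mul0r scaler0 addr0.
have [||x1 Dx1 x1max] := @compact_max D w _ (@cball_compact y d).
- by exists y.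
- move=> X DX; apply: cvgD; first exact: uc.
  by apply: cvgZ; [exact: cvg_cst | exact: bc].
have [Ex bx xp] := dH x1 Dx1.
have wx1 : m <= w x1 by rewrite -wy; exact: x1max.
(* An interior maximum contradicts the positive Laplacian of [w]. On the sphere, [w] is below [m]:
   outside the ball because the barrier is negative, on [S] because of the gap. *)
have [xin|xout] := ltP `|x1 - y| d.
  have wmax : \forall Y \near x1, w Y <= w x1.
    have nc : {for x1, continuous (fun X => `|X - y|)}.
      exact: (@cvg_norm _ _ _ (nbhs x1) _ (fun X => X - y) (x1 - y) (cvgB cvg_id (cvg_cst _))).
    have nx : \forall Y \near x1, `|Y - y| < d by exact: (@cvgr_lt _ _ _ _ _ _ nc d xin).
    by apply: filterS nx => Y /ltW; exact: x1max.
  have := lap_add_barrier (su xp) wmax.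
  rewrite (lu xp) add0r lap_barrier leNgt => /negP; apply.
  exact: mulr_gt0.
have [sx|sx] := ltP (s x1) 0.
  have : w x1 < m.
    rewrite /w -[ltRHS]addr0 ler_ltD ?um //.
    by rewrite -[_ *: _]/(_ * _) bE pmulr_rlt0 // pmulr_llt0.
  by rewrite ltNge wx1.
have Sx1 : S x1 by split.
have : w x1 < m.
  have sr : s x1 <= r by rewrite /s gerBl sqdist_ge0.
  have bB : barrier X0 r c x1 <= Bm.
    rewrite bE /Bm ler_pM // ?(ltW bx) // lerD2l ler_wpM2l //; exact: ltW.
  have eB : e * barrier X0 r c x1 <= del / 2.
    by apply: le_trans (ler_wpM2l (ltW e0) bB) _; rewrite /e divfK // lt0r_neq0.
  rewrite /w -[_ *: _]/(_ * _).
  exact: lt_of_margin del0 (delS _ Sx1) eB.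
by rewrite ltNge wx1.
Qed.

End Contact.

(** If [u] is smaller at some [x0] near [p], the open ball around [x0] reaching to the nearest
    maximum point [y] contains no maximum point, but its boundary may contain several. The ball with
    diameter from [x0] to [y] meets the maximum set only at [y], the situation excluded by
    [no_contact]. Taking [x0] within [rho / 4] of [p] keeps everything in the domain. *)
Lemma strong_maximum (u : RV -> R) p rho : 0 < rho ->
  (forall X, `|X - p| < rho -> smooth_near X u) ->
  (forall X, `|X - p| < rho -> lap u X = 0) ->
  (forall X, `|X - p| < rho -> u X <= u p) ->
  \forall X \near p, u X = u p.
Proof.
move=> rho0 su lu um; pose d := rho / 2; pose d2 := d / 2.
have d0 : 0 < d by rewrite divr_gt0.
have d20 : 0 < d2 by rewrite divr_gt0.
have pE : sqdist p p = 0.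
  by rewrite /sqdist subrr; apply: big1 => l _; rewrite /= /mx_coord !mxE !mulr0 addr0.
have : \forall X \near p, sqdist p X < d2 ^+ 2.
  have pd : sqdist p p < d2 ^+ 2 by rewrite pE exprn_gt0.
  exact: (@cvgr_lt _ _ _ _ _ _ (@sqdist_continuous p p) (d2 ^+ 2) pd).
apply: filterS => x0 x0p; apply/eqP; apply: contraT => ux0.
have sym := sqdistC.
have cont X : `|X - p| < rho -> {for X, continuous u}.
  by move=> /su; exact: smooth_near_continuous.
pose D := [set X : RV | `|X - p| <= d].
have Drho X : D X -> `|X - p| < rho by move=> /le_lt_trans; apply; exact: half_lt.
pose K := [set X : RV | D X /\ u X = u p].
have Kp : K p by split=> //; rewrite /D /= subrr normr0 ltW.
have Dcl : closed D.
  by apply: compact_closed; [exact: norm_hausdorff | exact: cball_compact].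
have K_compact : compact K.
  refine (@subclosed_compact RV K D _ (@cball_compact p d) _); last by move=> X [].
  rewrite -openC openE => X /= /not_andP HX.
  have [DX|nDX] := pselect (D X); last first.
    have : nbhs X (~` D) by apply: open_nbhs_nbhs; split=> //; exact: closed_openC.
    by apply: filterS => Y nDY [].
  have uX : u X != u p by case: HX => // /eqP.
  have u0 : u X - u p != 0 by rewrite subr_eq0.
  have cX : {for X, continuous (fun Y => u Y - u p)}.
    by apply: cvgB; [exact: cont (Drho X DX) | exact: cvg_cst].
  have nu : \forall Y \near X, u Y - u p != 0.
    exact: (@cvgr_neq0 _ _ _ (nbhs X) _ (fun Y => u Y - u p) _ cX u0).
  by apply: filterS nu => Y; rewrite subr_eq0 => /negP H [_ E]; apply: H; apply/eqP.
(* [y] is a maximum point of [u] nearest to [x0]; distance is minimized by maximizing its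
   opposite. *)
have [||y [Dy uy] ymin] := @compact_max K (fun X => - sqdist x0 X) _ K_compact.
- by exists p.
- by move=> X _; apply: cvgN; exact: sqdist_continuous.
have yle : sqdist x0 y <= sqdist x0 p by have := ymin p Kp; rewrite lerN2.
have x0p' : sqdist x0 p < d2 ^+ 2 by rewrite sym.
have x0d : `|x0 - p| < d2 by apply: norm_lt_sqdist => //; exact: ltW.
have xy : y != x0 by apply: contraNneq ux0 => <-; rewrite uy.
have ult X : sqdist x0 X < sqdist x0 y -> u X < u p.
  move=> Xy; have Xx0 : `|X - x0| < d2.
    apply: norm_lt_sqdist (ltW d20) _.
    exact: lt_le_trans Xy (le_trans yle (ltW x0p')).
  have DX : D X.
    rewrite /D /= -(subrK x0 X) -addrA.
    apply: le_trans (ler_normD _ _) _; rewrite [d](splitr d).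
    exact: lerD (ltW Xx0) (ltW x0d).
  rewrite lt_neqAle um ?Drho // andbT; apply/eqP => uX.
  by have := ymin X (conj DX uX); rewrite lerN2 leNgt Xy.
exfalso; have y0 : 0 < sqdist x0 y / 4 by rewrite divr_gt0 // sqdist_gt0.
apply: (no_contact su lu um (Drho y Dy) uy y0 (X0 := 2^-1 *: (x0 + y))).
  have hE : y - 2^-1 *: (x0 + y) = 2^-1 *: (y - x0).
    have {1}-> : y = 2^-1 *: (y + y).
      by rewrite scalerDr -scalerDl (_ : 2^-1 + 2^-1 = 1 :> R) ?scale1r //; lra.
    by rewrite -scalerBr opprD [- x0 - y]addrC addrACA subrr add0r.
  have lZ b Y Z : ip Y (b *: Z) = b * ip Y Z by exact: linearZ.
  by rewrite /sqdist hE lZ ipC lZ -/(sqdist x0 y); field.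
move=> X Xp Xle Xy; apply: ult; exact: midpoint_ball Xy Xle.
Qed.

End StrongMaximum.

(** * Pluriharmonic functions on a compact connected manifold *)

Section Pluriharmonic.
Context {R : realType} {n : nat} {M : charted R n}.
Hypothesis hM : complex_manifold M.
Let aM : atlas M := complex_manifold_atlas hM.

Lemma smooth_fun_continuous (u : M -> R) : smooth_fun u -> continuous u.
Proof.
move=> su p; have [tp dp] := aM p.
have c1 : {for p, continuous (@realify R 1 n \o cmap (chart_at p))}.
  apply: continuous_comp; first exact: cmap_cvg.
  exact: realify_continuous.
have c2 := continuous_comp c1 (smooth_near_continuous (su p)).
move: c2; rewrite /prop_for /continuous_at /= realifyK (cmapK tp) // => c2.
apply: cvg_trans c2; apply: near_eq_cvg.
by apply: filterS (cdom_near tp dp) => q dq /=; rewrite realifyK (cmapK tp).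
Qed.

(** [iddbar u q] is computed in the chart of [q], while the maximum principle needs one chart for
    all points near [p]; the transition map and [levi_comp] bridge the two. *)
Lemma levi_chart_eq0 (u : M -> R) p : smooth_fun u -> (forall q, iddbar u q = 0) ->
  \forall y \near cmap (chart_at p) p, levi (u \o cinv (chart_at p)) y = 0.
Proof.
move=> su u0; have [tp dp] := aM p.
apply: filterS (cimage_near tp dp) => _ [q dq <-].
have [tq dqq] := aM q.
have idc : {for q, continuous (@id M)} by exact: cvg_id.
have thr := through_chart u tp tq dq dqq idc.
have tr := transition_smooth hM dq dqq.
have E0 : (cmap (chart_at q) \o cinv (chart_at p)) (cmap (chart_at p) q) =
  cmap (chart_at q) q by rewrite /= (cmapK tp).
have suq := su q; rewrite -E0 in suq.
apply: etrans (esym (levi_near_eq thr)) _.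
apply: etrans (levi_comp tr suq) _.
by rewrite E0 -/(iddbar u q) u0 mulmx0 mul0mx.
Qed.

Lemma lap_levi (v : 'rV[Cplx R]_n -> R) y : levi v y = 0 ->
  lap (v \o @cplxify R 1 n) (realify y) = 0.
Proof.
move=> /matrixP L; apply: big1 => j _; have := L j j.
rewrite mxE [RHS]mxE => /(congr1 (@reC R)) /= /eqP.
by rewrite mulf_eq0 invr_eq0 pnatr_eq0 orbF => /eqP.
Qed.

(** The set where [u] attains its maximum is closed by continuity and open by the strong maximum
    principle in charts. *)
Lemma pluriharmonic_const (u : M -> R) : compact [set: M] -> connected [set: M] ->
  smooth_fun u -> (forall q, iddbar u q = 0) -> exists c, forall q, u q = c.
Proof.
move=> cM conM su u0; have uc := smooth_fun_continuous su.
have [||p _ pmax] := @compact_EVT_max M R u [set: M] _ cM.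
- by exists point.
- exact: continuous_subspaceT.
exists (u p) => q.
have loc x : u x = u p -> \forall z \near x, u z = u p.
  move=> ux; have [tx dx] := aM x; pose a := realify (cmap (chart_at x) x).
  pose f := (u \o cinv (chart_at x)) \o @cplxify R 1 n.
  have fa : f a = u p by rewrite /f /a /= realifyK (cmapK tx).
  have near1 : \forall X \near a, smooth_near X f by exact: smooth_near_near (su x).
  have near2 : \forall X \near a, lap f X = 0.
    have := levi_chart_eq0 x su u0; rewrite -[cmap _ x]realifyK -/a => LC.
    have LR : \forall X \near a, levi (u \o cinv (chart_at x)) (cplxify X) = 0.
      exact: (@cplxify_continuous R 1 n a _ LC).
    apply: filterS LR => X LX.
    by rewrite -[X]cplxifyK; apply: lap_levi.
  have [d d0 dH] : exists2 d, 0 < d & forall X, `|X - a| < d ->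
      smooth_near X f /\ lap f X = 0.
    have : \forall X \near a, smooth_near X f /\ lap f X = 0 by exact: filterI near1 near2.
    move=> /nbhs_ballP [d d0 dH]; exists d => // X Xa; apply: dH.
    by rewrite -ball_normE /= distrC.
  have : \forall X \near a, f X = f a.
    apply: (strong_maximum d0) => X Xa; [exact: (dH X Xa).1 | exact: (dH X Xa).2 |].
    by rewrite fa; apply: pmax; exact: mem_set.
  move=> /(@realify_continuous R 1 n (cmap (chart_at x) x)) /(near_of_chart tx dx).
  rewrite fa => H; near=> z.
  have <- : f (realify (cmap (chart_at x) z)) = u p by near: z.
  by rewrite /f /= realifyK (cmapK tx) //; near: z; exact: cdom_near.
have : [set x | u x = u p] = [set: M].
  apply: conM; first by exists p.
  - exists [set x | u x = u p]; last by rewrite setTI.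
    by rewrite openE => x /loc.
  - exists [set x | u x = u p]; last by rewrite setTI.
    have -> : [set x | u x = u p] = u @^-1` [set u p] by [].
    by apply: closed_comp => //; exact: closed_eq.
by move=> /seteqP [_ /(_ q)]; apply.
Unshelve. all: by end_near. Qed.

End Pluriharmonic.

(** * Volume measures *)

Section IntegralGeneralities.
Local Open Scope ereal_scope.
Context d (T : measurableType d) (R : realType).
Import HBNNSimple.

(** The supremum over simple functions that underlies the integral. It makes sense for every [f],
    and statements proved through it apply to integrands whose measurability is unknown. *)
Definition nnint (mu : set T -> \bar R) (f : T -> \bar R) : \bar R :=
  ereal_sup [set sintegral mu h | h in [set h : {nnsfun T >-> R} |
    forall x, (h x)%:E <= f x]].

Lemma integral_nnint (mu : set T -> \bar R) (f : T -> \bar R) :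
  \int[mu]_x f x = nnint mu (f ^\+) - nnint mu (f ^\-).
Proof. by rewrite /integral patch_setT. Qed.

Lemma nnint_ge0 (mu : {measure set T -> \bar R}) f : (forall x, 0 <= f x) -> 0 <= nnint mu f.
Proof.
by move=> f0; apply: ereal_sup_ubound; exists nnsfun0 => //; exact: sintegral0.
Qed.

(** The negative part only lowers the integral of [f], and a simple function below the positive part
    is below [g]. The inner integrals of [integral_Rn] are compared in this way. *)
Lemma le_integral_majorant (mu : {measure set T -> \bar R}) (f g : T -> \bar R) :
  (forall x, f x <= g x) -> (forall x, 0 <= g x) ->
  \int[mu]_x f x <= \int[mu]_x g x.
Proof.
move=> fg g0; rewrite (ge0_integralTE _ g0) integral_nnint.
have n0 : 0 <= nnint mu (f ^\-) by exact: nnint_ge0.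
apply: (@le_trans _ _ (nnint mu (f ^\+))).
  by rewrite -[leRHS]adde0; apply: leeD2l; rewrite oppe_le0.
apply: le_ereal_sup => _ [h hf <-]; exists h => //= x.
apply: le_trans (hf x) _; by rewrite funeposE ge_max fg g0.
Qed.

Section CompNnsfun.
Variables (s : {nnsfun T >-> R}) (g : T -> T).
Hypothesis mg : measurable_fun [set: T] g.

(* The unused argument keeps [mg] available to the instances declared below. *)
Definition comp_nnsfun_raw (_ : measurable_fun [set: T] g) : T -> R := s \o g.

Lemma comp_nnsfun_measurable : measurable_fun [set: T] (comp_nnsfun_raw mg).
Proof. exact: measurableT_comp. Qed.
HB.instance Definition _ := isMeasurableFun.Build _ _ _ _ (comp_nnsfun_raw mg)
  comp_nnsfun_measurable.

Lemma comp_nnsfun_finite : finite_set (range (comp_nnsfun_raw mg)).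
Proof.
by apply: sub_finite_set (fimfunP s) => _ [x _ <-]; exists (g x).
Qed.
HB.instance Definition _ := FiniteImage.Build _ _ (comp_nnsfun_raw mg) comp_nnsfun_finite.

Lemma comp_nnsfun_ge0 x : (0 <= comp_nnsfun_raw mg x)%R.
Proof. exact: fun_ge0. Qed.
HB.instance Definition _ := isNonNegFun.Build _ _ (comp_nnsfun_raw mg) comp_nnsfun_ge0.

Definition comp_nnsfun : {nnsfun T >-> R} := comp_nnsfun_raw mg.

End CompNnsfun.

(* F is not assumed measurable: the integral is a difference of suprema over
   simple functions, which composition with g and h permutes. *)
Lemma integral_iso (mu : set T -> \bar R) (g h : T -> T) (F : T -> \bar R) :
  measurable_fun [set: T] g -> measurable_fun [set: T] h ->
  cancel g h -> cancel h g ->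
  \int[pushforward mu h]_x F (g x) = \int[mu]_x F x.
Proof.
move=> mg mh gh hg; rewrite !integral_nnint.
have E (f : T -> \bar R) : nnint (pushforward mu h) (f \o g) = nnint mu f.
  have si (s s' : T -> R) : s' = s \o g -> sintegral (pushforward mu h) s' = sintegral mu s.
    move=> ->; apply: eq_fsbigr => x _; congr (_ * mu _).
    by apply/seteqP; split=> y /=; rewrite hg.
  congr ereal_sup; apply/seteqP; split=> _ [s sf <-].
    exists (comp_nnsfun s mh); first by move=> x /=; rewrite -{2}(hg x); exact: sf.
    by apply/esym/si/funext => x /=; rewrite /comp_nnsfun_raw /= gh.
  exists (comp_nnsfun s mg); first by move=> x; exact: sf.
  exact: si.
by rewrite -[fun x => F (g x)]/(F \o g) funepos_comp funeneg_comp !E.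
Qed.

End IntegralGeneralities.

Section Boxes.
Variable R : realType.
Local Open Scope ereal_scope.

Lemma le_integral_Rn m (f g : 'rV[R]_m -> \bar R) :
  (forall v, f v <= g v) -> (forall v, 0 <= g v) ->
  integral_Rn f <= integral_Rn g /\ 0 <= integral_Rn g.
Proof.
elim: m f g => [|m IH] f g fg g0 /=; first by split; [exact: fg | exact: g0].
have H x : integral_Rn (fun v : 'rV[R]_m => f (row_mx (x%:M : 'rV_1) v)) <=
    integral_Rn (fun v : 'rV[R]_m => g (row_mx (x%:M : 'rV_1) v)) /\
    0 <= integral_Rn (fun v : 'rV[R]_m => g (row_mx (x%:M : 'rV_1) v)).
  by apply: IH.
split; last by apply: integral_ge0 => x _; exact: (H x).2.
by apply: le_integral_majorant => x; [exact: (H x).1 | exact: (H x).2].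
Qed.

Definition box m (r : R) : set 'rV[R]_m := [set v | forall i, (`|v 0%R i| <= r)%R].

(** The indicator of the cube factors through the first coordinate, so each integration contributes
    the length [r *+ 2] of one side. The free constant [K] carries the outer factors through the
    induction. *)
Lemma integral_box m (r K : R) : (0 <= r)%R -> (0 <= K)%R ->
  integral_Rn (fun v : 'rV[R]_m => (K * \1_(box r) v)%:E) <= (K * (r *+ 2) ^+ m)%:E.
Proof.
move=> r0; elim: m K => [|m IH] K K0 /=.
  by rewrite lee_fin expr0; apply: ler_wpM2l => //.
have r20 : (0 <= r *+ 2)%R by rewrite mulrn_wge0.
pose c := (K * (r *+ 2) ^+ m)%R.
have c0 : (0 <= c)%R by rewrite mulr_ge0 // exprn_ge0.
have H x : integral_Rn (fun v : 'rV[R]_m =>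
     (K * \1_(box r) (row_mx (x%:M : 'rV_1) v))%:E) <= c%:E * (\1_(`[- r, r]%classic) x)%:E.
  have rE v : box r (row_mx (x%:M : 'rV_1) v) <-> ((`|x| <= r)%R /\ @box m r v).
    split=> [bv|[xr bv] i].
      split=> [|i].
        by have := bv (lshift m (@ord0 0)); rewrite row_mxEl mxE eqxx mulr1n.
      by have := bv (rshift 1 i); rewrite row_mxEr.
    rewrite mxE; case: splitP => j _; last exact: bv.
    by rewrite ord1 mxE eqxx mulr1n.
  have [xr|xr] := boolP (`|x| <= r)%R.
    rewrite indicE mem_set /= ?in_itv /= -?ler_norml // mule1.
    apply: le_trans (IH K K0); apply: (le_integral_Rn _ _).1 => v.
      rewrite lee_fin ler_wpM2l // !indicE.
      have [bv|bv] := boolP (row_mx (x%:M : 'rV_1) v \in box r); last by case: (_ \in _).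
      by rewrite mem_set //; move/set_mem : bv => /rE [].
    by rewrite lee_fin mulr_ge0 // indicE; case: (_ \in _).
  rewrite indicE memNset /= ?in_itv /= -?ler_norml //; last exact/negP.
  rewrite mule0; have -> : (fun v : 'rV[R]_m =>
     (K * \1_(box r) (row_mx (x%:M : 'rV_1) v))%:E) = (fun v => (0 * \1_(box r) v)%:E).
    apply/funext => v; rewrite mul0r indicE memNset ?mulr0 // => /rE [].
    by rewrite (negbTE xr).
  by apply: le_trans (IH 0%R (lexx _)) _; rewrite mul0r.
have g0 x : 0 <= c%:E * (\1_(`[- r, r]%classic) x)%:E.
  by rewrite mule_ge0 // lee_fin // indicE; case: (_ \in _).
apply: (le_trans (@le_integral_majorant _ _ _ (@lebesgue_measure R) _ _ H g0)).
rewrite ge0_integralZl_EFin //.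
  rewrite integral_indic // setIT [X in c%:E * X](lebesgue_measure_itv `[- r, r]%R) /= lte_fin.
  case: ifP => _; last by rewrite mule0 lee_fin mulr_ge0 // exprn_ge0.
  by rewrite -EFinD -EFinM lee_fin opprK -mulr2n /c exprSr mulrA.
exact/measurable_EFinP/measurable_indic.
Qed.

End Boxes.

Lemma compact_finite_cover (T : ptopologicalType) (O : T -> set T) :
  compact [set: T] -> (forall p, \forall q \near p, O p q) ->
  exists s : seq T, forall q, exists2 p, p \in s & O p q.
Proof.
move=> cT nO; rewrite (@compact_cover T) in cT.
have [|D _ Dc] := cT T setT (fun p => (O p)^°) (fun p _ => @open_interior _ _).
  by move=> p _; exists p => //; exact: nO.
exists (finmap.enum_fset D) => q; have [p pD /interior_subset Oq] := Dc q I.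
by exists p.
Qed.

(** * Transport of charts and volume measures along an automorphism *)

Section ChartTransport.
Context {R : realType} {n : nat} {M : charted R n}.
Local Notation C := (Cplx R).
Hypothesis hM : complex_manifold M.
Let aM := complex_manifold_atlas hM.

Lemma holomorphic_chart_at (p : M) : holomorphic_chart (chart_at p).
Proof.
have [tp _] := aM p; split=> // q pq; have [_ dq] := aM q.
by split; exact: transition_smooth.
Qed.

Variables g h : M -> M.
Hypotheses (hg : holomorphic g) (hh : holomorphic h).
Hypotheses (gh : cancel g h) (hgK : cancel h g).

(** With [c] around [p] and this chart around [g p], the map [g] is the identity in coordinates; the
    volume integrals of [pullback g w] and of [w] then run over the same subset of C^n with the same
    integrand. *)
Definition transport_chart (c : chart M 'rV[C]_n) : chart M 'rV[C]_n := {|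
  cdom := h @^-1` cdom c;
  cmap := cmap c \o h;
  cinv := g \o cinv c |}.

Lemma holomorphic_continuous (f : M -> M) : holomorphic f -> continuous f.
Proof. by move=> hf p; have [] := hf p. Qed.

Lemma transport_chart_image (c : chart M 'rV[C]_n) A :
  cmap (transport_chart c) @` (h @^-1` A) = cmap c @` A.
Proof.
apply/seteqP; split=> _ [p Ap <-]; first by exists (h p).
by exists (g p); rewrite /= ?gh.
Qed.

Lemma transport_chart_holomorphic c :
  holomorphic_chart c -> holomorphic_chart (transport_chart c).
Proof.
move=> [tc sc]; have hc := holomorphic_continuous hh; have gc := holomorphic_continuous hg.
have [[oc oi] cK _ _] := tc.
have od : open (h @^-1` cdom c) by apply: open_comp => // x _; exact: hc.
split; first split.
- by split=> //; rewrite transport_chart_image.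
- by move=> p cp /=; rewrite cK // hgK.
- rewrite continuous_open_subspace // => p /set_mem cp.
  by apply: continuous_comp; [exact: hc | exact: (cmap_cvg tc cp)].
- rewrite continuous_open_subspace ?transport_chart_image // => _ /set_mem [p cp <-].
  by apply: continuous_comp; [exact: (cinv_cvg tc cp) | exact: gc].
move=> p /= cp; have [s1 s2] := sc _ cp.
have [tp dp] := aM p; have [th dh] := aM (h p).
split.
  have E : {near cmap c (h p), in_charts g (h p) \o (cmap (chart_at (h p)) \o cinv c)
      =1 cmap (chart_at p) \o (g \o cinv c)}.
    have := through_chart (cmap (chart_at p) \o g) tc th cp dh (@cvg_id _ _).
    by apply: filterS => y e; rewrite /in_charts /= hgK; exact: e.
  apply: smooth_near_eq E _; apply: smooth_near_comp => //.
    exact: finite_frame_mx.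
  rewrite /= (cmapK tc) //; by have [] := hg (h p).
apply: smooth_near_eq (through_in_charts aM aM (cmap c) (hc p)) _.
apply: smooth_near_comp; [exact: finite_frame_mx | by have [] := hh p |].
by rewrite in_chartsE.
Qed.

Lemma coef_pullback (w : form11 M) c p : holomorphic_chart c -> cdom c p ->
  coef (pullback g w) c p = coef w (transport_chart c) (g p).
Proof.
move=> [tc sc] cp; have [s1 s2] := sc _ cp; have [tp dp] := aM p.
have E : {near cmap c p, in_charts g p \o (cmap (chart_at p) \o cinv c)
    =1 cmap (chart_at (g p)) \o (g \o cinv c)}.
  have := through_chart (cmap (chart_at (g p)) \o g) tc tp cp dp (@cvg_id _ _).
  by apply: filterS => y e; exact: e.
have d1 := smooth_near_differentiable s1.
have d2 := holomorphic_differentiable p hg.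
have cpE : (cmap (chart_at p) \o cinv c) (cmap c p) = cmap (chart_at p) p.
  by rewrite /= (cmapK tc).
have d2' : differentiable (in_charts g p) ((cmap (chart_at p) \o cinv c) (cmap c p)).
  by rewrite cpE.
have JE : 'J (cmap (chart_at (g p)) \o (g \o cinv c)) (cmap c p) =
    'J (cmap (chart_at p) \o cinv c) (cmap c p) *m jac g p.
  apply: etrans (esym (jacobian_near_eq (differentiable_comp d1 d2') E)) _.
  by apply: etrans (jacobian_comp d1 d2') _; rewrite cpE.
by rewrite /coef /= gh JE adjmxM /pullback !mulmxA.
Qed.

Local Notation borel := (g_sigma_algebraType (@open M)).

Lemma continuous_borel (f : M -> M) : continuous f ->
  measurable_fun [set: borel] (f : borel -> borel).
Proof.
move=> cf; apply: (@measurability _ _ borel borel setT f (@open M) erefl).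
move=> _ [U oU <-]; rewrite setTI.
by apply: sub_sigma_algebra; exact: (@continuousP M M f).1 cf U oU.
Qed.

Definition push_measure d (T : measurableType d) (mu : {measure set T -> \bar R}) (f : T -> T)
  (mf : measurable_fun [set: T] f) : {measure set T -> \bar R}.
Proof. by refine (pushforward mu f : {measure set T -> \bar R}). Defined.

Lemma push_measureE d (T : measurableType d) (mu : {measure set T -> \bar R}) (f : T -> T)
  (mf : measurable_fun [set: T] f) A : push_measure mu mf A = mu (f @^-1` A).
Proof. by []. Qed.

Let mh := continuous_borel (holomorphic_continuous hh).

Lemma preimage_borel (f : M -> M) (A : set borel) : continuous f ->
  measurable A -> measurable (f @^-1` A : set borel).
Proof.
by move=> cf mA; rewrite -[X in measurable X]setTI; exact: (continuous_borel cf).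
Qed.

Lemma volume_measure_pullback w mu :
  volume_measure w mu -> volume_measure (pullback g w) (push_measure mu mh).
Proof.
move=> wmu c hc A mA Ac; rewrite push_measureE.
rewrite (wmu _ (transport_chart_holomorphic hc)); first last.
- by move=> p /= Ap; exact: Ac.
- exact: preimage_borel (holomorphic_continuous hh) mA.
congr integral_Cn; apply/funext => z; rewrite transport_chart_image.
(* Off the image the inverse chart has arbitrary values, but the indicator vanishes on both
   sides. *)
have [/set_mem [p Ap <-]|nz] := boolP (z \in cmap c @` A).
  have [tc _] := hc; rewrite /= (cmapK tc); last exact: Ac.
  by rewrite (coef_pullback _ hc) //; exact: Ac.
have -> : \1_(cmap c @` A) z = 0 :> R by rewrite indicE (negbTE nz).
exact (f_equal EFin (etrans (mulr0 _) (esym (mulr0 _)))).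
Qed.

End ChartTransport.

Section FiniteCovers.
Context d (T : measurableType d) (R : realType).
Local Open Scope ereal_scope.
Variables (mu : {measure set T -> \bar R}) (I : Type) (O : I -> set T).
Hypothesis mO : forall p, measurable (O p).

(** Each step splits [A] along one member of the cover: the part inside is compared by hypothesis,
    the part outside is covered by the rest of the list. *)
Lemma finite_cover_measure_eq (nu : {measure set T -> \bar R}) (s : seq I) (A : set T) :
  (forall p B, measurable B -> B `<=` O p -> mu B = nu B) ->
  measurable A -> (forall q, A q -> List.Exists (fun p => O p q) s) ->
  mu A = nu A.
Proof.
move=> E; elim: s A => [|p s IH] A mA As.
  have -> : A = set0 by apply/seteqP; split=> // q /As /List.Exists_nil.
  by rewrite !measure0.
rewrite (measureDI mu mA (mO p)) (measureDI nu mA (mO p)); congr (_ + _).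
  apply: IH => [|q [Aq nO]]; first exact: measurableD.
  by have /List.Exists_cons [] := As q Aq.
by apply: (E p); [exact: measurableI | move=> q []].
Qed.

Lemma finite_cover_measure_lty (s : seq I) (A : set T) :
  (forall p, mu (O p) < +oo) ->
  measurable A -> (forall q, A q -> List.Exists (fun p => O p q) s) ->
  mu A < +oo.
Proof.
move=> E; elim: s A => [|p s IH] A mA As.
  have -> : A = set0 by apply/seteqP; split=> // q /As /List.Exists_nil.
  by rewrite !measure0.
rewrite (measureDI mu mA (mO p)) lte_add_pinfty //.
  apply: IH => [|q [Aq nO]]; first exact: measurableD.
  by have /List.Exists_cons [] := As q Aq.
apply: le_lt_trans (E p); apply: le_measure; rewrite ?inE //; exact: measurableI.
Qed.

End FiniteCovers.

(** * Uniqueness, finiteness and invariance of the volume *)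

Section Volume.
Context {R : realType} {n : nat} {M : charted R n}.
Local Notation C := (Cplx R).
Hypotheses (hM : complex_manifold M) (cM : compact [set: M]).
Let aM := complex_manifold_atlas hM.
Local Notation borel := (g_sigma_algebraType (@open M)).

Lemma compact_list_cover (O : M -> set M) :
  (forall p, \forall q \near p, O p q) ->
  exists s : seq M, forall q, List.Exists (fun p => O p q) s.
Proof.
move=> /(compact_finite_cover cM) [s sc]; exists s => q.
have [p ps Oq] := sc q; apply/List.Exists_exists; exists p; split=> //.
elim: s ps {sc} => //= a s IH; rewrite inE => /orP [/eqP -> | /IH]; by [left | right].
Qed.

Lemma open_borel (U : set M) : open U -> measurable (U : set borel).
Proof. exact: sub_sigma_algebra. Qed.

(** [volume_measure] prescribes values only on sets inside one chart; compactness cuts any Borel set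
    into finitely many of these. *)
Lemma volume_measure_unique (w : form11 M) mu nu (A : set borel) :
  volume_measure w mu -> volume_measure w nu -> measurable A -> mu A = nu A.
Proof.
move=> wmu wnu mA.
have [s sc] := compact_list_cover
  (fun p => cdom_near (aM p).1 (aM p).2 : \forall q \near p, cdom (chart_at p) q).
apply: (@finite_cover_measure_eq _ borel _ mu M (fun p => cdom (chart_at p)) _ nu s) => //.
  by move=> p; apply: open_borel; case: (aM p) => [[[]]].
move=> p B mB Bp; have hc := holomorphic_chart_at hM p.
exact: etrans (wmu _ hc _ mB Bp) (esym (wnu _ hc _ mB Bp)).
Qed.

Lemma integral_Cn_box (f : 'rV[C]_n -> R) (r K : R) : 0 <= r -> 0 <= K ->
  (forall z, f z <= K * (\1_(box r) (realify z).1 * \1_(box r) (realify z).2)) ->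
  (integral_Cn (fun z => (f z)%:E) < +oo)%E.
Proof.
move=> r0 K0 fK; rewrite /integral_Cn.
have b0 (v : 'rV[R]_n) : 0 <= \1_(box r) v :> R by rewrite indicE; case: (_ \in _).
have r20 : 0 <= (r *+ 2) ^+ n by rewrite exprn_ge0 // mulrn_wge0.
apply: le_lt_trans (ltry ((K * (r *+ 2) ^+ n) * (r *+ 2) ^+ n)).
apply: le_trans (@integral_box R n r (K * (r *+ 2) ^+ n) r0 _); last exact: mulr_ge0.
apply: (le_integral_Rn _ _).1 => x; last by rewrite lee_fin !mulr_ge0.
have -> : K * (r *+ 2) ^+ n * \1_(box r) x = (K * \1_(box r) x) * (r *+ 2) ^+ n.
  by rewrite mulrAC.
apply: le_trans (@integral_box R n r (K * \1_(box r) x) r0 _); last exact: mulr_ge0.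
apply: (le_integral_Rn _ _).1 => y; last by rewrite lee_fin !mulr_ge0.
by rewrite lee_fin; apply: le_trans (fK _) _; rewrite cplxifyK /= mulrA.
Qed.

Lemma volume_measure_finite (w : form11 M) mu :
  (forall p, exists B : R, \forall q \near p,
     reC (\det (coef w (chart_at p) q)) <= B) ->
  volume_measure w mu -> (mu [set: borel] < +oo)%E.
Proof.
move=> wB wmu.
have [B HB] := choice wB.
pose c (p : M) := chart_at p.
pose nz p : R := reC `|cmap (c p) p| + 1.
(* An open neighbourhood of [p] on which the density is bounded and whose coordinates stay in a
   cube, so that its volume is at most that of a constant on a cube. *)
pose O p := [set q | [/\ cdom (c p) q, reC (\det (coef w (c p) q)) <= B p &
  `|cmap (c p) q| <= cR (nz p)]]^°.
have nO p : \forall q \near p, O p q.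
  rewrite /O; apply: nbhs_interior.
  have [tp dp] := aM p.
  have n1 := cdom_near tp dp.
  have n2 : \forall q \near p, `|cmap (c p) q| <= cR (nz p).
    have nd : \forall q \near p, `|cmap (c p) p - cmap (c p) q| < 1 :> C :=
      @cvgr_dist_lt _ _ _ (nbhs p) _ _ _ (cmap_cvg tp dp) 1 ltr01.
    near=> q.
    have d : `|cmap (c p) p - cmap (c p) q| < 1 :> C by near: q; exact: nd.
    have -> : cR (nz p) = `|cmap (c p) p| + 1.
      exact: etrans (cRD _ _) (f_equal2 +%R (cR_reC (normr_ge0 _)) (cR1 R)).
    rewrite -lerBlDl; apply: le_trans (ltW d).
    by rewrite distrC; apply: lerB_dist.
  have n3 := HB p.
  near=> q; split; near: q; [exact: n1 | exact: n3 | exact: n2].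
have [s sc] := compact_list_cover nO.
apply: (@finite_cover_measure_lty _ borel _ mu M O _ s) => //.
  by move=> p; apply: open_borel; exact: open_interior.
move=> p; have [tp dp] := aM p.
have Op : O p `<=` cdom (c p) by move=> q /interior_subset [].
rewrite (wmu _ (holomorphic_chart_at hM p) _ _ Op); last first.
  by apply: open_borel; exact: open_interior.
have nz0 : 0 <= nz p.
  by rewrite addr_ge0 // -ler_cR cR_reC ?cR0 // normr_ge0.
(* The power of 2 comes from the volume density. Nothing is known about the sign of [B p], hence the
   maximum with 0. *)
pose K := 2 ^+ n * Num.max (B p) 0.
have K0 : 0 <= K by rewrite mulr_ge0 ?exprn_ge0 // le_max lexx orbT.
apply: (@integral_Cn_box _ (nz p) K) => // z.
have b0 (v : 'rV[R]_n) : 0 <= \1_(box (nz p)) v :> R.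
  by rewrite indicE; case: (_ \in _).
have [/set_mem [q Oq <-]|nzz] := boolP (z \in cmap (chart_at p) @` O p); last first.
  have -> : \1_(cmap (chart_at p) @` O p) z = 0 :> R by rewrite indicE (negbTE nzz).
  by apply: le_trans (mulr_ge0 K0 (mulr_ge0 (b0 _) (b0 _))); rewrite le_eqVlt mulr0 eqxx.
have [_ detq nq] := interior_subset Oq.
have en (i : 'I_n) : `|cmap (c p) q 0 i| <= cR (nz p).
  exact: le_trans (mx_norm_ge _ _ _) nq.
rewrite !indicE !mem_set ?mulr1; last 3 first.
- by move=> i; rewrite mxE -ler_cR; apply: le_trans (norm_imC _) (en i).
- by move=> i; rewrite mxE -ler_cR; apply: le_trans (norm_reC _) (en i).
- by exists q.
apply: ler_wpM2l; first exact: exprn_ge0.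
by rewrite (cmapK tp) ?le_max; [rewrite detq | exact: Op].
Unshelve. all: by end_near. Qed.

Lemma vol_finite (w : form11 M) :
  (forall p, exists B : R, \forall q \near p,
     reC (\det (coef w (chart_at p) q)) <= B) ->
  (vol w [set: borel] < +oo)%E.
Proof.
move=> wB; rewrite /vol; case: pselect => [e|_]; last by rewrite /mzero ltry.
exact: volume_measure_finite wB (projT2 (cid e)).
Qed.

Variables g h : M -> M.
Hypotheses (hg : holomorphic g) (hh : holomorphic h).
Hypotheses (gh : cancel g h) (hgK : cancel h g).

Lemma vol_spec (w : form11 M) :
  (exists mu, volume_measure w mu) -> volume_measure w (vol w).
Proof. by rewrite /vol; case: pselect => [e _|//]; exact: projT2 (cid e). Qed.

Lemma vol_default (w : form11 M) (A : set borel) :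
  ~ (exists mu, volume_measure w mu) -> vol w A = 0%E.
Proof. by rewrite /vol; case: pselect. Qed.

Lemma vol_pullback (w : form11 M) (A : set borel) : measurable A ->
  vol (pullback g w) A = vol w (h @^-1` A).
Proof.
move=> mA; have [e'|ne'] := pselect (exists mu, volume_measure w mu).
  have v := volume_measure_pullback hM hg hh gh hgK (vol_spec e').
  by have := volume_measure_unique (vol_spec (ex_intro _ _ v)) v mA.
(* When [w] has no volume measure, neither has its pullback, since pulling back once more by [h]
   would give one for [w]. Both volumes are then the zero measure. *)
apply: etrans (vol_default A _) (esym (vol_default _ ne')) => -[mu wmu].
apply: ne'; have E := pullback_cancel aM w hh hg hgK.
apply: (eq_ind _ (fun w' => exists nu, volume_measure w' nu) _ _ E).
by eexists; exact: (volume_measure_pullback hM hh hg hgK gh wmu).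
Qed.

Lemma integralM_pullback (w : form11 M) (F : M -> R) :
  integralM (pullback g w) (F \o g) = integralM w F.
Proof.
have mh := continuous_borel (holomorphic_continuous hh).
have mg := continuous_borel (holomorphic_continuous hg).
rewrite /integralM /Rintegral; apply: (f_equal fine).
apply: etrans (@eq_measure_integral _ borel R setT (push_measure (vol w) mh) _ _ _) _.
  by move=> A mA _; exact: vol_pullback.
exact: (@integral_iso _ _ _ (vol w) g h (fun x => (F x)%:E) mg mh gh hgK).
Qed.

End Volume.

(** * The quotient manifold SU \ SL *)

Lemma mulmxr_continuous (K : numFieldType) m n p (Q : 'M[K]_(n, p)) :
  continuous (mulmxr Q : 'M[K]_(m, n) -> 'M[K]_(m, p)).
Proof.
move=> A.
have -> : (mulmxr Q : 'M[K]_(m, n) -> 'M[K]_(m, p)) =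
    fun B => \sum_i \sum_j mx_coord i j B *: (delta_mx i j *m Q).
  apply/funext => B; rewrite /= {1}[B]matrix_sum_delta mulmx_suml.
  apply: eq_bigr => i _; rewrite mulmx_suml; apply: eq_bigr => j _.
  by rewrite -scalemxAl.
apply: smooth_near_continuous; apply: smooth_near_sum => i.
apply: smooth_near_sum => j; apply: smooth_near_scale; last exact: smooth_near_cst.
by apply: smooth_near_linear; exact: mx_coord_continuous.
Qed.

Section Homogeneous.
Context {R : realType} (N : nat).
Local Notation C := (Cplx R).
Local Notation SL := (@SLn R N).
Local Notation coset := (@coset_SU R N).
Local Notation RM := ('M[R]_N.+1 * 'M[R]_N.+1)%type.

Definition rmulr (Q : 'M[C]_N.+1) : RM -> RM :=
  rlinear (mulmxr Q : {linear 'M[C]_(N.+1, N.+1) -> 'M[C]_(N.+1, N.+1)}).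

Lemma rmulrE Q A : rmulr Q (realify A) = realify (A *m Q).
Proof. by rewrite /rmulr /rlinear realifyK. Qed.

Lemma smooth_near_rmulr (V : normedModType R) (x : V) (f : V -> RM) Q :
  smooth_near x f -> smooth_near x (rmulr Q \o f).
Proof.
move=> sf; apply: smooth_near_linear_comp sf.
by apply: rlinear_continuous; exact: mulmxr_continuous.
Qed.

Lemma rmulr_continuous Q : continuous (rmulr Q).
Proof. by apply: rlinear_continuous; exact: mulmxr_continuous. Qed.

Lemma SL_mul A B : SL A -> SL B -> SL (A *m B).
Proof. by rewrite /SLn /= det_mulmx => -> ->; rewrite mulr1. Qed.

Lemma SL_unit A : SL A -> A \in unitmx.
Proof. by rewrite /SLn /= unitmxE => ->; rewrite unitr1. Qed.

Lemma SL_inv A : SL A -> SL (invmx A).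
Proof. by rewrite /SLn /= det_inv => ->; rewrite invr1. Qed.

Lemma open_in_SL_mulr (W : set 'M[C]_N.+1) Q : SL Q -> open_in_SL W ->
  open_in_SL [set A | W (A *m Q)].
Proof.
move=> SQ [U oU WU]; exists (mulmxr Q @^-1` U).
  by apply: open_comp => // A _; exact: mulmxr_continuous.
by move=> A SA; apply: WU; exact: SL_mul.
Qed.

Lemma open_in_SL_ext (W W' : set 'M[C]_N.+1) :
  (forall A, SL A -> (W A <-> W' A)) -> open_in_SL W -> open_in_SL W'.
Proof. by move=> E [U oU WU]; exists U => // A SA; rewrite -E ?WU. Qed.

Definition mulset (Q : 'M[C]_N.+1) (X : set 'M[C]_N.+1) := mulmxr Q @` X.

Lemma mulset_coset Q A : mulset Q (coset A) = coset (A *m Q).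
Proof.
apply/seteqP; split=> [_ [_ [U SU <-] <-]|_ [U SU <-]].
  by exists U => //=; rewrite mulmxA.
by exists (U *m A) => /=; [exists U | rewrite mulmxA].
Qed.

Lemma mulsetK P Q X : P *m Q = 1%:M -> mulset Q (mulset P X) = X.
Proof.
move=> PQ; apply/seteqP; split=> [_ [_ [A XA <-] <-]|A XA].
  by rewrite /= -mulmxA PQ mulmx1.
by exists (A *m P); [exists A | rewrite /= -mulmxA PQ mulmx1].
Qed.

Definition mulr_chart Q (h : chart (set 'M[C]_N.+1) 'rV[R]_(homdim N)) := {|
  cdom := [set X | cdom h (mulset (invmx Q) X)];
  cmap := fun X => cmap h (mulset (invmx Q) X);
  cinv := fun y => mulset Q (cinv h y) |}.

Lemma mulr_chart_homogeneous Q h : SL Q -> homogeneous_chart h ->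
  homogeneous_chart (mulr_chart Q h).
Proof.
move=> SQ [[hc ho] hK oh sh lh].
have QV : Q *m invmx Q = 1%:M by rewrite mulmxV // SL_unit.
have VQ : invmx Q *m Q = 1%:M by rewrite mulVmx // SL_unit.
have imE : cmap (mulr_chart Q h) @` cdom (mulr_chart Q h) = cmap h @` cdom h.
  apply/seteqP; split=> _ [X hX <-]; first by exists (mulset (invmx Q) X).
  by exists (mulset Q X); rewrite /= mulsetK.
split.
- split=> [X /= /hc [A SA AX]|].
    by exists (A *m Q); [exact: SL_mul | rewrite -mulset_coset AX mulsetK].
  apply: open_in_SL_ext (open_in_SL_mulr (SL_inv SQ) ho) => A SA /=.
  by rewrite mulset_coset.
- by move=> X /= hX; rewrite hK // mulsetK.
- by rewrite imE.
- move=> A SA /=; rewrite mulset_coset => hA.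
  have [D [G [[oD DA] sG GE]]] := sh _ (SL_mul SA (SL_inv SQ)) hA.
  exists (rmulr (invmx Q) @^-1` D), (G \o rmulr (invmx Q)); split.
  + split; last by rewrite /= rmulrE.
    by apply: open_comp => // X _; exact: rmulr_continuous.
  + apply: smooth_on_near => X /= DX; apply: smooth_near_comp.
    * exact: finite_frame_pair (finite_frame_mx _ _ _) (finite_frame_mx _ _ _).
    * rewrite /rmulr; apply: smooth_near_linear; apply: rlinear_continuous.
      exact: mulmxr_continuous.
    * exact: smooth_near_on sG DX.
  + move=> B SB /=; rewrite mulset_coset rmulrE => hB DB.
    by rewrite GE //; exact: SL_mul (SL_inv SQ).
- rewrite imE => y /lh [s ss sE]; exists (fun z => s z *m Q).
    have -> : @realify R _ _ \o (fun z => s z *m Q) = rmulr Q \o (@realify R _ _ \o s).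
      by apply/funext => z /=; rewrite rmulrE.
    exact: smooth_near_rmulr.
  apply: filterS sE => z [Sz dz mz].
  by split; rewrite /= ?mulset_coset -?mulmxA ?QV ?mulmx1 //; exact: SL_mul.
Qed.

End Homogeneous.

Section OrbitManifold.
Context {R : realType} (N : nat).
Local Notation C := (Cplx R).
Local Notation SL := (@SLn R N).
Local Notation coset := (@coset_SU R N).

(** [bergman_manifold] with the parametrization and the dimension set free. The projective
    dimensions for L and for its pullback are equal only propositionally, so a common variable [N]
    is needed to compare the two manifolds. *)
Definition orbit_manifold T (pts : set T) (omega : 'M[C]_N.+1 -> T) : smooth_manifold R T := {|
  points := pts;
  opens := [set W | W `<=` pts /\ open_in_SL (omega @^-1` W)];
  sdim := homdim N;
  charts := [set c | [/\ cdom c `<=` pts,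
    (forall w, cdom c w -> cinv c (cmap c w) = w) &
    exists2 h, homogeneous_chart h &
      forall A, SL A ->
        (cdom c (omega A) <-> cdom h (coset A)) /\
        (cdom c (omega A) -> cmap c (omega A) = cmap h (coset A))]] |}.

Variables (T T' : Type) (pts : set T) (pts' : set T').
Variables (omega : 'M[C]_N.+1 -> T) (omega' : 'M[C]_N.+1 -> T').
Hypotheses (ptsE : pts = omega @` SL) (ptsE' : pts' = omega' @` SL).
Variables (f : T -> T') (Q : 'M[C]_N.+1).
Hypotheses (SQ : SL Q) (fE : forall A, SL A -> f (omega A) = omega' (A *m Q)).

(** In charts the map is z |-> [s z * Q], with [s] a smooth local section of the projection from SL
    to the quotient. The target coordinate is smooth on SL through a local extension [G] to all
    matrices, so the map is [G] after a linear map after [s]. *)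
Lemma orbit_smooth_map :
  smooth_map (orbit_manifold pts omega) (orbit_manifold pts' omega') f.
Proof.
split.
- move=> p /=; rewrite ptsE ptsE' => -[A SA <-].
  by exists (A *m Q); [exact: SL_mul | rewrite fE].
- move=> V /= [Vp oV]; split; first by move=> p [].
  apply: open_in_SL_ext (open_in_SL_mulr SQ oV) => A SA /=; rewrite fE //.
  by split=> [VA|[]//]; split=> //; rewrite ptsE; exists A.
move=> c c' [cp cK [h hh ch]] [_ _ [h' hh' ch']].
apply: smooth_on_near => _ [w [cw c'w] <-].
have := cp w cw; rewrite ptsE => -[A SA Aw].
have [chA mhA] := ch A SA; rewrite Aw in chA mhA.
have hA := chA.1 cw.
have [_ _ _ _ lh] := hh.
have [|s ss sE] := lh (cmap c w); first by rewrite mhA //; exists (coset A).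
have sK : \forall z \near cmap c w, [/\ SL (s z), cdom c (omega (s z)) & cinv c z = omega (s z)].
  apply: filterS sE => z [Sz hz mz]; have [cz mz'] := ch _ Sz.
  have cz' := cz.2 hz; split=> //.
  by rewrite -[in LHS]mz -mz' // cK.
have [Sy _ yE] := nbhs_singleton sK; rewrite cK // in yE.
have [[_ [W oW WE]] _ _ sh' _] := hh'.
have SyQ := SL_mul Sy SQ.
have h'y : cdom h' (coset (s (cmap c w) *m Q)).
  by apply/(ch' _ SyQ).1; rewrite -fE // -yE.
have [D [G [[oD Dy] sG GE]]] := sh' _ SyQ h'y.
have sQ : smooth_near (cmap c w) (rmulr Q \o (@realify R _ _ \o s)).
  exact: smooth_near_rmulr.
have sQE z : (rmulr Q \o (@realify R _ _ \o s)) z = realify (s z *m Q) by rewrite /= rmulrE.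
have cQ := smooth_near_continuous sQ.
have nO : \forall z \near cmap c w, D (realify (s z *m Q)).
  have : \forall z \near cmap c w, D ((rmulr Q \o (@realify R _ _ \o s)) z).
    by apply: cQ; rewrite sQE; exact: open_nbhs_nbhs.
  by apply: filterS => z; rewrite sQE.
have nW : \forall z \near cmap c w, W (s z *m Q).
  have cs : {for cmap c w, continuous (@cplxify R _ _ \o (rmulr Q \o (@realify R _ _ \o s)))}.
    by apply: continuous_comp => //; exact: cplxify_continuous.
  have : \forall z \near cmap c w,
      W ((@cplxify R _ _ \o (rmulr Q \o (@realify R _ _ \o s))) z).
    apply: cs; apply: open_nbhs_nbhs; split=> //.
    by rewrite [X in W X]/= rmulrE realifyK; apply/(WE _ SyQ).
  by apply: filterS => z; rewrite [X in W X]/= rmulrE realifyK.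
apply: (@smooth_near_eq _ _ _ _ (G \o (rmulr Q \o (@realify R _ _ \o s)))).
  near=> z.
  have [Sz cz zE] : [/\ SL (s z), cdom c (omega (s z)) & cinv c z = omega (s z)].
    by near: z; exact: sK.
  have Oz : D (realify (s z *m Q)) by near: z; exact: nO.
  have Wz : W (s z *m Q) by near: z; exact: nW.
  have SzQ := SL_mul Sz SQ.
  have h'z : cdom h' (coset (s z *m Q)) by apply/(WE _ SzQ).
  have [c'z mc'z] := ch' _ SzQ.
  rewrite [LHS]/= -/(rmulr Q (realify (s z))) rmulrE GE // [RHS]/= zE fE //.
  by rewrite mc'z //; exact: c'z.2.
apply: smooth_near_comp sQ _.
  exact: finite_frame_pair (finite_frame_mx _ _ _) (finite_frame_mx _ _ _).
by rewrite sQE; exact: smooth_near_on sG Dy.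
Unshelve. all: by end_near. Qed.

Variable f' : T' -> T.
Hypotheses (ff' : cancel f f') (f'f : cancel f' f).

Lemma orbit_smooth_curve c :
  smooth_curve (orbit_manifold pts omega) c ->
  smooth_curve (orbit_manifold pts' omega') (f \o c).
Proof.
move=> [d [[dp dK [h hh dh]] dc sc]].
have f'E A : SL A -> f' (omega' A) = omega (A *m invmx Q).
  move=> SA; rewrite -[RHS]ff' fE; last exact: SL_mul (SL_inv SQ).
  by rewrite -mulmxA mulVmx ?mulmx1 // SL_unit.
(* The chart [d] carried along [f]. As [f'] multiplies by the inverse of [Q], it corresponds to
   [mulr_chart Q h] on cosets. *)
exists {| cdom := f' @^-1` cdom d; cmap := cmap d \o f'; cinv := f \o cinv d |}.
split.
- split=> [w /= /dp|w dw /=|]; last first.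
  + exists (mulr_chart Q h); first exact: mulr_chart_homogeneous.
    move=> A SA /=; rewrite mulset_coset f'E //.
    by apply: dh; exact: SL_mul (SL_inv SQ).
  + by rewrite dK // f'f.
  + rewrite ptsE ptsE' => -[A SA Aw]; exists (A *m Q); first exact: SL_mul.
    by rewrite -fE // Aw f'f.
- by apply: filterS dc => t /=; rewrite ff'.
- by apply: smooth_near_eq sc; apply: filterS dc => t _ /=; rewrite ff'.
Qed.

End OrbitManifold.

(** * Bases of sections *)

Section Bases.
Context {R : realType} {n : nat} {M : charted R n}.
Local Notation C := (Cplx R).
Variable P : line_bundle M.

Lemma H0_comb m (a : 'I_m -> C) (S : 'I_m -> M -> C) :
  (forall i, H0 P (S i)) -> H0 P (fun x => \sum_i a i * S i x).
Proof.
move=> hS i p ip.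
have -> : (fun x => btrans i (btriv P x) x * (\sum_j a j * S j x)) \o cinv (chart_at p) =
    fun y => \sum_j a j *: ((fun x => btrans i (btriv P x) x * S j x) \o cinv (chart_at p)) y.
  apply/funext => y /=; rewrite mulr_sumr; apply: eq_bigr => j _.
  by rewrite mulrCA.
apply: smooth_near_sum => j; apply: smooth_near_scale; first exact: smooth_near_cst.
exact: hS.
Qed.

Variable N : nat.
Implicit Types (S T : 'I_N.+1 -> M -> C) (A B : 'M[C]_N.+1).

Lemma act_basisM A B S : act_basis A (act_basis B S) = act_basis (A *m B) S.
Proof.
apply/funext => i; apply/funext => x; rewrite /act_basis.
transitivity (\sum_j \sum_l A i j * B j l * S l x).
  by apply: eq_bigr => j _; rewrite mulr_sumr; apply: eq_bigr => l _; rewrite mulrA.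
rewrite exchange_big; apply: eq_bigr => l _.
by rewrite mxE mulr_suml.
Qed.

Lemma act_basis1 S : act_basis 1%:M S = S.
Proof.
apply/funext => i; apply/funext => x; rewrite /act_basis (bigD1 i) //= big1 => [|j /negbTE ji].
  by rewrite mxE eqxx mul1r addr0.
by rewrite mxE eq_sym ji mul0r.
Qed.

Lemma act_basis_inj A B S : is_basis P S -> act_basis A S = act_basis B S -> A = B.
Proof.
move=> [hS uS] AB; apply/row_matrixP => i.
have [a [_ ua]] := uS _ (H0_comb (A i) hS).
have E D : act_basis A S i = act_basis D S i -> a = row i D.
  move=> AD; apply: ua; apply: etrans AD _; apply/funext => x.
  by apply: eq_bigr => j _; rewrite mxE.
by rewrite -(E A) // -(E B) // AB.
Qed.

Lemma basis_expand S T : is_basis P S -> (forall i, H0 P (T i)) ->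
  exists A, T = act_basis A S.
Proof.
move=> [_ uS] hT.
have /choice [a aE] : forall i, exists a : 'rV[C]_N.+1, T i = fun x => \sum_j a 0 j * S j x.
  by move=> i; have [a [aE _]] := uS _ (hT i); exists a.
exists (\matrix_(i, j) a i 0 j); apply/funext => i.
rewrite aE; apply/funext => x.
by apply: eq_bigr => j _; rewrite mxE.
Qed.

Lemma basis_change S T : is_basis P S -> is_basis P T ->
  exists2 A, A \in unitmx & T = act_basis A S.
Proof.
move=> bS bT; have [A TE] := basis_expand bS bT.1; have [B SE] := basis_expand bT bS.1.
exists A => //; have : B *m A = 1%:M.
  by apply: act_basis_inj bS _; rewrite act_basis1 -act_basisM -TE.
by move/mulmx1_unit => [].
Qed.

Lemma act_basis_basis A S : A \in unitmx -> is_basis P S -> is_basis P (act_basis A S).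
Proof.
move=> Au [hS uS]; split=> [i|s hs]; first exact: H0_comb.
have combE (b : 'rV[C]_N.+1) : (fun x => \sum_i b 0 i * act_basis A S i x) =
    (fun x => \sum_i (b *m A) 0 i * S i x).
  apply/funext => x.
  transitivity (\sum_i \sum_j b 0 i * A i j * S j x).
    by apply: eq_bigr => i _; rewrite mulr_sumr; apply: eq_bigr => j _; rewrite mulrA.
  rewrite exchange_big; apply: eq_bigr => j _.
  by rewrite mxE mulr_suml.
have [a [sE ua]] := uS s hs; exists (a *m invmx A); split.
  by rewrite combE mulmxKV.
by move=> b; rewrite combE => /ua ->; rewrite mulmxK.
Qed.

Lemma bergman_form_scale k c A S : c != 0 ->
  bergman_form k (act_basis (c *: A) S) = bergman_form k (act_basis A S).
Proof.
move=> c0; rewrite /bergman_form; have -> // : kodaira_map (act_basis (c *: A) S) =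
  kodaira_map (act_basis A S).
apply/funext => x; rewrite /kodaira_map -[RHS](hclassZ _ c0); congr hclass.
apply/rowP => i; rewrite !mxE /act_basis mulr_sumr; apply: eq_bigr => j _.
by rewrite mxE mulrA.
Qed.

(** Scaling by [c] multiplies the determinant by its power [N.+1], and C contains a root of that
    order. *)
Lemma unit_SL_scale A : A \in unitmx -> exists2 c : C, c != 0 & SLn (c *: A).
Proof.
rewrite unitmxE unitfE => dA; pose c : C := N.+1.-root (\det A)^-1.
have cE : c ^+ N.+1 = (\det A)^-1 by rewrite rootCK.
exists c; last by rewrite /SLn /= detZ cE mulVf.
by apply/eqP => c0; move: cE; rewrite c0 expr0n /= => /esym/eqP; rewrite invr_eq0 (negbTE dA).
Qed.

Definition bergman_points k : set (form11 M) :=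
  [set w | exists T : 'I_N.+1 -> M -> C, is_basis P T /\ w = bergman_form k T].

Lemma bergman_points_SL k S : is_basis P S ->
  bergman_points k = (fun A => bergman_form k (act_basis A S)) @` @SLn R N.
Proof.
move=> bS; apply/seteqP; split=> [w [T [bT ->]]|_ [A SA <-]].
  have [A Au ->] := basis_change bS bT; have [c c0 Sc] := unit_SL_scale Au.
  by exists (c *: A); [exact: Sc | exact: bergman_form_scale].
by exists (act_basis A S); split=> //; apply: act_basis_basis => //; exact: SL_unit.
Qed.

End Bases.

(** * Sections of the pulled-back bundle *)

Section PullbackBases.
Context {R : realType} {n : nat} {M : charted R n}.
Local Notation C := (Cplx R).
Hypothesis aM : atlas M.
Variables (g h : M -> M).
Hypotheses (hg : holomorphic g) (hh : holomorphic h).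
Hypotheses (gh : cancel g h) (hgK : cancel h g).

(** The preferred trivialization of the pulled-back bundle at [x] is that of [P] at [g x], so the
    components of [s \o g] are those of [s] composed with [g]. *)
Lemma H0_pullback (P : line_bundle M) s : H0 P s <-> H0 (pullback_bundle g P) (s \o g).
Proof.
split=> hs i; first exact: (holomorphic_fun_on_comp aM aM hg (hs i)).
have := holomorphic_fun_on_comp aM aM hh (hs i).
have -> : h @^-1` (bdom (l := pullback_bundle g P) i) = bdom (l := P) i.
  by apply/seteqP; split=> p /=; rewrite hgK.
congr holomorphic_fun_on; apply/funext => p.
by rewrite /= hgK.
Qed.

Lemma is_basis_comp (P : line_bundle M) m (S : 'I_m -> M -> C) :
  is_basis P S -> is_basis (pullback_bundle g P) (fun i => S i \o g).
Proof.
move=> [hS uS]; split=> [i|s]; first exact: (@H0_pullback P (S i)).1 (hS i).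
have sE : s = (s \o h) \o g by apply/funext => x /=; rewrite gh.
rewrite {1}sE => Hs; have [a [ae ua]] := uS _ ((@H0_pullback P (s \o h)).2 Hs); exists a; split.
  by rewrite {1}sE ae.
move=> b sb; apply: ua; rewrite sb; apply/funext => x /=.
by apply: eq_bigr => i _; rewrite /= hgK.
Qed.

Lemma is_basis_comp_inv (P : line_bundle M) m (S : 'I_m -> M -> C) :
  is_basis (pullback_bundle g P) S -> is_basis P (fun i => S i \o h).
Proof.
move=> [hS uS]; have SE i : S i = (S i \o h) \o g by apply/funext => x /=; rewrite gh.
split=> [i|s]; first by apply/H0_pullback; rewrite -SE.
move=> Hs; have [a [ae ua]] := uS _ ((@H0_pullback P s).1 Hs); exists a; split.
  by apply/funext => x; move: (f_equal (@^~ (h x)) ae); rewrite /= hgK.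
move=> b sb; apply: ua; rewrite sb; apply/funext => x /=.
by apply: eq_bigr => i _; rewrite /= gh.
Qed.

(** [dimH0] selects an element of the set of sizes of bases; the two sets coincide, hence so do the
    selected elements. *)
Lemma dimH0_pullback (P : line_bundle M) : dimH0 (pullback_bundle g P) = dimH0 P.
Proof.
congr (xget 0%N); apply/seteqP; split=> m [S bS].
  by exists (fun i => S i \o h); exact: is_basis_comp_inv.
by exists (fun i => S i \o g); exact: is_basis_comp.
Qed.

End PullbackBases.

(** * The Calabi and Mabuchi metrics *)

Lemma mxtrace_congruence (K : comUnitRingType) n (J A w v : 'M[K]_n) :
  J \in unitmx -> A \in unitmx -> w \in unitmx ->
  \tr (invmx (J *m w *m A) *m (J *m v *m A)) = \tr (invmx w *m v).
Proof.
move=> Ju Au wu.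
have Xu : J *m w *m A \in unitmx by rewrite !unitmx_mul Ju wu Au.
have -> : invmx (J *m w *m A) = invmx A *m invmx w *m invmx J.
  apply: (can_inj (mulKmx Xu)); rewrite mulmxV //.
  by rewrite !mulmxA mulmxK // mulmxK // mulmxV.
by rewrite -!mulmxA mxtrace_mulC -!mulmxA mulKmx // mulmxV // mulmx1.
Qed.

Section MetricTransport.
Context {R : realType} {n : nat} {M : charted R n}.
Local Notation C := (Cplx R).
Hypotheses (hM : complex_manifold M) (cM : compact [set: M]).
Let aM := complex_manifold_atlas hM.
Local Notation borel := (g_sigma_algebraType (@open M)).
Variable w : form11 M.
Hypothesis wfin : (vol w [set: borel] < +oo)%E.

Lemma continuous_integrable (f : M -> R) : continuous f ->
  (vol w).-integrable [set: borel] (EFin \o f).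
Proof.
move=> cf; apply: measurable_bounded_integrable => //.
  apply: (@measurability _ _ borel _ setT f _ (RGenOInfty.measurableE R)) => _ [_ [x ->] <-].
  rewrite setTI; apply: sub_sigma_algebra.
  by apply: (@continuousP M R f).1 => //; exact: interval_open.
have [K [Kr H]] := compact_bounded (continuous_compact (continuous_subspaceT cf) cM).
by exists K; split=> // r Kltr x _; apply: (H r Kltr); exists x.
Qed.

Lemma integralM_null (F : M -> R) : vol w [set: borel] = 0%E -> integralM w F = 0.
Proof.
move=> v0.
have E : (\int[vol w]_(x in [set: borel]) (F x)%:E = 0)%E; last exact: (f_equal fine E).
apply: etrans (@eq_measure_integral _ borel R setT mzero _ _ _) (integral_measure_zero _ _).
move=> A mA _; apply/eqP; rewrite /mzero -measure_le0 -[leRHS]v0.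
by apply: le_measure; rewrite ?inE.
Qed.

Lemma mean_add_cst (phi : M -> R) c : continuous phi -> vol w [set: borel] != 0%E ->
  mean w (fun q => phi q + c) = mean w phi + c.
Proof.
move=> cphi v0; rewrite /mean /integralM RintegralD //.
- rewrite Rintegral_cst // mulrDr mulrCA mulVf ?mulr1 //.
  by rewrite fine_eq0 // fin_numE gt_eqF ?lt_eqF // (lt_le_trans _ (measure_ge0 _ _)).
- exact: continuous_integrable.
- by apply: continuous_integrable; exact: cst_continuous.
Qed.

Lemma mabuchi_add_cst (phi1 phi2 : M -> R) c1 c2 :
  continuous phi1 -> continuous phi2 ->
  mabuchi w (fun q => phi1 q + c1) (fun q => phi2 q + c2) = mabuchi w phi1 phi2.
Proof.
move=> s1 s2; rewrite /mabuchi.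
(* With zero volume the mean is 0 and does not follow the added constant, but then every integral
   vanishes. This includes the fallback value of [vol]. *)
have [v0|v0] := eqVneq (vol w [set: borel]) 0%E; first by rewrite !integralM_null.
congr integralM; apply/funext => q; rewrite !mean_add_cst //; congr (_ * _); ring.
Qed.

Variables g h : M -> M.
Hypotheses (hg : holomorphic g) (hh : holomorphic h).
Hypotheses (gh : cancel g h) (hgK : cancel h g).

Lemma mean_pullback (F : M -> R) : mean (pullback g w) (F \o g) = mean w F.
Proof.
have v := vol_pullback hM cM hg hh gh hgK w (@measurableT _ borel).
exact (f_equal2 (fun a b => (fine a)^-1 * b) v (integralM_pullback hM cM hg hh gh hgK w F)).
Qed.

Lemma mabuchi_pullback (F1 F2 : M -> R) :
  mabuchi (pullback g w) (F1 \o g) (F2 \o g) = mabuchi w F1 F2.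
Proof.
apply: etrans (f_equal2 (fun a b => integralM (pullback g w)
  (fun p => (F1 (g p) - a) * (F2 (g p) - b))) (mean_pullback F1) (mean_pullback F2)) _.
exact: (integralM_pullback hM cM hg hh gh hgK w
  (fun p => (F1 p - mean w F1) * (F2 p - mean w F2))).
Qed.

Lemma laplacian_pullback (phi psi : M -> R) p : w (g p) \in unitmx ->
  iddbar psi = pullback g (iddbar phi) ->
  laplacian (pullback g w) psi p = laplacian w phi (g p).
Proof.
move=> wu psiE.
have JK := jac_inverse aM p hg hh gh.
have [Ju _] : jac g p \in unitmx /\ jac h (g p) \in unitmx by exact: mulmx1_unit JK.
have Jau : adjmx (jac g p) \in unitmx.
  have : adjmx (jac h (g p)) *m adjmx (jac g p) = 1%:M by rewrite -adjmxM JK adjmx1.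
  by move/mulmx1_unit => [].
rewrite /laplacian psiE; apply: (f_equal (@reC R)).
exact: mxtrace_congruence.
Qed.

Lemma calabi_pullback (phi1 phi2 psi1 psi2 : M -> R) :
  (forall p, w p \in unitmx) ->
  iddbar psi1 = pullback g (iddbar phi1) -> iddbar psi2 = pullback g (iddbar phi2) ->
  calabi (pullback g w) psi1 psi2 = calabi w phi1 phi2.
Proof.
move=> wu e1 e2.
have E : (fun p => laplacian (pullback g w) psi1 p * laplacian (pullback g w) psi2 p) =
    (fun p => laplacian w phi1 p * laplacian w phi2 p) \o g.
  by apply/funext => p; exact (f_equal2 *%R (laplacian_pullback (wu _) e1)
    (laplacian_pullback (wu _) e2)).
apply: etrans (f_equal (integralM (pullback g w)) E) _.
exact: (integralM_pullback hM cM hg hh gh hgK).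
Qed.

End MetricTransport.

(** * Velocities of curves of forms *)

Section Velocity.
Context {R : realType} {n : nat} {M : charted R n}.
Local Notation C := (Cplx R).

Definition cderiv (f : R -> C) (v : C) :=
  is_derive (0 : R) (1 : R) (fun t => reC (f t)) (reC v) /\
  is_derive (0 : R) (1 : R) (fun t => imC (f t)) (imC v).

Lemma cderiv_mulr f v (c : C) : cderiv f v -> cderiv (fun t => f t * c) (v * c).
Proof.
move=> [d1 d2]; split.
  rewrite reCM (_ : (fun t => _) = fun t => reC (f t) * reC c - imC (f t) * imC c).
    have e1 := is_deriveM d1 (is_derive_cst (reC c) (0 : R) (1 : R)).
    have e2 := is_deriveM d2 (is_derive_cst (imC c) (0 : R) (1 : R)).
    apply: is_derive_eq (is_deriveB e1 e2) _.
    by rewrite !scaler0 !add0r /= ![_ *: _]mulrC.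
  by apply/funext => t; exact: reCM.
rewrite imCM (_ : (fun t => _) = fun t => reC (f t) * imC c + imC (f t) * reC c).
  have e1 := is_deriveM d1 (is_derive_cst (imC c) (0 : R) (1 : R)).
  have e2 := is_deriveM d2 (is_derive_cst (reC c) (0 : R) (1 : R)).
  apply: is_derive_eq (is_deriveD e1 e2) _.
  by rewrite !scaler0 !add0r /= ![_ *: _]mulrC.
by apply/funext => t; exact: imCM.
Qed.

Lemma cderiv_sum (I : Type) (r : seq I) (f : I -> R -> C) (v : I -> C) :
  (forall i, cderiv (f i) (v i)) ->
  cderiv (fun t => \sum_(i <- r) f i t) (\sum_(i <- r) v i).
Proof.
move=> H; elim: r => [|i r [IH1 IH2]].
  rewrite big_nil (_ : (fun t => _) = fun=> 0); last first.
    by apply/funext => t; rewrite big_nil.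
  by split; exact: is_derive_cst.
rewrite big_cons (_ : (fun t => _) = fun t => f i t + \sum_(j <- r) f j t); last first.
  by apply/funext => t; rewrite big_cons.
have [h1 h2] := H i; split.
  rewrite reCD (_ : (fun t => _) = fun t => reC (f i t) + reC (\sum_(j <- r) f j t)).
    exact: is_deriveD h1 IH1.
  by apply/funext => t; exact: reCD.
rewrite imCD (_ : (fun t => _) = fun t => imC (f i t) + imC (\sum_(j <- r) f j t)).
  exact: is_deriveD h2 IH2.
by apply/funext => t; exact: imCD.
Qed.

Lemma velocity_unique (c : R -> form11 M) v v' : velocity c v -> velocity c v' -> v = v'.
Proof.
move=> cv cv'; apply/funext => p; apply/matrixP => j k.
have [a1 a2] := cv p j k; have [b1 b2] := cv' p j k.
have val f a b (da : is_derive (0 : R) (1 : R) f a) (db : is_derive (0 : R) (1 : R) f b) :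
    a = b := etrans (esym (@derive_val _ _ _ _ _ _ _ da)) (@derive_val _ _ _ _ _ _ _ db).
by apply: cplx_eqP; [exact: val a1 b1 | exact: val a2 b2].
Qed.

(** At a point [p] the pullback is a fixed linear combination of the entries of the form at [g p],
    so it commutes with the derivative in [t]. *)
Lemma velocity_pullback (g : M -> M) (c : R -> form11 M) v :
  velocity c v -> velocity (pullback g \o c) (pullback g v).
Proof.
move=> cv p j k.
pose J := jac g p; pose e (w : form11 M) :=
  \sum_b \sum_a w (g p) a b * (J j a * adjmx J b k).
have eE w : pullback g w p j k = e w.
  rewrite /pullback mxE; apply: eq_bigr => b _; rewrite mxE mulr_suml.
  by apply: eq_bigr => a _; rewrite mulrAC mulrC.
have : cderiv (fun t => e (c t)) (e v).
  by apply: cderiv_sum => b; apply: cderiv_sum => a; apply: cderiv_mulr; exact: cv.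
rewrite -eE (_ : (fun t => e (c t)) = fun t => pullback g (c t) p j k) //.
by apply/funext => t; rewrite -eE.
Qed.

End Velocity.

Lemma sub_interchange (V : zmodType) (a b c d : V) : (a - b) - (c - d) = (a - c) - (b - d).
Proof. by rewrite !opprB addrACA [RHS]addrACA [- b - c]addrC. Qed.

Section LeviDifference.
Context {R : realType} {n : nat}.
Local Notation C := (Cplx R).

Lemma smooth_near_sub (V : normedModType R) (x : V) (f g : V -> R) :
  smooth_near x f -> smooth_near x g -> smooth_near x (fun y => f y - g y).
Proof.
move=> sf sg.
have sN : smooth_near x (fun y => (-1) *: g y).
  by apply: smooth_near_scale => //; exact: smooth_near_cst.
have sS := smooth_near_add sf sN.
rewrite (_ : (fun y => f y - g y) = fun y => f y + (-1) *: g y) //.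
by apply/funext => y; rewrite scaleN1r.
Qed.

Lemma derive2_sub (V : normedModType R) (x u v : V) (f g : V -> R) :
  smooth_near x f -> smooth_near x g ->
  'D_u ('D_v (fun y => f y - g y)) x = 'D_u ('D_v f) x - 'D_u ('D_v g) x.
Proof.
move=> sf sg.
have E : {near x, 'D_v (fun y => f y - g y) =1 fun y => 'D_v f y - 'D_v g y}.
  have nf := smooth_near_near sf; have ng := smooth_near_near sg.
  near=> y.
  have dfy : derivable f y v.
    by apply: diff_derivable; apply: smooth_near_differentiable; near: y; exact: nf.
  have dgy : derivable g y v.
    by apply: diff_derivable; apply: smooth_near_differentiable; near: y; exact: ng.
  exact: (deriveB dfy dgy).
apply: etrans (near_eq_derive u E) _.
have dD (k : V -> R) : smooth_near x k -> derivable ('D_v k) x u.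
  by move=> sk; apply: diff_derivable; apply: smooth_near_differentiable; exact: smooth_near_derive.
exact: (deriveB (dD f sf) (dD g sg)).
Unshelve. all: by end_near. Qed.

Lemma levi_sub (f g : 'rV[C]_n -> R) z :
  smooth_near (realify z) (f \o @cplxify R 1 n) ->
  smooth_near (realify z) (g \o @cplxify R 1 n) ->
  levi (fun y => f y - g y) z = levi f z - levi g z.
Proof.
move=> sf sg; apply/matrixP => i j.
have H u v := @derive2_sub _ (realify z) u v _ _ sf sg.
rewrite [LHS]mxE [RHS]mxE [in RHS]mxE [X in _ = _ + X]mxE [X in _ = _ - X]mxE.
apply: cplx_eqP; rewrite !(reCD, imCD, reCN, imCN) /reC /imC /=.
  rewrite -mulrBl; congr (_ / 4).
  apply: etrans (f_equal2 +%R (H (dirx R i) (dirx R j)) (H (diry R i) (diry R j))) _.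
  by rewrite opprD addrACA.
rewrite -mulrBl; congr (_ / 4).
apply: etrans (f_equal2 (fun a b => a - b) (H (dirx R i) (diry R j)) (H (diry R i) (dirx R j))) _.
exact: sub_interchange.
Qed.

End LeviDifference.

(** * Uniqueness of potentials up to constants *)

Section Potentials.
Context {R : realType} {n : nat} {M : charted R n}.
Hypotheses (hM : complex_manifold M) (cM : compact [set: M]) (coM : connected [set: M]).

Lemma iddbar_inj (phi psi : M -> R) : smooth_fun phi -> smooth_fun psi ->
  iddbar phi = iddbar psi -> exists c, forall q, phi q = psi q + c.
Proof.
move=> sphi spsi E.
have [||c cE] := @pluriharmonic_const _ _ _ hM (fun q => phi q - psi q) cM coM.
- move=> p; exact: (smooth_near_sub (sphi p) (spsi p)).
- move=> q; apply: etrans (levi_sub (sphi q) (spsi q)) _.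
  exact: (etrans (f_equal (fun w => w q - iddbar psi q) E) (subrr _)).
- by exists c => q; rewrite -(cE q) addrC subrK.
Qed.

End Potentials.

(** * Bergman spaces *)

Section BergmanDiffeomorphism.
Context {R : realType} {n : nat} {M : charted R n}.
Local Notation C := (Cplx R).
Hypothesis aM : atlas M.
Variable k : nat.

Definition bergman_orbit N (P : line_bundle M) (S : 'I_N.+1 -> M -> C) :=
  orbit_manifold (bergman_points P N k) (fun A => bergman_form k (act_basis A S)).

Section OneWay.
Variables (P P' : line_bundle M) (g h : M -> M) (N : nat).
Hypotheses (hg : holomorphic g) (hh : holomorphic h).
Hypotheses (gh : cancel g h) (hgK : cancel h g).
Hypothesis kdiff : forall T : 'I_N.+1 -> M -> C, is_basis P T ->
  forall p, differentiable (in_charts (kodaira_map T) p) (cmap (chart_at p) p).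
Variables S S' : 'I_N.+1 -> M -> C.
Hypotheses (bS : is_basis P S) (bS' : is_basis P' S').
Hypothesis bSg : is_basis P' (fun i => S i \o g).

Lemma pullback_omega : exists2 Q : 'M[C]_N.+1, SLn Q & forall A, SLn A ->
  pullback g (bergman_form k (act_basis A S)) = bergman_form k (act_basis (A *m Q) S').
Proof.
have [Q0 Qu SE] := basis_change bS' bSg; have [c c0 Sc] := unit_SL_scale Qu.
exists (c *: Q0) => // A SA.
have bA := act_basis_basis (SL_unit SA) bS.
apply: etrans (bergman_form_pullback aM k hg (kdiff bA)) _.
rewrite -scalemxAr; apply: etrans _ (esym (bergman_form_scale k (A *m Q0) S' c0)).
rewrite -act_basisM -SE //.
Qed.

Lemma bergman_smooth_map : smooth_map (bergman_orbit P S) (bergman_orbit P' S') (pullback g).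
Proof.
have [Q SQ QE] := pullback_omega.
exact: (orbit_smooth_map (bergman_points_SL k bS) (bergman_points_SL k bS') SQ QE).
Qed.

Lemma bergman_smooth_curve c : smooth_curve (bergman_orbit P S) c ->
  smooth_curve (bergman_orbit P' S') (pullback g \o c).
Proof.
have [Q SQ QE] := pullback_omega.
apply: (orbit_smooth_curve (bergman_points_SL k bS) (bergman_points_SL k bS') SQ QE
  (f' := pullback h)) => w.
- exact: (pullback_cancel aM w hh hg hgK).
- exact: (pullback_cancel aM w hg hh gh).
Qed.

End OneWay.

Variables (P : line_bundle M) (g h : M -> M) (N : nat).
Hypotheses (hg : holomorphic g) (hh : holomorphic h).
Hypotheses (gh : cancel g h) (hgK : cancel h g).
Hypothesis kdiff : forall T : 'I_N.+1 -> M -> C, is_basis P T ->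
  forall p, differentiable (in_charts (kodaira_map T) p) (cmap (chart_at p) p).
Variables S S' : 'I_N.+1 -> M -> C.
Hypotheses (bS : is_basis P S) (bS' : is_basis (pullback_bundle g P) S').

Lemma bergman_diffeomorphism :
  diffeomorphism (bergman_orbit P S) (bergman_orbit (pullback_bundle g P) S') (pullback g).
Proof.
split.
  exact: (bergman_smooth_map hg kdiff bS bS' (is_basis_comp aM hg hh gh hgK bS)).
exists (pullback h); split=> [|w _|w _].
- have kdiff' (T : 'I_N.+1 -> M -> C) : is_basis (pullback_bundle g P) T ->
      forall p, differentiable (in_charts (kodaira_map T) p) (cmap (chart_at p) p).
    move=> bT p.
    have bTh := is_basis_comp_inv aM hg hh gh hgK bT.
    have := kodaira_comp_differentiable aM hg (kdiff bTh) p.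
    rewrite (_ : (fun i => (T i \o h) \o g) = T) //.
    by apply/funext => i; apply/funext => x /=; rewrite gh.
  exact: (bergman_smooth_map hh kdiff' bS' bS (is_basis_comp_inv aM hg hh gh hgK bS')).
- exact: (pullback_cancel aM w hh hg hgK).
- exact: (pullback_cancel aM w hg hh gh).
Qed.

Lemma bergman_tangent_along w c phi : smooth_fun phi ->
  tangent_along (bergman_orbit P S) w c phi ->
  tangent_along (bergman_orbit (pullback_bundle g P) S') (pullback g w)
    (pullback g \o c) (phi \o g).
Proof.
move=> sphi [sc c0 _ vc]; split.
- exact: (bergman_smooth_curve hg hh gh hgK kdiff bS bS' (is_basis_comp aM hg hh gh hgK bS)).
- by rewrite /= c0.
- exact: (smooth_fun_comp aM aM hg sphi).
- by rewrite (iddbar_comp aM aM hg sphi); exact: velocity_pullback.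
Qed.

End BergmanDiffeomorphism.

Section BergmanIsometry.
Context {R : realType} {n : nat} {M : charted R n}.
Local Notation C := (Cplx R).
Hypotheses (hM : complex_manifold M) (cM : compact [set: M]) (coM : connected [set: M]).
Let aM := complex_manifold_atlas hM.
Variables (L : line_bundle M) (k : nat) (g h : M -> M) (N : nat).
Hypothesis hL : very_ample L.
Hypotheses (hg : holomorphic g) (hh : holomorphic h).
Hypotheses (gh : cancel g h) (hgK : cancel h g).
Variables S S' : 'I_N.+1 -> M -> C.
Hypotheses (bS : is_basis (power L k.+1) S).
Hypothesis (bS' : is_basis (pullback_bundle g (power L k.+1)) S').
Let B := bergman_orbit k.+1 (power L k.+1) S.
Let B' := bergman_orbit k.+1 (pullback_bundle g (power L k.+1)) S'.

Let kdiff (T : 'I_N.+1 -> M -> C) (bT : is_basis (power L k.+1) T) p :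
  differentiable (in_charts (kodaira_map T) p) (cmap (chart_at p) p).
Proof. exact: (kodaira_differentiable aM hL bT). Qed.

(** Existence of an image of [phi] is settled by [phi \o g] along any curve representing [phi]. For
    arbitrary related potentials, uniqueness of velocities leaves one link,
    [iddbar psi = pullback g (iddbar phi)], under which the metric has to be compared. *)
Lemma bergman_transports (G : metric (M := M)) :
  (forall w phi1 phi2 psi1 psi2, bergman_points (power L k.+1) N k.+1 w ->
     smooth_fun phi1 -> smooth_fun phi2 -> smooth_fun psi1 -> smooth_fun psi2 ->
     iddbar psi1 = pullback g (iddbar phi1) -> iddbar psi2 = pullback g (iddbar phi2) ->
     G (pullback g w) psi1 psi2 = G w phi1 phi2) ->
  transports B B' (pullback g) G G.
Proof.
move=> HG w pw; split=> [phi [c tc]|phi1 phi2 psi1 psi2 [c1 [t1 u1]] [c2 [t2 u2]]].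
  have [_ _ sphi _] := tc; exists (phi \o g), c.
  apply: (conj tc); exact: (bergman_tangent_along aM hg hh gh hgK kdiff bS bS' sphi tc).
have dE c phi psi : tangent_along B w c phi ->
    tangent_along B' (pullback g w) (pullback g \o c) psi ->
    iddbar psi = pullback g (iddbar phi).
  move=> [_ _ _ vc] [_ _ _ vc'].
  exact: (@velocity_unique _ _ _ (pullback g \o c) _ _ vc'
    (@velocity_pullback _ _ _ g c _ vc)).
have [_ _ s1 _] := t1; have [_ _ s2 _] := t2.
have [_ _ s1' _] := u1; have [_ _ s2' _] := u2.
exact: (HG w _ _ _ _ pw s1 s2 s1' s2' (dE _ _ _ t1 u1) (dE _ _ _ t2 u2)).
Qed.

Lemma bergman_isometry : [/\ diffeomorphism B B' (pullback g),
  transports B B' (pullback g) calabi calabi &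
  transports B B' (pullback g) mabuchi mabuchi].
Proof.
split.
- exact: (bergman_diffeomorphism aM _ hg hh gh hgK kdiff bS bS').
- apply: bergman_transports => w phi1 phi2 psi1 psi2 [T [bT wT]] _ _ _ _ e1 e2.
  apply: (calabi_pullback hM cM hg hh gh hgK _ e1 e2) => p.
  by rewrite wT; exact: (bergman_form_unit aM hL bT p).
- apply: bergman_transports => w phi1 phi2 psi1 psi2 [T [bT wT]] s1 s2 s1' s2' e1 e2.
  have wfin : (vol w [set: g_sigma_algebraType (@open M)] < +oo)%E.
    apply: (vol_finite hM cM) => p; rewrite wT.
    exact: (bergman_form_det_bounded aM hL bT hM p).
  have pot (phi psi : M -> R) : smooth_fun phi -> smooth_fun psi ->
      iddbar psi = pullback g (iddbar phi) -> exists c, psi = (fun q => phi q + c) \o g.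
    move=> sphi spsi e; have sc := smooth_fun_comp aM aM hg sphi.
    have [|c cE] := iddbar_inj hM cM coM spsi sc.
      exact: etrans e (esym (iddbar_comp aM aM hg sphi)).
    by exists c; apply/funext => q; exact: cE.
  have [c1 ->] := pot _ _ s1 s1' e1; have [c2 ->] := pot _ _ s2 s2' e2.
  apply: etrans (mabuchi_pullback hM cM w hg hh gh hgK _ _) _.
  by apply: (mabuchi_add_cst cM wfin); exact: (smooth_fun_continuous hM).
Qed.

End BergmanIsometry.

Theorem proposition1p1 (R : realType) (n : nat) (M : charted R n)
    (L : line_bundle M) (k : nat) (gamma : M -> M)
    (S : 'I_(projdim L k).+1 -> M -> Cplx R)
    (S' : 'I_(projdim (pullback_bundle gamma L) k).+1 -> M -> Cplx R)
    (hM : projective_manifold M) (hL : very_ample L) (hk : (1 <= k)%N)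
    (hgamma : automorphism gamma)
    (hS : is_basis (power L k) S)
    (hS' : is_basis (power (pullback_bundle gamma L) k) S') :
  let B := bergman_manifold S in
  let B' := bergman_manifold S' in
  [/\ diffeomorphism B B' (pullback gamma),
      transports B B' (pullback gamma) calabi calabi &
      transports B B' (pullback gamma) mabuchi mabuchi].
Proof.
case: k hk S S' hS hS' => [hk|k _] S S' hS hS'; first by discriminate hk.
have [cM kM coM _] := hM; have [hg [h [hh gh hgK]]] := hgamma.
have aM := complex_manifold_atlas cM.
have E : projdim L k.+1 = projdim (pullback_bundle gamma L) k.+1.
  exact: (f_equal predn (esym (dimH0_pullback aM hg hh gh hgK (power L k.+1)))).
(* With [N'] a variable, the equality of dimensions can be eliminated together with the type of the
   second basis. The power of the pulled-back bundle and the pullback of the power agree by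
   computation, as do [bergman_orbit] and [bergman_manifold]. *)
suff H N' (E' : projdim L k.+1 = N') (T : 'I_N'.+1 -> M -> Cplx R) :
    is_basis (pullback_bundle gamma (power L k.+1)) T ->
  [/\ diffeomorphism (bergman_orbit k.+1 (power L k.+1) S)
        (bergman_orbit k.+1 (pullback_bundle gamma (power L k.+1)) T) (pullback gamma),
      transports (bergman_orbit k.+1 (power L k.+1) S)
        (bergman_orbit k.+1 (pullback_bundle gamma (power L k.+1)) T)
        (pullback gamma) calabi calabi &
      transports (bergman_orbit k.+1 (power L k.+1) S)
        (bergman_orbit k.+1 (pullback_bundle gamma (power L k.+1)) T)
        (pullback gamma) mabuchi mabuchi].
  exact: (H _ E S' hS').
case: N' / E' T => T hT.
exact: (bergman_isometry cM kM coM hL hg hh gh hgK hS hT).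
Qed.
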